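(* Let $R$ be a Cohen-Macaulay local ring with canonical module $\omega$. If $\Omega\mathrm{CM}^{\times}(R)$ is closed under the canonical duality functor $D(-)=\mathrm{Hom}_R(-,\omega)$ (that is, $DM\in\Omega\mathrm{CM}^{\times}(R)$ whenever $M\in\Omega\mathrm{CM}^{\times}(R)$), then $$\mathrm{ca}(R)=\underline{\mathrm{ann}}_R(\mathrm{CM}(R)).$$
   Context: All rings are commutative Noetherian local and all modules are finitely generated; $\mathrm{mod}\,R$ is the category of finitely generated $R$-modules and $\mathrm{CM}(R)$ is the category of maximal Cohen-Macaulay $R$-modules. Syzygies: given a surjection $P\to M$ with $P$ a (finitely generated) projective module, its kernel is called a syzygy of $M$, denoted $\Omega M$; it is unique up to projective summands. $\Omega\mathrm{CM}(R)$ is the category of modules that are syzygies of maximal Cohen-Macaulay modules, and $\Omega\mathrm{CM}^{\times}(R)$ is the category of those modules in $\Omega\mathrm{CM}(R)$ that have no nonzero free direct summand. Stable annihilator: $\underline{\mathrm{End}}_R(M)$ is the quotient of $\mathrm{End}_R(M)$ by the submodule of endomorphisms factoring through a projective module, and $\underline{\mathrm{ann}}_R(M)$ is the annihilator in $R$ of $\underline{\mathrm{End}}_R(M)$; equivalently, $r\in\underline{\mathrm{ann}}_R(M)$ iff multiplication by $r$ on $M$ factors through a projective module. For a subcategory $\mathcal X$ of $\mathrm{mod}\,R$, $\underline{\mathrm{ann}}_R(\mathcal X)=\bigcap_{M\in\mathcal X}\underline{\mathrm{ann}}_R(M)$. Cohomology annihilator: for $n\ge 1$, $\mathrm{ca}^n(R)=\{r\in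 R: r\,\mathrm{Ext}_R^{i}(M,N)=0 \text{ for all } i\ge n \text{ and all } M,N\in\mathrm{mod}\,R\}$, and $\mathrm{ca}(R)=\bigcup_{n}\mathrm{ca}^n(R)$. *)

(* Defs.v *)
From HB Require Import structures.
From mathcomp Require Import all_boot all_order all_algebra.
From mathcomp Require Import ring_quotient.
From mathcomp Require Import boolp classical_sets.

Set Implicit Arguments.
Unset Strict Implicit.
Unset Printing Implicit Defensive.

Import GRing.Theory.

Local Open Scope classical_set_scope.
Local Open Scope ring_scope.

Section LocalAlgebra.
Variable R : comNzRingType.

Definition submodule (V : lmodType R) (U : submodClosed V) : Type :=
  {v : V | v \in U}.

HB.instance Definition _ (V : lmodType R) (U : submodClosed V) :=
  SubChoice.on (submodule U).
HB.instance Definition _ (V : lmodType R) (U : submodClosed V) :=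
  [SubChoice_isSubLmodule of submodule U by <:].

(* A submodule is closed under opposites, which [submodClosed] does not record. *)
Definition submod_pred (V : lmodType R) (U : submodClosed V) : {pred V} :=
  fun v => v \in U.

Lemma submod_pred_zmod (V : lmodType R) (U : submodClosed V) :
  zmod_closed (submod_pred U).
Proof.
split=> [|u v]; first exact: (rpred0 U).
rewrite -![_ \in submod_pred U]/(_ \in U) => uU vU.
by rewrite rpredD // -scaleN1r rpredZ.
Qed.

HB.instance Definition _ (V : lmodType R) (U : submodClosed V) :=
  GRing.isZmodClosed.Build V (submod_pred U) (submod_pred_zmod U).

Definition quotmodule (V : lmodType R) (U : submodClosed V) : Type :=
  Quotient.quot (submod_pred U).

Section Quotient.
Variables (V : lmodType R) (U : submodClosed V).
Local Notation Q := (quotmodule U).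

HB.instance Definition _ := GRing.Zmodule.on Q.

Definition quotmodule_pi (v : V) : Q := \pi_(Quotient.quot (submod_pred U))%qT v.

Definition quotmodule_scale (a : R) (x : Q) : Q :=
  quotmodule_pi (a *: repr (x : Quotient.quot (submod_pred U))).

Lemma quotmodule_piP u v : u - v \in U <-> quotmodule_pi u = quotmodule_pi v.
Proof.
rewrite -[_ \in U]/(_ \in submod_pred U) Quotient.idealrBE.
by split=> /eqP.
Qed.

Lemma quotmodule_reprK (x : Q) :
  quotmodule_pi (repr (x : Quotient.quot (submod_pred U))) = x.
Proof. by rewrite /quotmodule_pi reprK. Qed.

Lemma quotmodule_piD u v :
  quotmodule_pi (u + v) = quotmodule_pi u + quotmodule_pi v.
Proof. exact: (raddfD (\pi_(Quotient.quot (submod_pred U))%qT)). Qed.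

Lemma quotmodule_piZ a v :
  quotmodule_pi (a *: v) = quotmodule_scale a (quotmodule_pi v).
Proof.
apply/quotmodule_piP; rewrite -scalerBr rpredZ //.
by apply/quotmodule_piP; rewrite quotmodule_reprK.
Qed.

Lemma quotmodule_scaleA a b (x : Q) :
  quotmodule_scale a (quotmodule_scale b x) = quotmodule_scale (a * b) x.
Proof. by rewrite -(quotmodule_reprK x) -!quotmodule_piZ scalerA. Qed.

Lemma quotmodule_scale1 : left_id 1 quotmodule_scale.
Proof.
by move=> x; rewrite -(quotmodule_reprK x) -quotmodule_piZ scale1r.
Qed.

Lemma quotmodule_scaleDr : right_distributive quotmodule_scale +%R.
Proof.
move=> a x y; rewrite -(quotmodule_reprK x) -(quotmodule_reprK y).
by rewrite -quotmodule_piD -!quotmodule_piZ scalerDr quotmodule_piD.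
Qed.

Lemma quotmodule_scaleDl (x : Q) :
  {morph quotmodule_scale^~ x : a b / a + b}.
Proof.
move=> a b; rewrite -(quotmodule_reprK x).
by rewrite -!quotmodule_piZ scalerDl quotmodule_piD.
Qed.

HB.instance Definition _ := GRing.Zmodule_isLmodule.Build R Q
  quotmodule_scaleA quotmodule_scale1 quotmodule_scaleDr quotmodule_scaleDl.

Lemma quotmodule_pi_linear : linear quotmodule_pi.
Proof. by move=> a u v; rewrite quotmodule_piD quotmodule_piZ. Qed.

HB.instance Definition _ :=
  GRing.isLinear.Build R V Q _ quotmodule_pi quotmodule_pi_linear.

End Quotient.

Definition HomR (U V : lmodType R) : Type := {linear U -> V}.

Section Hom.
Variables U V : lmodType R.
Local Notation H := (HomR U V).

Lemma HomP (f g : H) : (f : U -> V) =1 (g : U -> V) -> f = g.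
Proof.
case: f => f [[f1] [f2]]; case: g => g [[g1] [g2]] /= /funext fg.
case: _ / fg in g1 g2 *.
by rewrite (Prop_irrelevance f1 g1) (Prop_irrelevance f2 g2).
Qed.

HB.instance Definition _ := gen_eqMixin H.
HB.instance Definition _ := gen_choiceMixin H.

Definition Hom_zero : H := (\0 : U -> V).
Definition Hom_opp (f : H) : H := \- (f : {linear U -> V}).
Definition Hom_add (f g : H) : H :=
  (f : {linear U -> V}) \+ (g : {linear U -> V}).

Lemma Hom_addA : associative Hom_add.
Proof. by move=> f g h; apply: HomP => x /=; rewrite addrA. Qed.

Lemma Hom_addC : commutative Hom_add.
Proof. by move=> f g; apply: HomP => x /=; rewrite addrC. Qed.

Lemma Hom_add0 : left_id Hom_zero Hom_add.
Proof. by move=> f; apply: HomP => x /=; rewrite add0r. Qed.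

Lemma Hom_addN : left_inverse Hom_zero Hom_opp Hom_add.
Proof. by move=> f; apply: HomP => x /=; rewrite addNr. Qed.

HB.instance Definition _ :=
  GRing.isZmodule.Build H Hom_addA Hom_addC Hom_add0 Hom_addN.

Definition Hom_scale (a : R) (f : H) : H := a \*: (f : {linear U -> V}).

Lemma Hom_scaleA a b (f : H) :
  Hom_scale a (Hom_scale b f) = Hom_scale (a * b) f.
Proof. by apply: HomP => x /=; rewrite scalerA. Qed.

Lemma Hom_scale1 : left_id 1 Hom_scale.
Proof. by move=> f; apply: HomP => x /=; rewrite scale1r. Qed.

Lemma Hom_scaleDr : right_distributive Hom_scale +%R.
Proof. by move=> a f g; apply: HomP => x /=; rewrite scalerDr. Qed.

Lemma Hom_scaleDl (f : H) : {morph Hom_scale^~ f : a b / a + b}.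
Proof. by move=> a b; apply: HomP => x /=; rewrite scalerDl. Qed.

HB.instance Definition _ := GRing.Zmodule_isLmodule.Build R H
  Hom_scaleA Hom_scale1 Hom_scaleDr Hom_scaleDl.

End Hom.

Definition surjective (A B : Type) (f : A -> B) : Prop :=
  forall y, exists x, f x = y.

Definition exact (U V W : lmodType R) (f : {linear U -> V})
    (g : {linear V -> W}) : Prop :=
  forall y, g y = 0 <-> exists x, f x = y.

Definition isomorphic (U V : lmodType R) : Prop :=
  exists f : {linear U -> V}, bijective f.

Definition fin_gen (M : lmodType R) : Prop :=
  exists (n : nat) (g : 'I_n -> M),
    forall x, exists c : 'I_n -> R, x = \sum_(i < n) c i *: g i.

Definition projective (P : lmodType R) : Prop :=
  forall (M N : lmodType R) (p : {linear M -> N}) (g : {linear P -> N}),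
    surjective p -> exists h : {linear P -> M}, forall x, p (h x) = g x.

Definition injective_module (E : lmodType R) : Prop :=
  forall (M N : lmodType R) (i : {linear M -> N}) (g : {linear M -> E}),
    injective i -> exists h : {linear N -> E}, forall x, h (i x) = g x.

Definition ann (M : lmodType R) : set R := [set r | forall x : M, r *: x = 0].

Definition factors_proj (M : lmodType R) (f : HomR M M) : Prop :=
  exists (P : lmodType R) (a : {linear M -> P}) (b : {linear P -> M}),
    [/\ fin_gen P, projective P & forall x, f x = b (a x)].

Definition proj_endo (M : lmodType R) : {pred HomR M M} :=
  fun f => `[< factors_proj f >].

Definition pair_fun (U V W : lmodType R) (f : {linear U -> V})
    (g : {linear U -> W}) (x : U) : V * W := (f x, g x).

Lemma pair_fun_linear (U V W : lmodType R) (f : {linear U -> V})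
  (g : {linear U -> W}) : linear (pair_fun f g).
Proof. by move=> a x y; rewrite /pair_fun !linearP. Qed.

HB.instance Definition _ (U V W : lmodType R) (f : {linear U -> V})
    (g : {linear U -> W}) :=
  GRing.isLinear.Build R U (V * W)%type _ (pair_fun f g) (pair_fun_linear f g).

Lemma fin_gen_pair (P Q : lmodType R) :
  fin_gen P -> fin_gen Q -> fin_gen (P * Q)%type.
Proof.
move=> [m [g gP]] [n [h hP]].
exists (m + n)%N, (fun i => match split i with
  | inl j => (g j, 0) | inr j => (0, h j) end) => -[x y].
have [c ->] := gP x; have [d ->] := hP y.
exists (fun i => match split i with inl j => c j | inr j => d j end).
have splitl i : split (lshift n i) = inl i := unsplitK (inl i).
have splitr i : split (rshift m i) = inr i := unsplitK (inr i).
rewrite big_split_ord /=.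
under [X in _ = X + _]eq_bigr do rewrite splitl.
under [X in _ = _ + X]eq_bigr do rewrite splitr.
rewrite [RHS]surjective_pairing !raddfD /= !(raddf_sum fst) !(raddf_sum snd) /=.
congr pair.
- by rewrite [X in _ + X]big1 ?addr0 // => i _; exact: scaler0.
- by rewrite [X in X + _]big1 ?add0r // => i _; exact: scaler0.
Qed.

Lemma projective_pair (P Q : lmodType R) :
  projective P -> projective Q -> projective (P * Q)%type.
Proof.
move=> prP prQ M N p g psurj.
pose inP : {linear P -> (P * Q)%type} := pair_fun idfun \0.
pose inQ : {linear Q -> (P * Q)%type} := pair_fun \0 idfun.
have [hP hPE] := prP _ _ p (g \o inP) psurj.
have [hQ hQE] := prQ _ _ p (g \o inQ) psurj.
exists ((hP \o fst) \+ (hQ \o snd)) => -[x y] /=.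
rewrite raddfD /= hPE hQE /= -raddfD; congr (g _).
by congr pair; rewrite /= ?addr0 ?add0r.
Qed.

Lemma proj_endo_submod (M : lmodType R) : submod_closed (@proj_endo M).
Proof.
split=> [|r f g /asboolP[P [a [b [fP pP fE]]]] /asboolP[Q [c [d [fQ pQ gE]]]]].
  have z (x : 'rV[R]_0) : x = 0 by exact: thinmx0.
  apply/asboolP; exists 'rV[R]_0, \0, \0; split=> //.
  - by exists 0, (fun=> 0) => x; exists (fun=> 0); rewrite big_ord0.
  - by move=> U V p g _; exists \0 => x; rewrite /= (z x) !raddf0.
apply/asboolP; exists (P * Q)%type, (pair_fun a c).
exists ((r \*: b \o fst) \+ (d \o snd)); split.
- exact: fin_gen_pair.
- exact: projective_pair.
- move=> x; rewrite -[LHS]/(r *: (f : {linear M -> M}) x + (g : {linear M -> M}) x).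
  by rewrite fE gE.
Qed.

HB.instance Definition _ (M : lmodType R) :=
  GRing.isSubmodClosed.Build R (HomR M M) (@proj_endo M) (@proj_endo_submod M).

Definition stable_End (M : lmodType R) : lmodType R :=
  quotmodule (@proj_endo M).

Definition stable_ann (X : lmodType R -> Prop) : set R :=
  [set r | forall M : lmodType R, X M -> ann (stable_End M) r].

Record resolution (M : lmodType R) := Resolution {
  res_mod : nat -> lmodType R;
  res_d : forall i, {linear res_mod i.+1 -> res_mod i};
  res_aug : {linear res_mod 0%N -> M};
  res_fin_gen : forall i, fin_gen (res_mod i);
  res_projective : forall i, projective (res_mod i);
  res_aug_surj : surjective res_aug;
  res_exact0 : exact (res_d 0%N) res_aug;
  res_exactS : forall i, exact (res_d i.+1) (res_d i)
}.

Section Ext.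
Variables (M : lmodType R) (F : resolution M) (N : lmodType R).

Definition cocycle (i : nat) : {pred HomR (res_mod F i) N} :=
  fun f => `[< forall x, f (res_d F i x) = 0 >].

Lemma cocycle_submod i : submod_closed (@cocycle i).
Proof.
split=> [|a f g /asboolP fP /asboolP gP]; apply/asboolP=> x //=.
by rewrite fP gP scaler0 addr0.
Qed.

HB.instance Definition _ i :=
  GRing.isSubmodClosed.Build R (HomR (res_mod F i) N) (@cocycle i)
    (@cocycle_submod i).

Definition is_coboundary (i : nat) : HomR (res_mod F i) N -> Prop :=
  match i with
  | 0 => fun f => f = 0
  | j.+1 => fun f =>
      exists g : HomR (res_mod F j) N, forall x, f x = g (res_d F j x)
  end.

Definition coboundary (i : nat) : {pred submodule (@cocycle i)} :=
  fun f => `[< is_coboundary (val f) >].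

Lemma coboundary_submod i : submod_closed (@coboundary i).
Proof.
split=> [|a f g /asboolP fP /asboolP gP]; apply/asboolP.
  case: i => [|i] //=; exists 0 => x //.
case: i f g fP gP => [|i] f g /=; first by move=> -> ->; rewrite scaler0 addr0.
move=> [f' fE] [g' gE]; exists (a *: f' + g') => x /=.
by rewrite -[LHS]/(a *: val f x + val g x) fE gE.
Qed.

HB.instance Definition _ i :=
  GRing.isSubmodClosed.Build R (submodule (@cocycle i)) (@coboundary i)
    (@coboundary_submod i).

(* The [i]-th cohomology of [Hom(F, N)]; up to isomorphism it does not depend
   on the resolution [F] of [M]. *)
Definition Ext (i : nat) : lmodType R := quotmodule (@coboundary i).

End Ext.

Definition ca_n (n : nat) : set R :=
  [set r | forall i : nat, (n <= i)%N ->
     forall M N : lmodType R, fin_gen M -> fin_gen N ->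
     forall F : resolution M, ann (Ext F N i) r].

Definition ca : set R := \bigcup_(n in [set n : nat | (1 <= n)%N]) ca_n n.

Definition noetherian : Prop :=
  forall I : submodClosed R^o, fin_gen (submodule I).

(* [idealr] only contains proper ideals. *)
Definition maximal_ideal (m : idealr R) : Prop :=
  forall J : idealr R, {subset m <= J} -> {subset J <= m}.

Definition local_ring (m : idealr R) : Prop :=
  maximal_ideal m /\ forall m' : idealr R, maximal_ideal m' -> m' =i m.

Definition prime_chain (n : nat) (p : nat -> prime_idealr R) : Prop :=
  forall i : nat, (i < n)%N ->
    {subset p i <= p i.+1} /\ ~ {subset p i.+1 <= p i}.

Definition krull_dim (n : nat) : Prop :=
  (exists p, prime_chain n p) /\
  forall (k : nat) p, prime_chain k p -> (k <= n)%N.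

Definition seq_mul (s : seq R) (M : lmodType R) : set M :=
  [set u | exists v : 'I_(size s) -> M, u = \sum_(i < size s) s`_i *: v i].

Definition regular_seq (s : seq R) (M : lmodType R) : Prop :=
  (forall i : nat, (i < size s)%N -> forall u : M,
     seq_mul (take i s) (s`_i *: u) -> seq_mul (take i s) u) /\
  exists u : M, ~ seq_mul s u.

Definition ideal_pred (m : idealr R) : {pred R^o} := fun x => (x : R) \in m.

Lemma ideal_pred_submod m : submod_closed (ideal_pred m).
Proof.
split=> [|a x y xm ym]; first exact: (rpred0 m).
by apply: (rpredD (S := m)) => //; exact: (idealMr (idealrI := m)).
Qed.

HB.instance Definition _ m :=
  GRing.isSubmodClosed.Build R R^o (ideal_pred m) (ideal_pred_submod m).

Definition residue_module (m : idealr R) : lmodType R :=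
  quotmodule (ideal_pred m).

Section LocalRing.
Variable m : idealr R.

Definition depth (M : lmodType R) (n : nat) : Prop :=
  (exists s : seq R, [/\ {subset s <= m}, regular_seq s M & size s = n]) /\
  forall s : seq R, {subset s <= m} -> regular_seq s M -> (size s <= n)%N.

(* The zero module counts as maximal Cohen-Macaulay. *)
Definition CM (M : lmodType R) : Prop :=
  fin_gen M /\
  ((forall x : M, x = 0) \/ exists n : nat, krull_dim n /\ depth M n).

Definition CM_local_ring : Prop :=
  [/\ noetherian, local_ring m & CM R^o].

Definition finite_injdim (W : lmodType R) : Prop :=
  exists (n : nat) (E : nat -> lmodType R) (e : {linear W -> E 0%N})
      (d : forall i, {linear E i -> E i.+1}),
    [/\ forall i, injective_module (E i),
        injective e,
        exact e (d 0%N),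
        forall i, exact (d i) (d i.+1)
      & forall i, (n < i)%N -> forall x : E i, x = 0].

(* With [k] the residue field and [t] the depth of [W], the type of [W] is
   [dim_k Ext^t(k, W)]; it is one when this [k]-vector space is a copy of [k]. *)
Definition type_one (W : lmodType R) : Prop :=
  exists t : nat, depth W t /\
    forall F : resolution (residue_module m),
      isomorphic (Ext F W t) (residue_module m).

(* Bruns and Herzog, Cohen-Macaulay Rings, Definition 3.3.1. *)
Definition canonical_module (W : lmodType R) : Prop :=
  [/\ CM W, finite_injdim W & type_one W].

Definition syzygy_of (K X : lmodType R) : Prop :=
  exists (P : lmodType R) (i : {linear K -> P}) (p : {linear P -> X}),
    [/\ fin_gen P /\ projective P, injective i, exact i p & surjective p].

Definition OmegaCM (K : lmodType R) : Prop :=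
  exists X : lmodType R, CM X /\ syzygy_of K X.

Definition no_free_summand (M : lmodType R) : Prop :=
  forall (n : nat) (N : lmodType R),
    isomorphic M ('rV[R]_n * N)%type -> n = 0%N.

Definition OmegaCMx (M : lmodType R) : Prop := OmegaCM M /\ no_free_summand M.

End LocalRing.

End LocalAlgebra.

Arguments ca_n R n : clear implicits.
Arguments ca R : clear implicits.
Arguments noetherian R : clear implicits.
Arguments krull_dim R n : clear implicits.

(* Main.v *)
From HB Require Import structures.
Require Import Defs.
From mathcomp Require Import all_boot all_algebra ring_quotient.
From mathcomp Require Import boolp classical_sets ring zify.

(* Write [D] for the duality [Hom(-, w)] and [A_0 = A, A_1, A_2, ...] for the
   minimal syzygies of a maximal Cohen-Macaulay module [A].

   If [r] kills [Ext^n], then multiplication by [r] on [A_(n-1)] factors through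
   a projective module, because it does so as soon as [r] annihilates the class
   of [0 -> A_n -> F_(n-1) -> A_(n-1) -> 0].  The hypothesis allows to descend
   from [B = A_(j+1)] to [A_j].  As [Ext^1(A_j, w) = 0], every map [B -> w]
   extends to [F_j]; hence [B] has no free summand, so [D B] embeds in a free
   module [G] with Cohen-Macaulay cokernel, and dualizing gives a surjection
   [D G -> D D B = B].  If multiplication by [r] on [B] factors through a
   projective module, it lifts to a map [B -> D G], which extends to [F_j] since
   [D G] is a summand of a power of [w].  So [r] kills the class of
   [0 -> B -> F_j -> A_j -> 0], that is, [r] factors through [F_j] on [A_j].

   The biduality [A = D D A] rests on [Hom(w, w) = R].  With [y] a maximal
   [w]-regular sequence, [Ext^d(-, w)] is right exact on finitely generated
   modules, the socle of [w / y w] is one-dimensional, and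
   [Ext^d(w / y w, w) = Hom(w, w) / y Hom(w, w)], so [Hom(w, w)] is cyclic.
   Faithfulness of [w] comes from [Ext^d(R / x, w) = w / x w] for a maximal
   [R]-regular sequence [x]. *)

Set Implicit Arguments.
Unset Strict Implicit.
Unset Printing Implicit Defensive.

Import GRing.Theory.

Local Open Scope ring_scope.

(** * Linear maps from graphs, submodules, quotients, and modules of homomorphisms *)

Section LinearMaps.
Variable R : comNzRingType.
Implicit Types U V W N P Q : lmodType R.

(** The overview treats [ca R] inside [stable_ann]. The other inclusion is soft: in any projective
    resolution the cokernels from step [dim] on are maximal Cohen-Macaulay, and an [r] that factors
    through a projective module on them kills all later Ext. Two computations of Ext coexist. The
    definitions use projective resolutions of the first argument, but the duality arguments vary
    that argument, which a fixed injective resolution of [w] allows without comparing resolutions.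
    The two are matched only for the residue field, where the type of [w] and the vanishing below
    [dim] are stated as linear relations between classes, so that no vector space dimension occurs.
    Being Cohen-Macaulay, [w] brings a regular sequence [y] unrelated to the sequence [x] of [R].
    While [y] suffices to compute [Hom(w, w)], purity and the depth of duals need one sequence that
    is regular on all modules at once; hence [x] has to be shown regular on [w] as well. Syzygies
    are taken minimal because a free summand would then force [w = m w]. *)

Lemma linear_graph U V (r : U -> V -> Prop) :
  (forall x, exists y, r x y) ->
  (forall a x x' y y', r x y -> r x' y' -> r (a *: x + x') (a *: y + y')) ->
  (forall y, r 0 y -> y = 0) ->
  exists h : {linear U -> V}, forall x y, r x y <-> h x = y.
Proof.
move=> tot lin r0.
(* Linearity and the condition at [0] make [r] single-valued, so any choice function is linear. Maps
   that involve a choice of preimages are built this way throughout. *)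
have runiq x y y' : r x y -> r x y' -> y = y'.
  move=> rxy rxy'; have := lin (-1) _ _ _ _ rxy rxy'.
  by rewrite !scaleN1r addNr => /r0 /eqP; rewrite addrC subr_eq0 => /eqP.
have [f fP] := choice tot.
have f_lin : linear f.
  by move=> a x y; apply: (runiq (a *: x + y)) => //; apply: lin.
pose F := HB.pack_for {linear U -> V} f (GRing.isLinear.Build R U V _ f f_lin).
exists F => x y; split=> [rxy|<-]; last exact: fP.
by apply: (runiq x) => //; exact: fP.
Qed.

Definition submodP V (P : V -> Prop) : Prop :=
  P 0 /\ forall a x y, P x -> P y -> P (a *: x + y).

(** The proof [hP] is an argument so that the closure instance can be attached to the predicate
    itself. *)
Definition submod_bool V (P : V -> Prop) (hP : submodP P) : {pred V} :=
  fun v => `[< P v >].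

Lemma submod_boolP V (P : V -> Prop) (hP : submodP P) :
  submod_closed (submod_bool hP).
Proof.
case: (hP) => P0 PD; split=> [|a x y /asboolP Px /asboolP Py]; apply/asboolP => //.
exact: PD.
Qed.

HB.instance Definition _ V (P : V -> Prop) (hP : submodP P) :=
  GRing.isSubmodClosed.Build R V (submod_bool hP) (submod_boolP hP).

(** Submodules and quotients are used through an embedding or a projection with prescribed image or
    kernel, not through their carriers. *)
Definition is_sub V (P : V -> Prop) U (i : {linear U -> V}) : Prop :=
  injective i /\ forall v, P v <-> exists u, i u = v.

Definition is_quot V (P : V -> Prop) Q (p : {linear V -> Q}) : Prop :=
  surjective p /\ forall v, P v <-> p v = 0.

Lemma submod_sub V (P : V -> Prop) :
  submodP P -> exists U (i : {linear U -> V}), is_sub P i.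
Proof.
move=> hP; exists (submodule (submod_bool hP) : lmodType R).
have lin : linear (val : submodule (submod_bool hP) -> V) by [].
exists (HB.pack_for {linear (submodule (submod_bool hP)) -> V}
   (val : submodule (submod_bool hP) -> V)
   (GRing.isLinear.Build R (submodule (submod_bool hP)) V _ _ lin)).
split; first exact: val_inj.
move=> v; split=> [Pv|[[u Pu] /= <-]]; last exact/asboolP.
have bv : v \in submod_bool hP by exact/asboolP.
by exists (exist _ v bv).
Qed.

Lemma submod_quot V (P : V -> Prop) :
  submodP P -> exists Q (p : {linear V -> Q}), is_quot P p.
Proof.
move=> hP; exists (quotmodule (submod_bool hP) : lmodType R).
exists (@quotmodule_pi _ _ (submod_bool hP) : {linear _ -> _}); split.
  by move=> y; exists (repr (y : Quotient.quot (submod_pred (submod_bool hP))));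
    exact: quotmodule_reprK.
move=> v; rewrite -[X in _ <-> _ = X](linear0 (@quotmodule_pi _ _ (submod_bool hP))).
rewrite -quotmodule_piP subr0.
by split=> [Pv|/asboolP //]; exact/asboolP.
Qed.

Lemma factor_quot V W Q (p : {linear V -> Q}) (f : {linear V -> W}) :
  surjective p -> (forall v, p v = 0 -> f v = 0) ->
  exists g : {linear Q -> W}, forall v, g (p v) = f v.
Proof.
move=> ps kf.
have [|a x x' y y' [v <- <-] [v' <- <-]|y [v pv <-]|g gP] :=
    @linear_graph Q W (fun q w => exists2 v, p v = q & f v = w).
- by move=> x; have [v <-] := ps x; exists (f v), v.
- by exists (a *: v + v'); rewrite linearP.
- exact: kf.
by exists g => v; apply/gP; exists v.
Qed.

Lemma factor_sub U V N (i : {linear U -> V}) (f : {linear N -> V}) :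
  injective i -> (forall n, exists u, i u = f n) ->
  exists g : {linear N -> U}, forall n, i (g n) = f n.
Proof.
move=> inj_i imf.
have [|a x x' y y' iy iy'|y iy|g gP] :=
    @linear_graph N U (fun n u => i u = f n).
- by move=> x; have [u iu] := imf x; exists u.
- by rewrite !linearP iy iy'.
- by apply: inj_i; rewrite iy !linear0.
by exists g => n; apply/gP.
Qed.

Lemma submodP_ker V W (f : {linear V -> W}) : submodP (fun v => f v = 0).
Proof.
by split=> [|a x y fx fy]; rewrite ?linear0 // linearP fx fy scaler0 addr0.
Qed.

Lemma submodP_im V W (f : {linear V -> W}) :
  submodP (fun w => exists v, f v = w).
Proof.
split=> [|a x y [u <-] [v <-]]; first by exists 0; rewrite linear0.
by exists (a *: u + v); rewrite linearP.
Qed.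

Lemma submodP_sum V (P : V -> Prop) (hP : submodP P) (I : finType)
  (c : I -> R) (g : I -> V) : (forall i, P (g i)) -> P (\sum_i c i *: g i).
Proof.
case: hP => P0 PD Pg; elim/big_ind: _ => // [x y Px Py|i _].
  by rewrite -[x]scale1r; apply: PD.
by rewrite -[X in P X]addr0; apply: PD.
Qed.

Lemma submodPD V (P : V -> Prop) (hP : submodP P) x y : P x -> P y -> P (x + y).
Proof. by move=> Px Py; rewrite -[x]scale1r; apply: hP.2. Qed.

Lemma submodPZ V (P : V -> Prop) (hP : submodP P) a x : P x -> P (a *: x).
Proof. by move=> Px; rewrite -[X in P X]addr0; apply: hP.2 => //; exact: hP.1. Qed.

Lemma submodPB V (P : V -> Prop) (hP : submodP P) x y : P x -> P y -> P (x - y).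
Proof. by move=> Px Py; rewrite addrC -scaleN1r; apply: hP.2. Qed.

Definition ses U V W (i : {linear U -> V}) (p : {linear V -> W}) : Prop :=
  [/\ injective i, exact i p & surjective p].

Lemma ses_sub V W (p : {linear V -> W}) : surjective p ->
  exists U (i : {linear U -> V}), ses i p.
Proof.
move=> ps; have [U [i [inj_i iP]]] := submod_sub (submodP_ker p).
by exists U, i; split.
Qed.

Lemma ses_quot U V (i : {linear U -> V}) : injective i ->
  exists W (p : {linear V -> W}), ses i p.
Proof.
move=> inj_i; have [W [p [ps pP]]] := submod_quot (submodP_im i).
by exists W, p; split=> // y; rewrite pP.
Qed.

Lemma ses_comp0 U V W (i : {linear U -> V}) (p : {linear V -> W}) u :
  ses i p -> p (i u) = 0.
Proof. by case=> _ ex _; apply/ex; exists u. Qed.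

Definition comb n V (g : 'I_n -> V) (u : 'rV[R]_n) : V := \sum_j u 0 j *: g j.

Lemma comb_linear n V (g : 'I_n -> V) : linear (comb g).
Proof.
move=> a u v; rewrite /comb scaler_sumr -big_split /=; apply: eq_bigr => j _.
by rewrite !mxE scalerDl scalerA.
Qed.

HB.instance Definition _ n V (g : 'I_n -> V) :=
  GRing.isLinear.Build R 'rV[R]_n V _ (comb g) (comb_linear g).

Lemma comb_delta n V (g : 'I_n -> V) j : comb g (delta_mx 0 j) = g j.
Proof.
rewrite /comb (bigD1 j) //= !mxE !eqxx scale1r big1 ?addr0 // => k kj.
by rewrite mxE (negbTE kj) andbF scale0r.
Qed.

Lemma linear_comb n V (f : {linear 'rV[R]_n -> V}) u :
  f u = comb (fun j => f (delta_mx 0 j)) u.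
Proof.
rewrite {1}(row_sum_delta u) linear_sum; apply: eq_bigr => j _.
by rewrite linearZ.
Qed.

Lemma fin_genP V : fin_gen V <->
  exists n (p : {linear 'rV[R]_n -> V}), surjective p.
Proof.
split=> [[n [g gP]]|[n [p ps]]].
  exists n, (comb g) => x; have [c ->] := gP x.
  by exists (\row_j c j); apply: eq_bigr => j _; rewrite mxE.
exists n, (fun j => p (delta_mx 0 j)) => x; have [u <-] := ps x.
by exists (fun j => u 0 j); rewrite linear_comb.
Qed.

Lemma fin_gen_rV n : fin_gen 'rV[R]_n.
Proof. by apply/fin_genP; exists n, idfun => x; exists x. Qed.

Lemma projective_rV n : projective 'rV[R]_n.
Proof.
move=> M N p g ps.
have [f fP] := choice (fun j => ps (g (delta_mx 0 j))).
exists (comb f) => x; rewrite [RHS]linear_comb /= /comb linear_sum.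
by apply: eq_bigr => j _; rewrite linearZ /= fP.
Qed.

Lemma projective_reg : projective R^o.
Proof.
move=> M N p g ps; have [y py] := ps (g 1).
have [v|b x x' _ _ -> ->|_ ->|h hE] := @linear_graph R^o M (fun r z => z = r *: y).
- by eexists.
- by rewrite scalerDl scalerA.
- by rewrite scale0r.
exists h => x; have /esym <- := (hE x _).1 erefl.
by rewrite linearZ /= py -linearZ /GRing.scale /= mulr1.
Qed.

Lemma fin_gen_reg : fin_gen R^o.
Proof.
exists 1%N, (fun=> 1) => v; exists (fun=> v).
by rewrite big_ord1 /GRing.scale /= mulr1.
Qed.

Lemma projective_lift P V W (p : {linear V -> W}) (g : {linear P -> W}) :
  projective P -> (forall x, exists v, p v = g x) ->
  exists h : {linear P -> V}, forall x, p (h x) = g x.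
Proof.
move=> prP pg; have [U [i [inj_i iP]]] := submod_sub (submodP_im p).
have [|q qE] := factor_sub (f := p) inj_i; first by move=> v; apply/iP; exists v.
have [|g' gE] := factor_sub (f := g) inj_i; first by move=> x; apply/iP/pg.
have [|h hE] := prP _ _ q g'; last by exists h => x; rewrite -qE hE gE.
move=> u; have /iP[v pv] : exists u', i u' = i u by exists u.
by exists v; apply: inj_i; rewrite qE.
Qed.

Definition ev U V (x : U) (f : HomR U V) : V := (f : {linear U -> V}) x.

Lemma ev_linear U V (x : U) : linear (@ev U V x).
Proof. by []. Qed.

HB.instance Definition _ U V (x : U) :=
  GRing.isLinear.Build R (HomR U V) V _ (@ev U V x) (ev_linear x).

Definition precomp U V W (p : {linear U -> V}) (f : HomR V W) : HomR U W :=
  (f : {linear V -> W}) \o p.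

Lemma precomp_linear U V W (p : {linear U -> V}) : linear (@precomp U V W p).
Proof. by move=> a f g; apply: HomP. Qed.

HB.instance Definition _ U V W (p : {linear U -> V}) :=
  GRing.isLinear.Build R (HomR V W) (HomR U W) _ (@precomp U V W p)
    (precomp_linear p).

Definition postcomp U V W (p : {linear V -> W}) (f : HomR U V) : HomR U W :=
  p \o (f : {linear U -> V}).

Lemma postcomp_linear U V W (p : {linear V -> W}) : linear (@postcomp U V W p).
Proof. by move=> a f g; apply: HomP => x; rewrite /= linearP. Qed.

HB.instance Definition _ U V W (p : {linear V -> W}) :=
  GRing.isLinear.Build R (HomR U V) (HomR U W) _ (@postcomp U V W p)
    (postcomp_linear p).

Lemma comb_ev n U V (g : 'I_n -> HomR U V) c x :
  ev x (comb g c) = comb (fun j => ev x (g j)) c.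
Proof. by rewrite /comb linear_sum; apply: eq_bigr => j _; rewrite linearZ. Qed.

(** Under [Hom(R^n, V) = V^n], the inclusion of the [l]-th factor; evaluation at [delta_mx 0 l] is
    its retraction. *)
Definition coordmap n V (l : 'I_n) (v : V) : HomR 'rV[R]_n V :=
  comb (fun k => if k == l then v else 0).

Lemma coordmapE n V (l : 'I_n) (v : V) u : ev u (coordmap l v) = u 0 l *: v.
Proof.
rewrite /ev /= /comb (bigD1 l) //= eqxx big1 ?addr0 // => k /negbTE ->.
by rewrite scaler0.
Qed.

Lemma coordmap_linear n V (l : 'I_n) : linear (@coordmap n V l).
Proof.
move=> a u v; apply: HomP => c; rewrite -[LHS]/(ev c (coordmap l (a *: u + v))).
rewrite -[RHS]/(a *: ev c (coordmap l u) + ev c (coordmap l v)) !coordmapE.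
by rewrite scalerDr !scalerA mulrC.
Qed.

HB.instance Definition _ n V (l : 'I_n) :=
  GRing.isLinear.Build R V (HomR 'rV[R]_n V) _ (@coordmap n V l) (coordmap_linear l).

Lemma coordmap_sum n V (h : HomR 'rV[R]_n V) :
  h = \sum_l coordmap l (ev (delta_mx 0 l) h).
Proof.
apply: HomP => u; rewrite -[RHS]/(ev u _) linear_sum linear_comb.
apply: eq_bigr => l _; apply/esym/coordmapE.
Qed.

Lemma fin_gen_surj V W (p : {linear V -> W}) :
  surjective p -> fin_gen V -> fin_gen W.
Proof.
move=> ps /fin_genP[n [q qs]]; apply/fin_genP; exists n, (p \o q) => x.
by have [v <-] := ps x; have [u <-] := qs v; exists u.
Qed.

End LinearMaps.

(** * Finite generation over a Noetherian ring, and Noetherian induction *)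

Section Noetherian.
Variable R : comNzRingType.
Implicit Types U V W N Q : lmodType R.

(** Induction on the number of generators: modulo the cyclic submodule on the first generator, one
    generator fewer is needed. *)
Lemma fin_gen_ind (Phi : lmodType R -> Prop) :
  (forall V (u : V), (forall v, exists a, v = a *: u) -> Phi V) ->
  (forall U V W (i : {linear U -> V}) (p : {linear V -> W}),
     ses i p -> Phi U -> Phi W -> Phi V) ->
  forall V, fin_gen V -> Phi V.
Proof.
move=> hcyc hext V /fin_genP[n]; elim: n V => [|n IHn] V [p ps].
  apply: (hcyc V 0) => v; have [u <-] := ps v.
  by exists 0; rewrite scale0r [u]thinmx0 linear0.
have [U [i [inj_i iP]]] :=
  submod_sub (submodP_im (comb (fun _ : 'I_1 => p (delta_mx 0 0)))).
have [W [q hq]] := ses_quot inj_i.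
apply: (hext _ _ _ _ _ hq).
  have /iP[u0 iu0] : exists v, comb (fun _ : 'I_1 => p (delta_mx 0 0)) v
                               = p (delta_mx 0 0).
    by exists (delta_mx 0 0); rewrite (comb_delta _ 0).
  apply: (hcyc _ u0) => v.
  have /iP[c cv] : exists u, i u = i v by exists v.
  exists (c 0 0); apply: inj_i; rewrite -cv linearZ /= iu0.
  by rewrite /comb big_ord1.
apply: IHn; exists (comb (fun j => q (p (delta_mx 0 (lift 0 j))))) => y.
have [_ ex qs] := hq; have [v <-] := qs y; have [u <-] := ps v.
exists (\row_j u 0 (lift 0 j)).
rewrite [p u]linear_comb /comb [in RHS]linear_sum big_ord_recl /= linearZ /=.
have -> : q (p (delta_mx 0 0)) = 0.
  by apply/ex; apply/iP; exists (delta_mx 0 0); exact: (comb_delta (fun=> _) 0).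
by rewrite scaler0 add0r; apply: eq_bigr => j _; rewrite mxE linearZ.
Qed.

Definition fgP V (P : V -> Prop) : Prop :=
  exists n (p : {linear 'rV[R]_n -> V}), forall x, P x <-> exists u, p u = x.

Hypothesis noeR : noetherian R.

Lemma ideal_fg (I : R^o -> Prop) : submodP I -> fgP I.
Proof.
move=> hI; have /fin_genP[n [p ps]] := noeR (submod_bool hI).
have lin : linear (val : submodule (submod_bool hI) -> R^o) by [].
pose v := HB.pack_for {linear (submodule (submod_bool hI)) -> R^o}
   (val : submodule (submod_bool hI) -> R^o)
   (GRing.isLinear.Build R (submodule (submod_bool hI)) R^o _ _ lin).
exists n, (v \o p) => x; split=> [Ix|[u <-]].
  have bx : x \in submod_bool hI by exact/asboolP.
  by have [u pu] := ps (exist _ x bx); exists u; rewrite /= pu.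
by have /asboolP := valP (p u).
Qed.

(** For cyclic [V], pull [P] back to an ideal; for an extension, join generators of the part of [P]
    in [U] with lifts of generators of its image in [W]. *)
Lemma fin_gen_fgP V : fin_gen V -> forall P : V -> Prop, submodP P -> fgP P.
Proof.

move=> fV; pose Phi W := forall P : W -> Prop, submodP P -> fgP P.
apply: (fin_gen_ind (Phi := Phi) _ _ fV) => {V fV}.
  move=> V u uV P hP.
  have /ideal_fg[n [p pP]] : submodP (fun a : R^o => P (a *: u)).
    split=> [|a x y Px Py]; first by rewrite scale0r; exact: hP.1.
    by rewrite scalerDl -scalerA; apply: hP.2.
  pose g j : V := p (delta_mx 0 j) *: u.
  exists n, (comb g) => x.
  have cE c : comb g c = p c *: u.
    rewrite [p c]linear_comb /comb scaler_suml.
    by apply: eq_bigr => j _; rewrite scalerA.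
  split=> [Px|[c <-]].
    have [a ax] := uV x; move: Px; rewrite ax => /pP[c <-].
    by exists c; exact: cE.
  by rewrite [X in P X]cE; apply/pP; exists c.
move=> U V W i q [inj_i ex qs] fU fW P hP.
have [|k [f fP]] := fU (fun u => P (i u)).
  by split=> [|a x y Px Py]; rewrite ?linear0 ?linearP; [exact: hP.1|apply: hP.2].
have [|n [g gP]] := fW (fun w => exists2 v, P v & q v = w).
  split=> [|a _ _ [x Px <-] [y Py <-]].
    by exists 0; rewrite ?linear0 //; exact: hP.1.
  by exists (a *: x + y); rewrite ?linearP //; apply: hP.2.
have gj j : exists v, P v /\ q v = g (delta_mx 0 j).
  have /gP[v Pv qv] : exists u, g u = g (delta_mx 0 j) by exists (delta_mx 0 j).
  by exists v.
have [h /all_and2[Ph qh]] := choice gj.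
have qcomb c : q (comb h c) = g c.
  rewrite [RHS]linear_comb /comb linear_sum.
  by apply: eq_bigr => j _; rewrite linearZ /= qh.
have lr c : lsubmx (row_mx c.1 c.2) = c.1 :> 'rV[R]_k
            /\ rsubmx (row_mx c.1 c.2) = c.2 :> 'rV[R]_n.
  by rewrite row_mxKl row_mxKr.
have [F FE] : exists F : {linear 'rV[R]_(k + n) -> V},
    forall c, F c = i (f (lsubmx c)) + comb h (rsubmx c).
  have [|a x x' _ _ -> ->|_ ->|F FP] := linear_graph (U := 'rV[R]_(k + n))
      (r := fun c y => y = i (f (lsubmx c)) + comb h (rsubmx c)).
  - by move=> x; eexists.
  - by rewrite !linearP scalerDr !addrA; congr (_ + _); rewrite -!addrA;
      congr (_ + _); exact: addrC.
  - by rewrite !linear0 addr0.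
  by exists F => c; apply/FP.
exists (k + n)%N, F => x; split=> [Px|[c <-]]; last first.
  rewrite FE; apply: submodPD => //; first by apply/fP; exists (lsubmx c).
  exact: submodP_sum.
have /gP[c gc] : exists2 v, P v & q v = q x by exists x.
have [u iu] : exists u, i u = x - comb h c.
  by apply/ex; rewrite linearB /= qcomb gc subrr.
have /fP[b fb] : P (i u).
  by rewrite iu; apply: submodPB => //; exact: submodP_sum.
by exists (row_mx b c); rewrite FE row_mxKl row_mxKr fb iu subrK.
Qed.

Lemma fin_gen_inj U V (i : {linear U -> V}) :
  injective i -> fin_gen V -> fin_gen U.
Proof.
move=> inj_i /fin_gen_fgP /(_ _ (submodP_im i))[n [p pP]].
have [q qP] : exists q : {linear 'rV[R]_n -> U}, forall c, i (q c) = p c.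
  by apply: factor_sub => // c; apply/pP; exists c.
apply/fin_genP; exists n, q => u.
have /pP[c pc] : exists v, i v = i u by exists u.
by exists c; apply: inj_i; rewrite qP.
Qed.

Lemma fin_gen_mid U V W (i : {linear U -> V}) (p : {linear V -> W}) :
  exact i p -> fin_gen U -> fin_gen W -> fin_gen V.
Proof.
move=> ex fU fW; have [I0 [k [inj_k kP]]] := submod_sub (submodP_im p).
have /fin_genP[n [g gs]] := fin_gen_inj inj_k fW.
have [l [f fs]] := (fin_genP U).1 fU.
have gP c : exists v, p v = k (g c) by apply/kP; exists (g c).
have [h hP] := projective_lift (projective_rV (n := n)) (g := k \o g) gP.
have fi : fin_gen ('rV[R]_l * 'rV[R]_n)%type.
  by apply: fin_gen_pair; exact: fin_gen_rV.
apply: (fin_gen_surj (p := (i \o f \o fst) \+ (h \o snd)) _ fi) => v.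
have /kP[u ku] : exists v', p v' = p v by exists v.
have [c gc] := gs u; have [b ib] : exists b, i b = v - h c.
  by apply/ex; rewrite linearB /= hP /= gc ku subrr.
by have [b' fb] := fs b; exists (b', c); rewrite /= fb ib subrK.
Qed.

(** For cyclic [V], evaluation at the generator embeds the module into [W]; for an extension, left
    exactness of [Hom(-, W)] puts it in the middle of an exact sequence. *)
Lemma fin_gen_Hom V W : fin_gen V -> fin_gen W -> fin_gen (HomR V W).
Proof.
move=> fV fW; pose Phi V' := fin_gen (HomR V' W).
apply: (fin_gen_ind (Phi := Phi) _ _ fV) => {V fV} [V u uV|U V N i p ip fU fN].
  apply: (fin_gen_inj (i := ev u) _ fW) => f g fg; apply: HomP => v.
  by have [a ->] := uV v; rewrite !linearZ; congr (_ *: _).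
apply: (fin_gen_mid (i := precomp p) (p := precomp i) _ fN fU) => f; split.
  move=> fi; have [inj_i ex ps] := ip.
  have [|g gE] := factor_quot (f := (f : {linear V -> W})) ps.
    move=> v /ex[u <-]; exact: (congr1 (ev u) fi).
  by exists g; apply: HomP => v; rewrite /= gE.
move=> [g <-]; apply: HomP => u /=.
by rewrite (ses_comp0 u ip) linear0.
Qed.

Definition proper_sup (I J : R^o -> Prop) : Prop :=
  (forall x, I x -> J x) /\ exists2 x, J x & ~ I x.

(** Noetherian induction on ideals: a counterexample would start a strictly increasing chain, whose
    union is finitely generated. *)
Lemma ideal_ind (Q : (R^o -> Prop) -> Prop) :
  (forall I, submodP I ->
     (forall J, submodP J -> proper_sup I J -> Q J) -> Q I) ->
  forall I, submodP I -> Q I.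
Proof.
move=> step I0 hI0; apply: contrapT => nQ0.
pose S := {I : R^o -> Prop | submodP I /\ ~ Q I}.
have nxt (I : S) : exists J : S, proper_sup (sval I) (sval J).
  case: I => I [hI nQ] /=; apply: contrapT => nJ; apply: nQ; apply: step => //.
  move=> J hJ IJ; apply: contrapT => nQJ; apply: nJ.
  by exists (exist _ J (conj hJ nQJ)).
have [f fP] := choice nxt.
pose s k := sval (iter k f (exist _ I0 (conj hI0 nQ0) : S)).
have sm k : submodP (s k) by rewrite /s; case: (iter _ _ _) => J [].
have sle k l : (k <= l)%N -> forall x, s k x -> s l x.
  move=> /subnK <-; elim: (l - k)%N => [//|j IHj] x /IHj.
  by have [+ _] := fP (iter (j + k) f (exist _ I0 (conj hI0 nQ0) : S)); apply.
have [|n [p pP]] := @ideal_fg (fun x => exists k, s k x).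
  split=> [|a x y [k sx] [l sy]]; first by exists 0%N; exact: (sm 0%N).1.
  by exists (maxn k l); apply: (sm _).2; apply: (sle _ _ _ _ sx) || apply: (sle _ _ _ _ sy);
    rewrite ?leq_maxl ?leq_maxr.
have gk j : exists k, s k (p (delta_mx 0 j)).
  by apply/pP; exists (delta_mx 0 j).
have [K KP] := choice gk.
(* All generators of the union have appeared by stage [M]. *)
pose M := (\max_j K j)%N.
have sM x k : s k x -> s M x.
  move=> sx; have /pP[u <-] : exists k, s k x by exists k.
  rewrite linear_comb; apply: (submodP_sum (sm M)) => j.
  by apply: sle (KP j); exact: leq_bigmax.
have [_ [x sx nx]] := fP (iter M f (exist _ I0 (conj hI0 nQ0) : S)).
exact: nx (sM x M.+1 sx).
Qed.

End Noetherian.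

(** * Local rings and Nakayama's lemma *)

Section Local.
Variables (R : comNzRingType) (m : idealr R).
Implicit Types U V W N Q : lmodType R.

Lemma submodP_idealr (J : idealr R) : submodP (fun x : R^o => (x : R) \in J).
Proof.
split=> [|a x y xJ yJ]; first exact: (rpred0 J).
by apply: (rpredD (S := J)) => //; exact: (idealMr (idealrI := J)).
Qed.

Lemma idealr_of (I : R^o -> Prop) : submodP I -> ~ I 1 ->
  exists J : idealr R, forall x : R, (x \in J) <-> I x.
Proof.
move=> hI nI1.
have cl : idealr_closed (fun x : R => `[< I x >]).
  split; first by apply/asboolP; exact: hI.1.
  - by apply/negP => /asboolP.
  - by move=> a x y /asboolP Ix /asboolP Iy; apply/asboolP; exact: hI.2.
exists (HB.pack_for (idealr R) (fun x : R => `[< I x >])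
   (isIdealr.Build R (fun x : R => `[< I x >]) cl)) => x.
by split=> [/asboolP//|Ix]; exact/asboolP.
Qed.

Lemma prime_idealr_of (I : R^o -> Prop) : submodP I -> ~ I 1 ->
  (forall a b : R, I (a * b) -> I a \/ I b) ->
  exists J : prime_idealr R, forall x : R, (x \in J) <-> I x.
Proof.
move=> hI nI1 pI.
have cl : idealr_closed (fun x : R => `[< I x >]).
  split; first by apply/asboolP; exact: hI.1.
  - by apply/negP => /asboolP.
  - by move=> a x y /asboolP Ix /asboolP Iy; apply/asboolP; exact: hI.2.
have pr : prime_idealr_closed (fun x : R => `[< I x >]).
  move=> a b /asboolP/pI h; apply/orP.
  by case: h => h; [left|right]; exact/asboolP.
exists (HB.pack_for (prime_idealr R) (fun x : R => `[< I x >])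
   (isIdealr.Build R (fun x : R => `[< I x >]) cl)
   (isPrimeIdealrClosed.Build R (fun x : R => `[< I x >]) pr)) => x.
by split=> [/asboolP//|Ix]; exact/asboolP.
Qed.

Lemma one_notin_idealr (J : idealr R) : (1 : R) \notin J.
Proof. by rewrite idealr1. Qed.

Lemma mulm (a b : R) : b \in m -> a * b \in m.
Proof. exact: (idealMr (idealrI := m)). Qed.

Hypotheses (noeR : noetherian R) (locR : local_ring m).

Lemma proper_sub_max (I : R^o -> Prop) :
  submodP I -> ~ I 1 -> forall x : R, I x -> x \in m.
Proof.
move: I; apply: (ideal_ind noeR) => I hI IH nI1 x Ix.
have [J JI] := idealr_of hI nI1.
have [maxJ|nmaxJ] := pselect (maximal_ideal J).
  by rewrite -(locR.2 J maxJ); exact/JI.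
have [K [JK nKJ]] : exists K : idealr R, {subset J <= K} /\ ~ {subset K <= J}.
  apply: contrapT => nK; apply: nmaxJ => K JK; apply: contrapT => nKJ.
  by apply: nK; exists K.
apply: (IH _ (submodP_idealr K)).
- split=> [y /JI|]; first exact: JK.
  apply: contrapT => nx; apply: nKJ => y yK; apply: contrapT => nyJ.
  by apply: nx; exists y => // /JI.
- by move/negP: (one_notin_idealr K).
- by apply: JK; exact/JI.
Qed.

Lemma unit_notin (a : R) : a \notin m -> exists b, b * a = 1.
Proof.
move=> am; apply: contrapT => nb; move/negP: am; apply.
apply: (@proper_sub_max (fun x => exists b, b * a = x)) => //; last first.
  by exists 1; rewrite mul1r.
split=> [|c _ _ [x <-] [y <-]]; first by exists 0; rewrite mul0r.
by exists (c * x + y); rewrite mulrDl -mulrA.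
Qed.

Lemma one_sub_unit (a : R) : a \in m -> exists b, b * (1 - a) = 1.
Proof.
move=> am; apply: unit_notin; apply/negP => a1m.
have: (1 : R) \in m by rewrite -(subrK a 1) rpredD.
by apply/negP; exact: one_notin_idealr.
Qed.

(** The submodule [m V]. *)
Definition mspan V (v : V) : Prop :=
  exists n (c : 'rV[R]_n) (g : 'I_n -> V), (forall j, c 0 j \in m) /\ v = comb g c.

Lemma mspanZ V a (v : V) : a \in m -> mspan (a *: v).
Proof.
move=> am; exists 1%N, (const_mx a), (fun=> v); split=> [j|].
  by rewrite mxE.
by rewrite /comb big_ord1 mxE.
Qed.

Lemma submodP_mspan V : submodP (@mspan V).
Proof.
split=> [|a x y [k [c [g [cm ->]]]] [l [b [h [bm ->]]]]].
  by exists 0%N, 0, (fun=> 0); split=> [[]//|]; rewrite linear0.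
exists (k + l)%N, (row_mx (a *: c) b),
  (fun j => match split j with inl i => g i | inr i => h i end); split=> [j|].
  by rewrite -(splitK j); case: (split j) => i /=;
    rewrite ?row_mxEl ?row_mxEr ?mxE //; exact: mulm.
rewrite /comb big_split_ord /= scaler_sumr; congr (_ + _); apply: eq_bigr => i _.
  by rewrite (unsplitK (inl i)) row_mxEl mxE scalerA.
by rewrite (unsplitK (inr i)) row_mxEr.
Qed.

Lemma mspan_linear V W (f : {linear V -> W}) v : mspan v -> mspan (f v).
Proof.
move=> [n [c [g [cm ->]]]]; exists n, c, (f \o g); split=> //.
by rewrite linear_sum; apply: eq_bigr => j _; rewrite linearZ.
Qed.

Lemma mspan_comb V n (g : 'I_n -> V) (v : V) :
  (forall v : V, exists c : 'rV[R]_n, v = comb g c) -> mspan v ->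
  exists c : 'rV[R]_n, (forall j, c 0 j \in m) /\ v = comb g c.
Proof.
move=> gP [k [c [h [cm ->]]]]; have [b hb] := choice (fun j => gP (h j)).
exists (\sum_j c 0 j *: b j); split=> [j|].
  rewrite summxE rpred_sum // => i _; rewrite mxE mulrC; exact: mulm.
by rewrite linear_sum; apply: eq_bigr => j _; rewrite linearZ /= -hb.
Qed.

(** When the first generator is written with coefficients in [m], its own coefficient [c] leaves
    [1 - c] invertible, so this generator is redundant. *)
Lemma nakayama V : fin_gen V -> (forall v : V, mspan v) -> forall v : V, v = 0.
Proof.
move=> [n [g gP]] ms.
have {gP} : forall v : V, exists c : 'rV[R]_n, v = comb g c.
  move=> v; have [c ->] := gP v; exists (\row_j c j).
  by apply: eq_bigr => j _; rewrite mxE.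
elim: n g => [|n IHn] g gP.
  by move=> v; have [c ->] := gP v; rewrite /comb big_ord0.
apply: (IHn (g \o lift 0)) => v.
have [c [cm g0]] := mspan_comb gP (ms (g 0)).
have [b bc] := one_sub_unit (cm 0).
pose P w := exists u, comb (g \o lift 0) u = w.
have hP : submodP P := submodP_im (comb (g \o lift 0)).
have Pl j : P (g (lift 0 j)).
  by exists (delta_mx 0 j); exact: (comb_delta (g \o lift 0) j).
have Pg0 : P (g 0).
  rewrite -[g 0]scale1r -bc -scalerA; apply: submodPZ => //.
  rewrite scalerBl scale1r {1}g0 /comb big_ord_recl addrC addKr.
  by apply: submodP_sum.
have [d dv] := gP v; have [u uv] : P v; last by exists u.
rewrite dv; apply: submodP_sum => // j.
by have [k ->|->] := unliftP 0 j.
Qed.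

(** Only [V / P] has to be finitely generated. Ext needs this form: there [V] consists of cocycles,
    in general not finitely generated, and [P] of coboundaries. *)
Lemma nakayama_mod V (P : V -> Prop) n (p : {linear 'rV[R]_n -> V}) : submodP P ->
  (forall v, exists u, P (v - p u)) ->
  (forall v, exists2 v', mspan v' & P (v - v')) -> forall v, P v.
Proof.
move=> hP gen ms v; have [Q [q [qs qP]]] := submod_quot hP.
have qz x y : P (x - y) -> q x = q y.
  by move/qP; rewrite linearB => /eqP; rewrite subr_eq0 => /eqP.
apply/qP; apply: nakayama.
  by apply/fin_genP; exists n, (q \o p) => y; have [x <-] := qs y;
    have [u /qz xu] := gen x; exists u.
move=> y; have [x <-] := qs y; have [x' mx /qz ->] := ms x.
exact: mspan_linear.
Qed.

End Local.

(** * Weakly regular sequences, syzygies and direct summands *)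

Section Regular.
Variable R : comNzRingType.
Implicit Types (U V W N K P M : lmodType R) (s : seq R).

(** [regular_seq] without its nonvanishing condition, so that zero modules are included and summands
    inherit the property. *)
Definition wreg s V : Prop := forall i : nat, (i < size s)%N -> forall u : V,
  seq_mul (take i s) (s`_i *: u) -> seq_mul (take i s) u.

Lemma submodP_seq_mul s V : submodP (@seq_mul R s V).
Proof.
split=> [|a x y [f ->] [g ->]].
  by exists (fun=> 0); rewrite big1 // => i _; rewrite scaler0.
exists (fun i => a *: f i + g i); rewrite scaler_sumr -big_split /=.
by apply: eq_bigr => i _; rewrite scalerDr !scalerA mulrC.
Qed.

Lemma seq_mul_nil V (u : V) : seq_mul [::] u <-> u = 0.
Proof.
split=> [[v ->]|->]; first by rewrite big_ord0.
by exists (fun=> 0); rewrite big_ord0.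
Qed.

Lemma seq_mul_cons a s V (u : V) :
  seq_mul (a :: s) u <-> exists v w, seq_mul s w /\ u = a *: v + w.
Proof.
split=> [[v ->]|[v [_ [[w ->] ->]]]].
  exists (v ord0), (\sum_(i < size s) s`_i *: v (lift ord0 i)).
  by split; [exists (fun i => v (lift ord0 i))|rewrite big_ord_recl].
exists (fun i => if unlift ord0 i is Some j then w j else v).
rewrite big_ord_recl /= unlift_none; congr (_ + _).
by apply: eq_bigr => i _; rewrite liftK.
Qed.

Lemma seq_mul_rcons a s V (u : V) :
  seq_mul (rcons s a) u <-> exists v w, seq_mul s w /\ u = a *: v + w.
Proof.
elim: s u => [|b s IHs] u; first exact: seq_mul_cons.
rewrite rcons_cons seq_mul_cons; split.
  move=> [v [w [/IHs[v' [w' [sw' ->]]] ->]]].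
  exists v', (b *: v + w'); split; first by rewrite seq_mul_cons; exists v, w'.
  by rewrite addrCA.
move=> [v [w [/seq_mul_cons[v' [w' [sw' ->]]] ->]]].
exists v', (a *: v + w'); split; first by apply/IHs; exists v, w'.
by rewrite addrCA.
Qed.

Lemma seq_mul_linear s V W (f : {linear V -> W}) v :
  seq_mul s v -> seq_mul s (f v).
Proof.
move=> [g ->]; exists (f \o g); rewrite linear_sum.
by apply: eq_bigr => i _; rewrite linearZ.
Qed.

Lemma seq_mul_lift s V W (f : {linear V -> W}) w : surjective f ->
  seq_mul s w -> exists2 v, seq_mul s v & f v = w.
Proof.
move=> fs [g ->]; have [h hg] := choice (fun i => fs (g i)).
exists (\sum_(i < size s) s`_i *: h i); first by exists h.
by rewrite linear_sum; apply: eq_bigr => i _; rewrite linearZ /= hg.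
Qed.

Lemma wreg_rcons s a V : wreg (rcons s a) V <->
  wreg s V /\ forall u : V, seq_mul s (a *: u) -> seq_mul s u.
Proof.
split=> [h|[h ha] i].
  split=> [i lis u|u].
    have := h i; rewrite size_rcons ltnS -cats1 nth_cat lis.
    by rewrite takel_cat ?(ltnW lis) //; apply.
  have := h (size s); rewrite size_rcons ltnSn nth_rcons ltnn eqxx.
  by rewrite -cats1 take_size_cat //; exact.
rewrite size_rcons ltnS leq_eqVlt => /orP[/eqP->|lis] u.
  by rewrite nth_rcons ltnn eqxx -cats1 take_size_cat //; exact: ha.
by rewrite -cats1 nth_cat lis takel_cat ?(ltnW lis) //; exact: h.
Qed.

Lemma wreg_cons a s V W (p : {linear V -> W}) : surjective p ->
  (forall v, p v = 0 <-> exists u, a *: u = v) ->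
  wreg (a :: s) V <-> (forall u : V, a *: u = 0 -> u = 0) /\ wreg s W.
Proof.
move=> ps pk.
have smP t (v : V) : seq_mul (a :: t) v <-> seq_mul t (p v).
  rewrite seq_mul_cons; split=> [[u [w [tw ->]]]|].
    rewrite linearD /= (iffRL (pk _)); last by exists u.
    by rewrite add0r; exact: seq_mul_linear.
  move=> /(seq_mul_lift ps)[w tw pw].
  have /pk[u uw] : p (v - w) = 0 by rewrite linearB /= pw subrr.
  by exists u, w; rewrite uw subrK.
split=> [h|[ha h] [_ u /seq_mul_nil au0|i lis u]].
- split=> [u au0|i lis w].
    by apply/seq_mul_nil; apply: (h 0%N) => //=; apply/seq_mul_nil.
  have [u <-] := ps w; rewrite -linearZ -!smP.
  exact: (h i.+1).
- exact/seq_mul_nil/ha.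
- by rewrite /= !smP linearZ; exact: h.
Qed.

Lemma wreg_take i s V : wreg s V -> wreg (take i s) V.
Proof.
move=> h j; rewrite size_take_min ltn_min => /andP[ji js] u.
rewrite nth_take // take_takel ?(ltnW ji) //; exact: h.
Qed.

(* [Tor_1(R/(s), M) = 0] *)
Lemma seq_mul_pure s K P M (i : {linear K -> P}) (p : {linear P -> M}) k :
  ses i p -> wreg s M -> seq_mul s (i k) -> seq_mul s k.
Proof.
move=> ip; have [inj_i ex ps] := ip.
elim/last_ind: s k => [|s a IHs] k.
  by move=> _ /seq_mul_nil ik; apply/seq_mul_nil/inj_i; rewrite linear0.
move=> /wreg_rcons[sM aM] /seq_mul_rcons[v [w [sw ikE]]].
have /aM/(seq_mul_lift ps)[v' sv' pv'] : seq_mul s (a *: p v).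
  have : p (i k) = 0 by exact: ses_comp0.
  rewrite ikE linearD linearZ /= => /eqP; rewrite addr_eq0 => /eqP ->.
  by rewrite -scaleN1r; apply: (submodPZ (submodP_seq_mul s M)); exact: seq_mul_linear.
have [k' ik'] : exists k', i k' = v - v'.
  by apply/ex; rewrite linearB /= pv' subrr.
have /(IHs _ sM) sk : seq_mul s (i (k - a *: k')).
  rewrite linearB linearZ /= ik' ikE scalerBr opprB [_ + w]addrC -addrA.
  rewrite [X in w + X]addrC subrK.
  apply: (submodPD (submodP_seq_mul s P)) => //.
  exact: (submodPZ (submodP_seq_mul s P)).
by apply/seq_mul_rcons; exists k', (k - a *: k'); split=> //; rewrite addrC subrK.
Qed.

(** The depth lemma: [K] gains one step over [M], hence only proper prefixes of [s] are required to
    be regular on [M]. *)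
Lemma wreg_syz s K P M (i : {linear K -> P}) (p : {linear P -> M}) :
  ses i p -> wreg s P -> (forall j, (j < size s)%N -> wreg (take j s) M) ->
  wreg s K.
Proof.
move=> ip sP sM j js k sk.
apply: (seq_mul_pure ip (sM j js)); apply: sP => //.
by rewrite -linearZ; exact: seq_mul_linear.
Qed.

(** The identity [u = \sum_j e j (c j u)] exhibits [V] as a direct summand of [W^n]. *)
Lemma wreg_coord s n V W (c : 'I_n -> {linear V -> W})
    (e : 'I_n -> {linear W -> V}) :
  (forall u, u = \sum_j e j (c j u)) -> wreg s W -> wreg s V.
Proof.
move=> ce sW.
have smP t (u : V) : seq_mul t u <-> forall j, seq_mul t (c j u).
  split=> [tu j|h]; first exact: seq_mul_linear.
  rewrite (ce u); elim/big_ind: _ => [|x y|j _].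
  - exact: (submodP_seq_mul t V).1.
  - exact: (submodPD (submodP_seq_mul t V)).
  - exact: seq_mul_linear.
move=> i lis u; rewrite !smP => h j; apply: sW => //.
rewrite -linearZ; exact: h.
Qed.

Lemma wreg_projective s P : wreg s R^o -> fin_gen P -> projective P -> wreg s P.
Proof.
move=> sR /fin_genP[n [p ps]] /(_ _ _ p idfun ps)[h ph].
have [c cE] : exists c : 'I_n -> {linear P -> R^o}, forall j u, c j u = h u 0 j.
  suff /choice[c cP] : forall j, exists c : {linear P -> R^o}, forall u, c u = h u 0 j.
    by exists c.
  move=> j; have [|||f fE] := @linear_graph R P R^o (fun u r => r = h u 0 j).
  - by move=> u; eexists.
  - by move=> a x x' _ _ -> ->; rewrite linearP !mxE.
  - by move=> y ->; rewrite linear0 mxE.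
  by exists f => u; apply/fE.
have [e eE] : exists e : 'I_n -> {linear R^o -> P},
    forall j r, e j r = r *: p (delta_mx 0 j).
  suff /choice[c' cP] : forall j, exists c : {linear R^o -> P},
      forall r, c r = r *: p (delta_mx 0 j) by exists c'.
  move=> j; have [|||f fE] := @linear_graph R R^o P (fun r u => u = r *: p (delta_mx 0 j)).
  - by move=> u; eexists.
  - by move=> a x x' _ _ -> ->; rewrite scalerDl scalerA.
  - by move=> y ->; rewrite scale0r.
  by exists f => u; apply/fE.
apply: (wreg_coord (c := c) (e := e)) => // u.
rewrite -[LHS](ph u) linear_comb; apply: eq_bigr => j _.
by rewrite eE cE.
Qed.

End Regular.

(** * Prime chains from regular sequences, and depth at most dimension *)

Section Dimension.
Variables (R : comNzRingType) (m : idealr R).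
Implicit Types (U V W N K P M : lmodType R) (s : seq R).
Hypotheses (noeR : noetherian R) (locR : local_ring m).

Lemma submodP_adjoin (I : R^o -> Prop) (x : R) : submodP I ->
  submodP (fun z : R^o => exists r w, I w /\ z = w + r * x).
Proof.
move=> hI; split=> [|a _ _ [r [w [Iw ->]]] [r' [w' [Iw' ->]]]].
  by exists 0, 0; rewrite mul0r addr0; split=> //; exact: hI.1.
exists (a * r + r'), (a *: w + w'); split; first exact: hI.2.
by rewrite mulrDl -mulrA scalerDr !addrA; congr (_ + _); rewrite addrAC.
Qed.

Lemma proper_sup_adjoin (I : R^o -> Prop) (x : R) : submodP I -> ~ I x ->
  proper_sup I (fun z : R^o => exists r w, I w /\ z = w + r * x).
Proof.
move=> hI nx; split=> [y Iy|]; first by exists 0, y; rewrite mul0r addr0.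
by exists x => //; exists 1, 0; rewrite mul1r add0r; split=> //; exact: hI.1.
Qed.

(** The elements [t * a ^+ k] with [t] outside [q] form a multiplicative set, and an ideal maximal
    among those avoiding it is prime. The case [k = 0] puts this prime inside [q], the case [t = 1],
    [k = 1] keeps [a] out. *)
Lemma prime_avoiding (q : prime_idealr R) (a : R) (I : R^o -> Prop) :
  submodP I -> (forall t k, t \notin q -> ~ I (t * a ^+ k)) ->
  exists P : prime_idealr R,
    [/\ forall x : R, I x -> x \in P, {subset P <= q} & a \notin P].
Proof.
move: I; apply: (ideal_ind noeR) => I hI IH dis.
have q1 : 1 \notin q := one_notin_idealr q.
have [pI|npI] := pselect (forall a b : R, I (a * b) -> I a \/ I b).
  have nI1 : ~ I 1 by move: (dis 1 0%N q1); rewrite mulr1.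
  have [P PI] := prime_idealr_of hI nI1 pI; exists P; split=> [x /PI//|x /PI Ix|].
    by apply: contrapT => /negP xq; apply: (dis x 0%N xq); rewrite mulr1.
  by apply/negP => /PI Ia; apply: (dis 1 1%N q1); rewrite mul1r.
have [x [y [Ixy nIx nIy]]] : exists x y : R, [/\ I (x * y), ~ I x & ~ I y].
  apply: contrapT => h; apply: npI => x y Ixy; apply: contrapT => /not_orP[nx ny].
  by apply: h; exists x, y.
(* Enlarging [I] by [z] either preserves the condition, and the induction applies, or meets the
   multiplicative set. *)
have step z : ~ I z -> (exists P : prime_idealr R,
    [/\ forall x : R, I x -> x \in P, {subset P <= q} & a \notin P]) \/
    exists t k r w, [/\ t \notin q, I w & t * a ^+ k = w + r * z].
  move=> nz; have [h|h] := pselect (exists t k r w,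
    [/\ t \notin q, I w & t * a ^+ k = w + r * z]); first by right.
  left; have [||P [IP Pq aP]] := IH _ (submodP_adjoin z hI).
  - exact: proper_sup_adjoin.
  - by move=> t k tq [r [w [Iw E]]]; apply: h; exists t, k, r, w.
  exists P; split=> // u Iu; apply: IP; exists 0, u.
  by rewrite mul0r addr0.
have [//|[t [k [r [w [tq Iw E]]]]]] := step x nIx.
have [//|[t' [k' [r' [w' [tq' Iw' E']]]]]] := step y nIy.
exfalso; apply: (dis (t * t') (k + k')%N).
  by rewrite prime_idealrM negb_or tq.
have -> : t * t' * a ^+ (k + k') = (t' * a ^+ k') * w + (r * x) * w' + (r * r') * (x * y).
  rewrite exprD mulrACA E E'; ring.
do 2?apply: (submodPD hI); exact: (submodPZ hI).
Qed.

(** Induction from the last element [a]. It is a nonzerodivisor on [V / s V], so no power of [a]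
    times an element outside [q] annihilates that module, and some prime inside [q] contains the
    annihilator but not [a]. Since [a] lies in [q], the inclusion is strict. *)
Lemma wreg_prime_chain s V (q : prime_idealr R) : wreg s V ->
  (forall r, (forall u : V, seq_mul s (r *: u)) -> r \in q) ->
  exists p, prime_chain (size s) p /\ p (size s) = q.
Proof.
elim/last_ind: s q => [|s a IHs] q; first by move=> _ _; exists (fun=> q).
move=> /wreg_rcons[sV aV] hq.
have aq : a \in q.
  apply: hq => u; apply/seq_mul_rcons; exists u, 0; rewrite addr0; split=> //.
  exact: (submodP_seq_mul s V).1.
have [|t k tq h|P [IP Pq aP]] :=
    @prime_avoiding q a (fun r => forall u : V, seq_mul s (r *: u)).
- split=> [u|b x y hx hy u]; first by rewrite scale0r; exact: (submodP_seq_mul s V).1.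
  by rewrite scalerDl -scalerA; apply: (submodP_seq_mul s V).2.
- move/negP: tq; apply; apply: hq => u; apply/seq_mul_rcons.
  exists 0, (t *: u); rewrite scaler0 add0r; split=> //.
  elim: k u h => [|k IHk] u h; first by move: (h u); rewrite mulr1.
  apply: IHk => v; apply: aV; rewrite scalerA mulrCA -exprS; exact: h.
have [p [pc pE]] := IHs P sV IP.
exists (fun i => if (i <= size s)%N then p i else q); rewrite size_rcons ltnn; split=> //.
move=> i; rewrite ltnS => lis; rewrite lis; case: ltnP => [lt|ge]; first exact: pc.
have -> : i = size s by apply/eqP; rewrite eqn_leq lis ge.
by rewrite pE; split=> // /(_ a aq) aP'; move: aP; rewrite aP'.
Qed.

Lemma prime_of_max : exists q : prime_idealr R, forall x, (x \in q) = (x \in m).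
Proof.
have [|a b ab|q qP] := prime_idealr_of (submodP_idealr m).
- by apply/negP; rewrite idealr1.
- have [am|am] := boolP (a \in m); first by left.
  have [c ca] := unit_notin noeR locR am; right.
  by rewrite -[b]mul1r -ca -mulrA; apply: mulm.
by exists q => x; apply/idP/idP => /qP.
Qed.

Lemma wreg_size_le d s V : krull_dim R d -> {subset s <= m} -> wreg s V ->
  (exists u : V, ~ seq_mul s u) -> (size s <= d)%N.
Proof.
move=> [_ kd] sm sV [u nsu]; have [q qm] := prime_of_max.
have [|p [pc _]] := wreg_prime_chain (q := q) sV; last exact: kd pc.
move=> r h; rewrite qm; apply: contrapT => /negP/(unit_notin noeR locR)[b br].
by apply: nsu; rewrite -[u]scale1r -br -scalerA scalerA mulrC -scalerA.
Qed.

(** Otherwise the chain of length [d] ending at [q] could be prolonged by [m]. *)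
Lemma prime_over_wreg d s (q : prime_idealr R) : krull_dim R d ->
  wreg s R^o -> size s = d -> (forall r : R^o, seq_mul s r -> r \in q) ->
  {subset m <= q}.
Proof.
move=> [_ kd] sR sd hq x xm; apply: contrapT => xq; have [M Mm] := prime_of_max.
have [|p [pc pE]] := wreg_prime_chain (q := q) sR.
  by move=> r /(_ 1); rewrite /GRing.scale /= mulr1; exact: hq.
pose p' i := if (i <= size s)%N then p i else M.
have /kd : prime_chain (size s).+1 p'.
  move=> i; rewrite ltnS /p' => lis; rewrite lis; case: ltnP => [lt|ge]; first exact: pc.
  have -> : i = size s by apply/eqP; rewrite eqn_leq lis ge.
  rewrite pE; split=> [y yq|h]; last by apply: xq; apply: h; rewrite Mm.
  rewrite Mm; apply: (proper_sub_max noeR locR (submodP_idealr q)) => //.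
  by apply/negP; rewrite idealr1.
by rewrite sd ltnn.
Qed.

Lemma seq_mul_mspan s V (v : V) : {subset s <= m} -> seq_mul s v -> mspan m v.
Proof.
move=> sm [f ->]; elim/big_ind: _ => [|x y|i _].
- exact: (submodP_mspan m V).1.
- exact: (submodPD (submodP_mspan m V)).
- by apply: mspanZ; apply: sm; exact: mem_nth.
Qed.

(** If [V = s V], Nakayama's lemma gives [V = 0], which [CM] allows. *)
Lemma wreg_CM d s V : krull_dim R d -> {subset s <= m} -> size s = d ->
  fin_gen V -> wreg s V -> CM m V.
Proof.
move=> kd sm sd fV sV; split=> //.
have [V0|nV0] := pselect (forall x : V, x = 0); [by left|right].
exists d; split=> //; split=> [|t tm [tV tne]]; last exact: wreg_size_le kd tm tV tne.
exists s; split=> //; split=> //; apply: contrapT => h; apply: nV0.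
apply: (nakayama noeR locR fV) => v; apply: (seq_mul_mspan sm).
by apply: contrapT => nv; apply: h; exists v.
Qed.

Lemma CM_wreg d V : krull_dim R d -> CM m V -> exists s : seq R,
  [/\ {subset s <= m}, wreg s V & size s = d].
Proof.
move=> kd [fV [V0|[n [kn [[s [sm [sV _] sn]] _]]]]]; last first.
  exists s; split=> //; rewrite sn; apply/eqP; rewrite eqn_leq.
  by have [[p pc] un] := kd; have [[p' pc'] un'] := kn;
    rewrite (un _ _ pc') (un' _ _ pc).
(* For the zero module [CM] supplies no sequence; a string of zeros is weakly regular on it. *)
exists (nseq d 0); split; rewrite ?size_nseq //.
  by move=> x /nseqP[-> _]; exact: (rpred0 m).
by move=> i _ u _; rewrite (V0 u); exact: (submodP_seq_mul _ V).1.
Qed.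

End Dimension.

(* An injective resolution of [w], shifted so that [w] embeds in degree [1] and
   the module in degree [0] vanishes: coboundaries then need no special case. *)
Record injres (R : comNzRingType) (w : lmodType R) := InjRes {
  ir_mod :> nat -> lmodType R;
  ir_d : forall i, {linear ir_mod i -> ir_mod i.+1};
  ir_e : {linear w -> ir_mod 1};
  ir_inj : forall i, injective_module (ir_mod i);
  ir_zero : forall x : ir_mod 0, x = 0;
  ir_einj : injective ir_e;
  ir_exact0 : exact ir_e (ir_d 1);
  ir_exactS : forall i, exact (ir_d i.+1) (ir_d i.+2)
}.

(** * Ext into [w] from an injective resolution *)

Section InjectiveResolution.
Variables (R : comNzRingType) (w : lmodType R).
Implicit Types U V W N K P M : lmodType R.

Lemma finite_injdim_injres : finite_injdim w ->
  exists (E : injres w) (n : nat), forall i, (n < i)%N -> forall x : E i, x = 0.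
Proof.
move=> [n [E [e [d [injE inj_e ex0 exS van]]]]].
pose F i : lmodType R := if i is j.+1 then E j else 'rV[R]_0.
pose f i : {linear F i -> F i.+1} :=
  match i with 0 => \0 | j.+1 => d j end.
have F0 (x : F 0) : x = 0 by exact: thinmx0.
have injF i : injective_module (F i).
  case: i => [|i]; last exact: injE.
  by move=> M N j g _; exists \0 => x; rewrite /= [g x]F0.
exists (@InjRes R w F f e injF F0 inj_e ex0 exS), n.+1 => -[//|i] /=.
exact: van.
Qed.

Variable E : injres w.
Local Notation d := (ir_d E).

Lemma inj_extend i U V (j : {linear U -> V}) (g : {linear U -> E i}) :
  injective j -> exists h : {linear V -> E i}, forall x, h (j x) = g x.
Proof. exact: ir_inj. Qed.

Lemma dd0 i x : d i.+1 (d i x) = 0.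
Proof.
case: i x => [|i] x; first by rewrite [x]ir_zero !linear0.
by apply/(@ir_exactS _ _ E i); exists x.
Qed.

(** Because of the shift, classes in [Ext^i(N, w)] are represented by maps into [E i.+1]. *)
Definition cocyc i N (f : HomR N (E i.+1)) : Prop :=
  forall x, d i.+1 ((f : {linear _ -> _}) x) = 0.

Definition cobound i N (f : HomR N (E i.+1)) : Prop :=
  exists g : {linear N -> E i}, forall x, (f : {linear _ -> _}) x = d i (g x).

(* [Ext^i(N, w) = 0] *)
Definition ext0 i N : Prop := forall f : HomR N (E i.+1), cocyc f -> cobound f.

Lemma submodP_cocyc i N : submodP (@cocyc i N).
Proof.
by split=> [x|a f g fZ gZ x]; rewrite /= ?linearP ?fZ ?gZ ?scaler0 ?addr0 ?linear0.
Qed.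

Lemma submodP_cobound i N : submodP (@cobound i N).
Proof.
split=> [|a f g [f' fE] [g' gE]]; first by exists \0 => x; rewrite /= linear0.
by exists ((a \*: f') \+ g') => x; rewrite /= linearP -fE -gE.
Qed.

(** Exactness of [Ext^i(W, w) -> Ext^i(V, w) -> Ext^i(U, w)] in the middle. The next two lemmas use
    the same long exact sequence at the terms of [U] and of [W]. *)
Lemma ext0_mid i U V W (j : {linear U -> V}) (p : {linear V -> W}) :
  ses j p -> ext0 i U -> ext0 i W -> ext0 i V.
Proof.
move=> jp xU xW f fZ; have [inj_j ex ps] := jp.
have [x|g gE] := xU ((f : {linear V -> E i.+1}) \o j); first exact: fZ.
have [g' g'E] := inj_extend g inj_j.
have [v /ex[u <-]|h hE] :=
    factor_quot (f := (f : {linear V -> E i.+1}) \- (d i \o g')) ps.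
  by rewrite /= g'E -gE subrr.
have [y|k kE] := xW h.
  by have [v <-] := ps y; rewrite hE /= linearB /= dd0 fZ subrr.
exists (g' \+ (k \o p)) => v.
by rewrite /= linearD /= -kE hE /= addrC subrK.
Qed.

Lemma ext0_sub i U V W (j : {linear U -> V}) (p : {linear V -> W}) :
  ses j p -> ext0 i V -> ext0 i.+1 W -> ext0 i U.
Proof.
move=> jp xV xW f fZ; have [inj_j ex ps] := jp.
have [f' f'E] := inj_extend (f : {linear U -> E i.+1}) inj_j.
have [v /ex[u <-]|h hE] := factor_quot (f := d i.+1 \o f') ps.
  by rewrite /= f'E fZ.
have [y|k kE] := xW h.
  by have [v <-] := ps y; rewrite hE /= dd0.
have [x|g gE] := xV (f' \- (k \o p)).
  by rewrite /= linearB /= -kE hE subrr.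
exists (g \o j) => u; rewrite /= -gE /= f'E.
by rewrite (ses_comp0 u jp) linear0 subr0.
Qed.

Lemma ext0_quot i U V W (j : {linear U -> V}) (p : {linear V -> W}) :
  ses j p -> ext0 i U -> ext0 i.+1 V -> ext0 i.+1 W.
Proof.
move=> jp xU xV f fZ; have [inj_j ex ps] := jp.
have [v|g gE] := xV ((f : {linear W -> E i.+2}) \o p); first exact: fZ.
have [u|h hE] := xU (g \o j).
  by rewrite /= -gE /= (ses_comp0 u jp) linear0.
have [h' h'E] := inj_extend h inj_j.
have [v /ex[u <-]|k kE] := factor_quot (f := g \- (d i \o h')) ps.
  by rewrite /= h'E -hE subrr.
exists k => y; have [v <-] := ps y.
by rewrite kE /= linearB /= dd0 subr0 -gE.
Qed.

Lemma ext0_projective i P : projective P -> ext0 i.+1 P.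
Proof.
move=> prP f fZ.
have [|h hE] := projective_lift (p := d i.+1) (g := (f : {linear P -> E i.+2})) prP.
  by move=> x; apply/ir_exactS.
by exists h => x; rewrite hE.
Qed.

Lemma ext0_Hom N (f : HomR N (E 1)) : cocyc f ->
  exists g : {linear N -> w}, forall x, (f : {linear _ -> _}) x = ir_e E (g x).
Proof.
move=> fZ; have [|g gE] := factor_sub (f := (f : {linear N -> E 1})) (@ir_einj _ _ E).
  by move=> x; apply/ir_exact0.
by exists g => x; rewrite gE.
Qed.

Lemma cobound0 N (f : HomR N (E 1)) : cobound f <-> f = 0.
Proof.
split=> [[g fE]|->]; last exact: (submodP_cobound 0 N).1.
by apply: HomP => x; rewrite fE [g x]ir_zero linear0.
Qed.

(** The obstruction to extending [f] is its image in [Ext^1(W, w)]. *)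
Lemma Hom_extend U V W (j : {linear U -> V}) (p : {linear V -> W})
    (f : {linear U -> w}) : ses j p -> ext0 1 W ->
  exists g : {linear V -> w}, forall x, g (j x) = f x.
Proof.
move=> jp xW; have [inj_j ex ps] := jp.
have [f' f'E] := inj_extend (ir_e E \o f) inj_j.
have [v /ex[u <-]|h hE] := factor_quot (f := d 1 \o f') ps.
  by rewrite /= f'E /=; apply/ir_exact0; exists (f u).
have [y|k kE] := xW h.
  by have [v <-] := ps y; rewrite hE /= dd0.
have [x|g gE] := @ext0_Hom V (f' \- (k \o p)).
  by rewrite /= linearB /= -kE hE subrr.
exists g => u; apply: (@ir_einj _ _ E); rewrite -gE /= f'E.
by rewrite (ses_comp0 u jp) linear0 subr0.
Qed.

Section FinGen.
Hypotheses (noeR : noetherian R) (fw : fin_gen w).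

(** Finite generation of [Ext^i(N, w)], expressed by finitely many cocycles that span modulo
    coboundaries. Degree zero is [Hom(N, w)], and [Ext^(i+1)(N, w)] is a quotient of [Ext^i(K, w)]
    for a syzygy [K] of [N]. *)
Lemma ext_fg i N : fin_gen N ->
  exists n (F : {linear 'rV[R]_n -> HomR N (E i.+1)}),
    (forall c, cocyc (F c)) /\
    forall f : HomR N (E i.+1), cocyc f -> exists c, cobound (f - F c).
Proof.
elim: i N => [|i IHi] N fN.
  have /fin_genP[n [p ps]] := fin_gen_Hom noeR fN fw.
  exists n, (postcomp (ir_e E) \o p); split=> [c x|f fZ].
    by rewrite /=; apply/ir_exact0; eexists.
  have [g gE] := ext0_Hom fZ; have [c pc] := ps (g : HomR N w).
  exists c; apply/cobound0; apply/eqP; rewrite subr_eq0; apply/eqP/HomP => x.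
  by rewrite /= pc gE.
have [n [p ps]] := (fin_genP N).1 fN; have [K [j jp]] := ses_sub ps.
have [inj_j ex _] := jp.
have [|l [F [FZ Fgen]]] := IHi K; first exact: (fin_gen_inj noeR inj_j (fin_gen_rV _ n)).
have /choice[f' f'E] : forall k, exists f' : {linear 'rV[R]_n -> E i.+1},
    forall x, f' (j x) = ev x (F (delta_mx 0 k)).
  by move=> k; apply: (inj_extend _ inj_j).
(* [h k] represents the image of the [k]-th generating class of [K] under the connecting map. *)
have /choice[h hE] : forall k, exists h : HomR N (E i.+2),
    forall v, ev (p v) h = d i.+1 (f' k v).
  move=> k; have [v /ex[u <-]|h hE] := factor_quot (f := d i.+1 \o f' k) ps.
    by rewrite /= f'E; exact: FZ.
  by exists h.
have hZ k : cocyc (h k).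
  by move=> y; have [v <-] := ps y; rewrite [X in d _ X]hE dd0.
exists l, (comb h); split=> [c|f fZ]; first exact: (submodP_sum (submodP_cocyc _ _)).
have [v|g gE] := ext0_projective (projective_rV (n := n))
    (f := (f : {linear N -> E i.+2}) \o p).
  exact: fZ.
have [|c [k kE]] := Fgen ((g : {linear _ -> _}) \o j).
  by move=> u; rewrite /= -gE /= (ses_comp0 u jp) linear0.
have [k' k'E] := inj_extend k inj_j.
pose f'' : HomR 'rV[R]_n (E i.+1) := comb (f' : _ -> HomR _ _) c.
have f''E x : ev x f'' = comb (fun k => f' k x) c by rewrite comb_ev.
have [v /ex[u <-]|q qE] :=
    factor_quot (f := (g \- (d i \o k')) \- (f'' : {linear _ -> _})) ps.
  rewrite /= k'E -kE [X in _ - X = _]f''E.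
  have -> : comb (fun k0 => f' k0 (j u)) c = ev u (F c).
    rewrite (linear_comb F c) comb_ev.
    by apply: eq_bigr => k0 _; rewrite f'E.
  by rewrite -[X in _ - X - _]/(g (j u) - ev u (F c)) subKr subrr.
exists c, q => y; have [v <-] := ps y.
rewrite -[LHS]/((f : {linear _ -> _}) (p v) - ev (p v) (comb h c)).
rewrite qE /= !linearB /= dd0 subr0 -gE; congr (_ - _).
rewrite comb_ev -[X in d _ X]/(ev v f'') f''E linear_sum.
by apply: eq_bigr => k0 _; rewrite linearZ hE.
Qed.

End FinGen.

End InjectiveResolution.

(** * Devissage to the residue field, and bounds on Ext *)

Section Devissage.
Variables (R : comNzRingType) (m : idealr R).
Implicit Types U V W N K P M : lmodType R.
Hypotheses (noeR : noetherian R) (locR : local_ring m).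

Definition cyclic_by V (u : V) : Prop := forall v, exists a, v = a *: u.

Lemma submodP_ann V (u : V) : submodP (fun a : R^o => a *: u = 0).
Proof.
split=> [|a x y xu yu]; first by rewrite scale0r.
by rewrite scalerDl -scalerA xu yu scaler0 addr0.
Qed.

Lemma submodP_line V (u : V) : submodP (fun v => exists a, v = a *: u).
Proof.
split=> [|a _ _ [x ->] [y ->]]; first by exists 0; rewrite scale0r.
by exists (a * x + y); rewrite scalerDl scalerA.
Qed.

Lemma ses_line V (u : V) : exists U W (j : {linear U -> V}) (p : {linear V -> W})
  (u0 : U), [/\ ses j p, j u0 = u & cyclic_by u0].
Proof.
have [U [j [inj_j jP]]] := submod_sub (submodP_line u).
have [W [p jp]] := ses_quot inj_j.
have /jP[u0 ju0] : exists a, u = a *: u by exists 1; rewrite scale1r.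
exists U, W, j, p, u0; split=> // v.
have /jP[a av] : exists u', j u' = j v by exists v.
by exists a; apply: inj_j; rewrite av linearZ /= ju0.
Qed.

(** Noetherian induction on the annihilator of a generator. If [a * b] annihilates [u] but neither
    factor does, the submodule generated by [b *: u] and the quotient by it both have larger
    annihilators. The prime case may still assume the claim for cyclic modules with larger
    annihilator. *)
Lemma devissage (Phi : lmodType R -> Prop) :
  (forall V, (forall v : V, v = 0) -> Phi V) ->
  (forall U V W (j : {linear U -> V}) (p : {linear V -> W}),
     ses j p -> Phi U -> Phi W -> Phi V) ->
  (forall V (u : V), cyclic_by u -> u <> 0 ->
     (forall a b, (a * b) *: u = 0 -> a *: u = 0 \/ b *: u = 0) ->
     (forall W (w : W), cyclic_by w ->
        proper_sup (fun a : R^o => a *: u = 0) (fun a : R^o => a *: w = 0) ->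
        Phi W) -> Phi V) ->
  forall V, fin_gen V -> Phi V.
Proof.
move=> h0 hext hprime; apply: fin_gen_ind => // V u.
suff H (I : R^o -> Prop) : submodP I -> forall V (u : V), cyclic_by u ->
    (forall a, I a <-> a *: u = 0) -> Phi V.
  by move=> uV; apply: (H _ (submodP_ann u)).
move: I; apply: (ideal_ind noeR) => I hI IH {u}V u uV Iu.
have Isup W (w : W) : proper_sup (fun a : R^o => a *: u = 0)
    (fun a : R^o => a *: w = 0) -> cyclic_by w -> Phi W.
  move=> [le [b bw bu]] wW; apply: (IH _ (submodP_ann w) _ W w) => //.
  by split=> [x /Iu/le //|]; exists b => // /Iu.
have [u0|u0] := pselect (u = 0).
  by apply: h0 => v; have [a ->] := uV v; rewrite u0 scaler0.
have [pr|npr] := pselect (forall a b : R, (a * b) *: u = 0 -> a *: u = 0 \/ b *: u = 0).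
  by apply: (hprime V u) => // W w wW /Isup; exact.
have [a [b [abu au bu]]] : exists a b, [/\ (a * b) *: u = 0, a *: u <> 0 & b *: u <> 0].
  apply: contrapT => h; apply: npr => a b abu; apply: contrapT => /not_orP[? ?].
  by apply: h; exists a, b.
have [U [W [j [p [v0 [jp jv0 v0U]]]]]] := ses_line (b *: u).
have [inj_j ex ps] := jp.
apply: (hext _ _ _ _ _ jp).
  apply: (Isup _ v0) => //; split=> [x xu|].
    by apply: inj_j; rewrite linear0 linearZ /= jv0 scalerA mulrC -scalerA xu scaler0.
  by exists a => //; apply: inj_j; rewrite linear0 linearZ /= jv0 scalerA.
apply: (Isup _ (p u)).
  split=> [x xu|]; first by rewrite -linearZ xu linear0.
  by exists b => //; rewrite -linearZ -jv0 (ses_comp0 v0 jp).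
by move=> y; have [v <-] := ps y; have [c ->] := uV v; exists c; rewrite linearZ.
Qed.

(** [V] is a copy of the residue field with generator [u]. *)
Definition simple_by V (u : V) : Prop :=
  [/\ cyclic_by u, u <> 0 & forall a, a \in m -> a *: u = 0].

Lemma simple_ann V (u : V) a : simple_by u -> a *: u = 0 -> a \in m.
Proof.
move=> [_ u0 _] au; apply: contrapT => /negP/(unit_notin noeR locR)[b ba].
by apply: u0; rewrite -[u]scale1r -ba -scalerA au scaler0.
Qed.

Lemma simple_map V W (u : V) (y : W) : simple_by u ->
  (forall a, a \in m -> a *: y = 0) -> exists f : {linear V -> W}, f u = y.
Proof.
move=> su my; have [uV u0 mu] := su.
have [v|a v v' _ _ [b [-> ->]] [b' [-> ->]]|z [b [bu ->]]|f fE] :=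
    @linear_graph R V W (fun v z => exists b, v = b *: u /\ z = b *: y).
- by have [b ->] := uV v; exists (b *: y), b.
- by exists (a * b + b'); rewrite !scalerDl !scalerA.
- by apply: my; apply: (simple_ann su).
by exists f; apply/fE; exists 1; rewrite !scale1r.
Qed.

Lemma simple_map_inj V W (u : V) (f : {linear V -> W}) : simple_by u ->
  f u <> 0 -> injective f.
Proof.
move=> su fu0; have [uV u0 mu] := su.
suff ker v : f v = 0 -> v = 0.
  move=> x y fxy; apply/eqP; rewrite -subr_eq0; apply/eqP/ker.
  by rewrite linearB /= fxy subrr.
have [b ->] := uV v; rewrite linearZ /= => bf; apply: mu.
apply: contrapT => /negP/(unit_notin noeR locR)[c cb].
by apply: fu0; rewrite -[f u]scale1r -cb -scalerA bf scaler0.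
Qed.

(** By Noetherian induction some nonzero multiple of [v] has a prime annihilator. This prime
    contains the annihilator of [V], hence contains [m], so the multiple lies in the socle. *)
Lemma simple_multiple V (v : V) :
  (forall q : prime_idealr R, (forall r, (forall u : V, r *: u = 0) -> r \in q) ->
     {subset m <= q}) -> v <> 0 ->
  exists a, a *: v <> 0 /\ forall r, r \in m -> r *: (a *: v) = 0.
Proof.
move=> hq.
suff H (I : R^o -> Prop) : submodP I -> forall v : V,
    (forall a, I a <-> a *: v = 0) -> v <> 0 ->
    exists a, a *: v <> 0 /\ forall r, r \in m -> r *: (a *: v) = 0.
  exact: (H _ (submodP_ann v)).
move: I; apply: (ideal_ind noeR) => I hI IH {}v Iv v0.
have [pr|npr] := pselect (forall a b : R, I (a * b) -> I a \/ I b).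
  have [|q qI] := prime_idealr_of hI _ pr; first by move/Iv; rewrite scale1r.
  exists 1; rewrite scale1r; split=> // r rm; apply/Iv/qI; apply: hq => // x xV.
  exact/qI/Iv.
have [a [b [Iab na nb]]] : exists a b : R, [/\ I (a * b), ~ I a & ~ I b].
  apply: contrapT => h; apply: npr => x y Ixy; apply: contrapT => /not_orP[nx ny].
  by apply: h; exists x, y.
have [||c [cv cm]] := IH _ (submodP_ann (b *: v)) _ (b *: v) (fun=> iff_refl _).
- split=> [x /Iv xv|]; first by rewrite scalerA mulrC -scalerA xv scaler0.
  by exists a => //; rewrite scalerA; exact/Iv.
- by move/Iv.
by exists (c * b); rewrite -scalerA.
Qed.

Lemma mulmap V a : exists j : {linear V -> V}, forall v, j v = a *: v.
Proof.
have [v|b x x' _ _ -> ->|y ->|j jE] := @linear_graph R V V (fun v y => y = a *: v).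
- by eexists.
- by rewrite scalerDr !scalerA mulrC.
- by rewrite scaler0.
by exists j => v; apply/jE.
Qed.

Lemma ses_mul V a (j : {linear V -> V}) : (forall v, j v = a *: v) ->
  (forall v : V, a *: v = 0 -> v = 0) ->
  exists W (p : {linear V -> W}), ses j p.
Proof.
move=> jE aV; apply: ses_quot => x y; rewrite !jE => /eqP.
by rewrite -subr_eq0 -scalerBr => /eqP/aV/eqP; rewrite subr_eq0 => /eqP.
Qed.

(** [W] is [V / s V], reached by one quotient at a time; left exactness at each step records that
    [s] is weakly regular. *)
Inductive regquot : seq R -> lmodType R -> lmodType R -> Prop :=
| regquot_nil V : regquot [::] V V
| regquot_cons a s V V1 W (j : {linear V -> V}) (p : {linear V -> V1}) :
    (forall v, j v = a *: v) -> ses j p -> regquot s V1 W ->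
    regquot (a :: s) V W.

Lemma ses_mulP V W a (j : {linear V -> V}) (p : {linear V -> W}) :
  (forall v, j v = a *: v) -> ses j p ->
  forall v, p v = 0 <-> exists u, a *: u = v.
Proof.
move=> jE [_ ex _] v; rewrite (ex v).
by split=> [[u <-]|[u <-]]; exists u; rewrite jE.
Qed.

Lemma wreg_regquot s V : wreg s V -> exists W, regquot s V W.
Proof.
elim: s V => [|a s IHs] V sV; first by exists V; constructor.
have [j jE] := mulmap V a.
have aV (v : V) : a *: v = 0 -> v = 0.
  by move=> av; apply/seq_mul_nil; apply: (sV 0%N) => //; apply/seq_mul_nil.
have [V1 [p jp]] := ses_mul jE aV; have [_ ex ps] := jp.
have [_ /IHs[W sW]] := (wreg_cons s ps (ses_mulP jE jp)).1 sV.
by exists W; apply: regquot_cons jE jp sW.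
Qed.

Lemma regquot_map s V W : regquot s V W ->
  exists p : {linear V -> W}, surjective p /\ forall v, p v = 0 <-> seq_mul s v.
Proof.
elim=> {s V W} [V|a s V V1 W j p jE jp _ [q [qs qP]]].
  by exists idfun; split=> [v|v]; [exists v|rewrite seq_mul_nil].
have [_ ex ps] := jp; exists (q \o p); split=> [y|v].
  by have [z <-] := qs y; have [v <-] := ps z; exists v.
rewrite /= qP seq_mul_cons; split=> [/(seq_mul_lift ps)[v' sv' pv']|].
  have /(ses_mulP jE jp)[u au] : p (v - v') = 0 by rewrite linearB /= pv' subrr.
  by exists u, v'; rewrite au subrK.
move=> [u [v' [sv' ->]]]; rewrite linearD /= (iffRL (ses_mulP jE jp _)); last by exists u.
by rewrite add0r; exact: seq_mul_linear.
Qed.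

Section Ext.
Variables (w : lmodType R) (E : injres w).
Local Notation d := (ir_d E).
Hypothesis fw : fin_gen w.

Lemma ext0_zero i V : (forall v : V, v = 0) -> ext0 E i V.
Proof.
by move=> V0 f _; exists \0 => v; rewrite (V0 v) !linear0.
Qed.

(** Since [Ext^(i+1)(W, w)] vanishes, multiplication by [a] is onto on [Ext^i(V, w)], and Nakayama's
    lemma applies modulo coboundaries. *)
Lemma ext0_nakayama i V W a (j : {linear V -> V}) (p : {linear V -> W}) :
  a \in m -> (forall v, j v = a *: v) -> ses j p -> fin_gen V ->
  ext0 E i.+1 W -> ext0 E i V.
Proof.
move=> am jE jp fV xW f fZ; have [inj_j ex ps] := jp.
have [Z [z [inj_z zP]]] := submod_sub (submodP_cocyc E i V).
have [n [F [FZ Fgen]]] := ext_fg E noeR fw i fV.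
have [|F' F'E] := factor_sub (f := F) inj_z; first by move=> c; apply/zP.
have hP : submodP (fun u => cobound (z u)).
  split=> [|b x y xB yB]; first by rewrite linear0; exact: (submodP_cobound E i V).1.
  by rewrite linearP; exact: (submodP_cobound E i V).2.
have /zP[u0 zu0] := fZ; rewrite -zu0.
apply: (nakayama_mod noeR locR (m := m) (p := F') hP) => u.
  have [|c cB] := Fgen (z u); first by apply/zP; exists u.
  by exists c; rewrite linearB /= F'E.
have zuZ : cocyc (z u) by apply/zP; exists u.
(* Extending along [j] divides [z u] by [a]; the failure of [g] to be a cocycle is a class in
   [Ext^(i+1)(W, w)]. *)
have [g gE] := inj_extend (z u : {linear V -> E i.+1}) inj_j.
have [v /ex[v' <-]|h hE] := factor_quot (f := d i.+1 \o g) ps.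
  by rewrite /= gE zuZ.
have [y|k kE] := xW h; first by have [v <-] := ps y; rewrite hE /= dd0.
have /zP[u' zu'] : cocyc (g \- (k \o p) : HomR V (E i.+1)).
  by move=> v; rewrite /= linearB /= -kE hE subrr.
exists (a *: u'); first exact: mspanZ.
suff -> : u = a *: u' by rewrite subrr linear0; exact: (submodP_cobound E i V).1.
apply: inj_z; apply: HomP => v.
rewrite linearZ /= zu' -[LHS]gE jE linearZ /=.
rewrite -[RHS]/(a *: (g v - k (p v))) scalerBr.
suff -> : a *: k (p v) = 0 by rewrite subr0.
by rewrite -!linearZ -jE (ses_comp0 v jp) linear0.
Qed.

Lemma ext0_regquot_up c s V W : regquot s V W ->
  (forall i, (c < i)%N -> ext0 E i V) ->
  forall i, (c + size s < i)%N -> ext0 E i W.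
Proof.
move=> sV; elim: sV c => {s V W} [V|a s V V1 W j p jE jp _ IH] c xV i.
  by rewrite addn0; exact: xV.
rewrite /= addnS -addSn; apply: IH => -[//|k] ck.
by apply: (ext0_quot jp); apply: xV => //; exact: ltnW.
Qed.

Lemma ext0_regquot_down c s V W : regquot s V W -> {subset s <= m} -> fin_gen V ->
  (forall i, (c + size s < i)%N -> ext0 E i W) ->
  forall i, (c < i)%N -> ext0 E i V.
Proof.
move=> sV; elim: sV c => {s V W} [V|a s V V1 W j p jE jp _ IH] c sm fV xW i ci.
  by apply: xW; rewrite addn0.
have [_ _ ps] := jp.
apply: (ext0_nakayama _ jE jp fV); first by apply: sm; rewrite inE eqxx.
apply: (IH c.+1) => //; last by move=> k; rewrite addSnnS; exact: xW.
  by move=> x xs; apply: sm; rewrite inE xs orbT.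
exact: fin_gen_surj ps fV.
Qed.

(** On a prime cyclic module other than the residue field some [a] in [m] is a nonzerodivisor, and
    the quotient by [a] has a larger annihilator. Passing to it raises the degree by one, so all
    degrees from [t] on are treated together. *)
Lemma ext0_of_simple t :
  (forall V (u : V), simple_by u -> forall i, (t <= i)%N -> ext0 E i V) ->
  forall V, fin_gen V -> forall i, (t <= i)%N -> ext0 E i V.
Proof.
move=> hs; apply: devissage => [V V0 i _|U V W j p jp xU xW i ti|V u uV u0 pr IH i ti].
- exact: ext0_zero.
- exact: ext0_mid jp (xU i ti) (xW i ti).
have [mu|] := pselect (forall a, a \in m -> a *: u = 0); first by apply: (hs V u).
move/existsNP => [a /not_implyP[am au]].
have aV (v : V) : a *: v = 0 -> v = 0.
  by have [b ->] := uV v; rewrite scalerA => /pr[].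
have [j jE] := mulmap V a; have [W [p jp]] := ses_mul jE aV.
have [_ _ ps] := jp.
have fV : fin_gen V.
  exists 1%N, (fun=> u) => v; have [b ->] := uV v.
  by exists (fun=> b); rewrite big_ord1.
apply: (ext0_nakayama am jE jp fV); apply: (IH W (p u)) => //; last exact: leqW.
  by move=> y; have [v <-] := ps y; have [b ->] := uV v; exists b; rewrite linearZ.
split=> [b bu|]; first by rewrite -linearZ bu linear0.
by exists a => //; rewrite -linearZ -jE (ses_comp0 u jp).
Qed.

Section Bound.
Variables (dim : nat) (x : seq R).
Hypotheses (kd : krull_dim R dim) (xm : {subset x <= m}) (xR : wreg x R^o)
  (xd : size x = dim).
Hypothesis Efin : exists n, forall i, (n < i)%N -> forall y : E i, y = 0.

Lemma regquot_prime W : regquot x R^o W ->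
  forall q : prime_idealr R, (forall r, (forall u : W, r *: u = 0) -> r \in q) ->
  {subset m <= q}.
Proof.
move=> /regquot_map[p [ps pP]] q qW.
apply: (prime_over_wreg noeR locR kd xR xd) => r xr; apply: qW => u.
have [a <-] := ps u; rewrite -linearZ; apply/pP.
by rewrite /GRing.scale /= mulrC; apply: (submodPZ (submodP_seq_mul x R^o)).
Qed.

Lemma regquot_neq0 W (p : {linear R^o -> W}) :
  (forall v, p v = 0 <-> seq_mul x v) -> p 1 <> 0.
Proof.
move=> pP /pP/(seq_mul_mspan xm) x1.
have x1m : (1 : R) \in m.
  have [n [c [g [cm ->]]]] := x1; rewrite /comb rpred_sum // => k _.
  by rewrite /GRing.scale /= mulrC; exact: mulm.
by move: x1m; rewrite idealr1.
Qed.

(** Descending induction on the degree from the finite bound [n]. The residue field embeds into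
    [R / x], whose Ext vanishes above [dim]; the Ext of the cokernel one degree higher vanishes by
    induction. *)
Lemma ext0_gt_dim V : fin_gen V -> forall i, (dim < i)%N -> ext0 E i V.
Proof.
have [n En] := Efin.
suff H k V' : fin_gen V' -> forall i, (dim < i)%N -> (n - k <= i)%N -> ext0 E i V'.
  by move=> fV i di; apply: (H n) => //; rewrite subnn.
elim: k V' => [|k IHk] V' fV' i di ki.
  move=> f _; exists \0 => v; rewrite linear0; apply: En.
  by rewrite ltnS -[n]subn0.
have [ki'|ki'] := leqP (n - k)%N i; first exact: (IHk V').
have H t : (dim < t)%N -> (n - k <= t.+1)%N ->
    forall V (u : V), simple_by u -> ext0 E t V.
  move=> dt kt U u su; have [W xW] := wreg_regquot xR.
  have [p [ps pP]] := regquot_map xW.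
  have [a [ap am]] := simple_multiple (regquot_prime xW) (regquot_neq0 pP).
  have [f fu] := simple_map su am.
  have inj_f : injective f by apply: (simple_map_inj su); rewrite fu.
  have [C [q fq]] := ses_quot inj_f; have [_ _ qs] := fq.
  have fW : fin_gen W.
    exact: fin_gen_surj ps (fin_gen_reg R).
  apply: (ext0_sub fq); last by apply: IHk => //; [exact: fin_gen_surj qs fW|exact: ltnW].
  apply: (@ext0_regquot_up 0 _ _ _ xW); last by rewrite xd.
  move=> -[//|l] _; apply: ext0_projective; exact: projective_reg.
apply: (@ext0_of_simple i) => // U u su l il.
have dl : (dim < l)%N by exact: leq_trans il.
apply: (H l dl _ U u su).
by lia.
Qed.

End Bound.

(** Modulo a weakly regular sequence of length [dim] on [V], Ext vanishes above [dim]; each step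
    back to [V] lowers this bound by one. *)
Lemma ext0_CM dim V : krull_dim R dim -> CM m V ->
  (forall W, fin_gen W -> forall i, (dim < i)%N -> ext0 E i W) ->
  forall i, (0 < i)%N -> ext0 E i V.
Proof.
move=> kd cV xgt; have [s [sm sV sd]] := CM_wreg kd cV; have [fV _] := cV.
have [W sW] := wreg_regquot sV; apply: (ext0_regquot_down sW) => // i.
rewrite sd; apply: xgt; have [p [ps _]] := regquot_map sW.
exact: fin_gen_surj ps fV.
Qed.

End Ext.
End Devissage.

(** * Ext from projective resolutions, Rees shifting and balance *)

Section ProjectiveResolution.
Variables (R : comNzRingType) (M : lmodType R) (F : resolution M).
Implicit Types U V W N K P Q : lmodType R.
Local Notation d := (res_d F).

Definition rcocyc V i (f : HomR (res_mod F i) V) : Prop := forall x, ev (d i x) f = 0.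

(* Any two classes in [Ext^i(M, V)] have a linear relation with coefficients
   in [L]: [L = {(1, 0)}] expresses vanishing, and for [M = R/m] the complement
   of [m * m] expresses that the dimension is at most one. *)
Definition rel_ext (L : R -> R -> Prop) i V : Prop :=
  forall f g : HomR (res_mod F i) V, rcocyc f -> rcocyc g ->
  exists a b, L a b /\ is_coboundary (a *: f + b *: g).

Definition res_ext0 i V : Prop :=
  forall f : HomR (res_mod F i) V, rcocyc f -> is_coboundary f.

Lemma res_dd i x : d i (d i.+1 x) = 0.
Proof. by apply/res_exactS; exists x. Qed.

Lemma coboundary_d V i (f : HomR (res_mod F i) V) x :
  is_coboundary f -> ev (d i x) f = 0.
Proof.
case: i f x => [|i] f x; first by move=> /= ->.
by move=> [g fE]; rewrite /ev fE res_dd linear0.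
Qed.

(** Multiplication by [a] lifts the zero map of [M], hence is null-homotopic. Of the homotopy
    identity only [d h d = a d] is kept, which is what the next step of the construction needs. *)
Lemma homotopy a : (forall x : M, a *: x = 0) -> forall i,
  exists h : {linear res_mod F i -> res_mod F i.+1},
  (forall z, d i (h (d i z)) = a *: d i z) /\
  forall V (f : HomR (res_mod F i) V), rcocyc f -> is_coboundary (a *: f).
Proof.
move=> aM; have [j0 j0E] := mulmap (res_mod F 0) a.
elim=> [|i [h [hE _]]].
  have [|h hE] := projective_lift (p := d 0%N) (g := j0) (@res_projective _ _ F 0).
    by move=> x; apply/(@res_exact0 _ _ F); rewrite j0E linearZ /= aM.
  exists h; split=> [z|V f fZ]; first by rewrite hE j0E.
  by apply: HomP => x; rewrite -[LHS]/(a *: f x) -linearZ -j0E -hE; exact: fZ.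
have [j jE] := mulmap (res_mod F i.+1) a.
have [|k kE] := projective_lift (p := d i.+1) (g := j \- (h \o d i))
  (@res_projective _ _ F i.+1).
  move=> x; apply/(@res_exactS _ _ F i).
  by rewrite /= linearB /= hE jE linearZ /= subrr.
exists k; split=> [z|V f fZ]; first by rewrite kE /= jE res_dd linear0 subr0.
exists (f \o h) => x /=.
rewrite -[LHS]/(a *: f x) -linearZ -[a *: x]jE.
rewrite -[j x](subrK (h (d i x))) -[j x - h (d i x)]/((j \- (h \o d i)) x) -kE.
by rewrite linearD [X in X + _]fZ add0r.
Qed.

Section Shift.
Variables (V W : lmodType R) (a : R) (j : {linear V -> V}) (p : {linear V -> W}).
Hypotheses (aM : forall x : M, a *: x = 0) (jE : forall v, j v = a *: v) (jp : ses j p).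

Lemma lift_mod P (f : {linear P -> V}) : (forall x, p (f x) = 0) ->
  exists g : {linear P -> V}, forall x, f x = a *: g x.
Proof.
have [inj_j ex ps] := jp => pf.
have [x|g gE] := factor_sub (f := f) inj_j; first by apply/ex.
by exists g => x; rewrite -jE gE.
Qed.

Lemma coboundary_lift i (f : HomR (res_mod F i) V) :
  is_coboundary (postcomp p f) -> exists g h : HomR (res_mod F i) V,
    is_coboundary g /\ f = g + a *: h.
Proof.
have [inj_j ex ps] := jp; case: i f => [|i] f.
  move=> pf; have [x|h hE] := lift_mod (f := (f : {linear _ -> _})).
    exact: (congr1 (ev x) pf).
  exists 0, h; split=> //; apply: HomP => x; rewrite /= add0r; exact: hE.
move=> [k kE]; have [k' k'E] := res_projective (r := F) (k : {linear _ -> _}) ps.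
have [x|h hE] := lift_mod (f := (f : {linear _ -> V}) \- (k' \o d i)).
  by rewrite linearB /= k'E -kE subrr.
exists (k' \o d i), h; split; first by exists k'.
by apply: HomP => x; rewrite /= addrC; apply/eqP; rewrite -subr_eq -hE.
Qed.

(** Multiplication by [a] on [Ext^i(M, V)] is zero by the homotopy and injective because
    [Ext^(i-1)(M, W)] vanishes; in degree zero injectivity comes from [V] itself. *)
Lemma res_ext0_shift i : (forall k, i = k.+1 -> res_ext0 k W) -> res_ext0 i V.
Proof.
have [inj_j ex ps] := jp; move=> xW f fZ; have [_ [_ /(_ V f fZ) af]] := homotopy aM i.
have aV (u v : V) : a *: u = a *: v -> u = v by rewrite -!jE => /inj_j.
case: i f fZ af xW => [|i] f fZ /= af xW.
  by apply: HomP => x; apply: aV; rewrite scaler0; exact: (congr1 (ev x) af).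
case: af => g gE; have [|g' [h [g'B gh]]] := @coboundary_lift _ g.
  apply: (xW i erefl) => x; rewrite -[LHS]/(p (g (d i x))) -gE.
  by rewrite /= -jE (ses_comp0 _ jp).
exists h => x; apply: aV; transitivity (ev (d i x) g); [exact: gE|rewrite gh].
by rewrite -[LHS]/(ev (d i x) g' + a *: h (d i x)) (coboundary_d _ g'B) add0r.
Qed.

(** The connecting map [Ext^i(M, W) -> Ext^(i+1)(M, V)] is injective once [Ext^i(M, V) = 0], so
    relations can be pulled back along it. *)
Lemma rel_ext_shift L i : res_ext0 i V -> rel_ext L i.+1 V -> rel_ext L i W.
Proof.
have [inj_j ex ps] := jp; move=> xV relV.
have conn (f : HomR (res_mod F i) W) : rcocyc f ->
    exists f' : HomR (res_mod F i) V, exists g : HomR (res_mod F i.+1) V,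
    [/\ postcomp p f' = f, rcocyc g & forall x, ev (d i x) f' = a *: ev x g].
  move=> fZ; have [f' f'E] := res_projective (r := F) (f : {linear _ -> _}) ps.
  have [x|g gE] := lift_mod (f := f' \o d i); first by rewrite /= f'E; exact: fZ.
  exists f', g; split=> //; first exact: HomP.
  by move=> x; apply: inj_j; rewrite linear0 jE -[LHS]gE /= res_dd linear0.
move=> _ _ /conn[f [f' [<- f'Z fE]]] /conn[g [g' [<- g'Z gE]]].
have [b [c [Lbc [h hE]]]] := relV _ _ f'Z g'Z; exists b, c; split=> //.
rewrite -!linearZ -linearD /=.
have /xV : rcocyc (b *: f + c *: g - a *: h).
  move=> x; rewrite linearB linearD !linearZ /= fE gE.
  have -> : (h : {linear _ -> _}) (d i x) = b *: ev x f' + c *: ev x g' by rewrite -[LHS]hE.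
  by rewrite scalerN scalerDr !scalerA ![a * _]mulrC subrr.
have -> : postcomp p (b *: f + c *: g) = postcomp p (b *: f + c *: g - a *: h).
  rewrite linearB; apply: HomP => x; rewrite -[RHS]/(_ x - p (a *: h x)).
  by rewrite -jE (ses_comp0 _ jp) subr0.
move: (_ - _) => k; case: (i) k => [|l] k /=; first by move=> ->; rewrite linear0.
by move=> [k' kE]; exists (postcomp p k') => x; rewrite /= kE.
Qed.

End Shift.

(** Rees' theorem, by iterating the two shifts along [s]: vanishing below [size s], and an embedding
    of [Hom(M, W)] into Ext of degree [size s]. *)
Lemma res_ext0_regquot s V W : regquot s V W ->
  (forall a, a \in s -> forall x : M, a *: x = 0) ->
  (forall i, (i < size s)%N -> res_ext0 i V) /\
  forall L, rel_ext L (size s) V -> rel_ext L 0 W.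
Proof.
elim=> {s V W} [//|a s V V1 W j p jE jp _ IH] sM.
have [|x1 relL] := IH; first by move=> b bs; apply: sM; rewrite inE bs orbT.
have aM : forall x : M, a *: x = 0 by apply: sM; rewrite inE eqxx.
have xV i : (i < (size s).+1)%N -> res_ext0 i V.
  move=> il; apply: (res_ext0_shift aM jE jp) => k ik; apply: x1.
  by rewrite -ltnS -ik.
split=> [//|L relV]; apply/relL/(rel_ext_shift jE jp) => //.
exact: xV.
Qed.

Section Balance.
Variables (w : lmodType R) (E : injres w) (L : R -> R -> Prop).
Local Notation dE := (ir_d E).

Definition rel_iext i N : Prop :=
  forall f g : HomR N (E i.+1), cocyc f -> cocyc g ->
  exists a b, L a b /\ cobound (a *: f + b *: g).

Lemma rel_iext0 : rel_ext L 0 w -> rel_iext 0 M.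
Proof.
move=> relw f g /ext0_Hom[f' f'E] /ext0_Hom[g' g'E].
have augZ (h : {linear M -> w}) : rcocyc (h \o res_aug F : HomR (res_mod F 0) w).
  move=> x; rewrite -[LHS]/(h (res_aug F (d 0 x))).
  by rewrite (iffRL (@res_exact0 _ _ F _)) ?linear0 //; exists x.
have [a [b [Lab ab]]] := relw _ _ (augZ f') (augZ g').
exists a, b; split=> //; apply/cobound0; apply: HomP => y.
have [x <-] := @res_aug_surj _ _ F y.
have := congr1 (ev x) ab; rewrite -[LHS]/(a *: f' (res_aug F x) + b *: g' (res_aug F x)).
by rewrite /= f'E g'E -!linearZ -linearD /= => ->; rewrite linear0.
Qed.

(** [Q] is the [j]-th syzygy of [M]. Dimension shifting turns Ext of [M] in degree [j + i + 1] into
    [Ext^(i+1)(Q, w)], which compares the two computations without a double complex. *)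
Lemma rel_iextS i j Q (q : {linear res_mod F j -> Q}) :
  surjective q -> exact (d j) q -> rel_ext L (j + i.+1) w -> rel_iext i.+1 Q.
Proof.
elim: i j Q q => [|i IHi] j Q q qs ex relw f g fZ gZ;
    have qd x : q (d j x) = 0 by (apply/ex; exists x).
  rewrite addn1 in relw.
  have conn (t : HomR Q (E 2)) : cocyc t -> exists h : HomR (res_mod F j) (E 1),
      exists f' : HomR (res_mod F j.+1) w,
      [/\ forall x, ev (q x) t = dE 1 (ev x h), rcocyc f'
        & forall x, ev (d j x) h = ir_e E (ev x f')].
    move=> tZ; have [x|h hE] := ext0_projective (@res_projective _ _ F j)
        (f := (t : {linear Q -> E 2}) \o q); first exact: tZ.
    have [x|f' f'E] := @ext0_Hom _ _ E _ (h \o d j : HomR _ _).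
      by rewrite /= -hE /= qd linear0.
    exists h, f'; split=> // x; apply: (@ir_einj _ _ E).
    by rewrite linear0 -[LHS]f'E /= res_dd linear0.
  have [h [f' [fE f'Z f'E]]] := conn f fZ; have [k [g' [gE g'Z g'E]]] := conn g gZ.
  have [a [b [Lab [l lE]]]] := relw _ _ f'Z g'Z; exists a, b; split=> //.
  pose hk : HomR (res_mod F j) (E 1) := a *: h + b *: k - postcomp (ir_e E) l.
  have [x /ex[y <-]|u uE] := factor_quot (f := (hk : {linear _ -> _})) qs.
    rewrite -[LHS]/(a *: ev (d j y) h + b *: ev (d j y) k - ir_e E (l (d j y))).
    have -> : l (d j y) = a *: ev y f' + b *: ev y g' by rewrite -[LHS]lE.
    by rewrite f'E g'E linearD !linearZ /= subrr.
  exists u => y; have [x <-] := qs y; rewrite uE.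
  rewrite -[LHS]/(a *: ev (q x) f + b *: ev (q x) g).
  rewrite -[in RHS]/(a *: ev x h + b *: ev x k - ir_e E (l x)) fE gE.
  have el0 : dE 1 (ir_e E (l x)) = 0 by apply/ir_exact0; exists (l x).
  by rewrite linearB linearD !linearZ /= el0 subr0.
(* [Q'] is the next syzygy; passing to it lowers the degree over [E] by one. *)
have [Q' [j' [inj_j j'P]]] := submod_sub (submodP_im (d j)).
have [x|q' q'E] := factor_sub (f := d j) inj_j; first by apply/j'P; exists x.
have jq : ses j' q by split=> // x; rewrite (ex x) j'P.
have q's : surjective q'.
  move=> y; have /j'P[x xE] : exists u, j' u = j' y by exists y.
  by exists x; apply: inj_j; rewrite q'E.
have exq' : exact (d j.+1) q'.
  move=> x; rewrite -(@res_exactS _ _ F j x) -q'E.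
  by split=> [->|/eqP]; rewrite ?linear0 // -(linear0 j') (inj_eq inj_j) => /eqP.
have relQ' : rel_iext i.+1 Q' by apply: IHi q's exq' _; rewrite addSnnS.
have conn (t : HomR Q (E i.+3)) : cocyc t -> exists h : HomR (res_mod F j) (E i.+2),
    (forall x, ev (q x) t = dE i.+2 (ev x h)) /\ cocyc (precomp j' h).
  move=> tZ; have [x|h hE] := ext0_projective (@res_projective _ _ F j)
      (f := (t : {linear Q -> E i.+3}) \o q); first exact: tZ.
  exists h; split=> // x; rewrite -[X in dE _ X]/(h (j' x)) -hE /=.
  by rewrite (ses_comp0 x jq) linear0.
have [h [fE hZ]] := conn f fZ; have [k [gE kZ]] := conn g gZ.
have [a [b [Lab [l lE]]]] := relQ' _ _ hZ kZ; exists a, b; split=> //.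
have [l' l'E] := inj_extend l inj_j.
pose hk : HomR (res_mod F j) (E i.+2) := a *: h + b *: k - postcomp (dE i.+1) l'.
have [x /ex[y <-]|u uE] := factor_quot (f := (hk : {linear _ -> _})) qs.
  rewrite -[LHS]/(a *: ev (d j y) h + b *: ev (d j y) k - dE i.+1 (l' (d j y))).
  rewrite -q'E l'E -lE; exact: subrr.
exists u => y; have [x <-] := qs y; rewrite uE.
rewrite -[LHS]/(a *: ev (q x) f + b *: ev (q x) g).
rewrite -[in RHS]/(a *: ev x h + b *: ev x k - dE i.+1 (l' x)) fE gE.
by rewrite linearB linearD !linearZ /= dd0 subr0.
Qed.

Lemma rel_iext_res i : rel_ext L i w -> rel_iext i M.
Proof.
case: i => [|i]; first exact: rel_iext0.
exact: (rel_iextS (@res_aug_surj _ _ F) (@res_exact0 _ _ F)).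
Qed.

End Balance.

End ProjectiveResolution.

(** * Minimal free resolutions *)

Section Cover.
Variables (R : comNzRingType) (m : idealr R).
Implicit Types U V W N K P M : lmodType R.
Hypotheses (noeR : noetherian R) (locR : local_ring m).

Record cover (K : lmodType R) := Cover {
  cv_rank : nat;
  cv_ker : lmodType R;
  cv_inc : {linear cv_ker -> 'rV[R]_cv_rank};
  cv_proj : {linear 'rV[R]_cv_rank -> K};
  cv_ses : ses cv_inc cv_proj;
  cv_min : forall u j, cv_inc u 0 j \in m
}.

(** Take the least number of generators: a relation with an invertible coefficient would make one of
    them redundant. *)
Lemma minimal_cover K : fin_gen K -> exists c : cover K, True.
Proof.
move=> /fin_genP gen.
have ex : exists n, `[< exists p : {linear 'rV[R]_n -> K}, surjective p >].
  by have [n gn] := gen; exists n; exact/asboolP.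
case: (ex_minnP ex) => n /asboolP[p ps] nmin.
have [U [i ip]] := ses_sub ps.
suff minU u j : i u 0 j \in m by exists (Cover ip minU).
apply: contrapT => /negP/(unit_notin noeR locR)[b bu].
case: n p ps nmin i ip j bu => [|n] p ps nmin i ip j bu; first by case: j bu.
suff : (n.+1 <= n)%N by rewrite ltnn.
apply: nmin; apply/asboolP.
pose g k := p (delta_mx 0 (lift j k)); exists (comb g) => y.
have hP := submodP_im (comb g).
have gk k : exists v, comb g v = g k by exists (delta_mx 0 k); exact: comb_delta.
have [v <-] := ps y; rewrite linear_comb; apply: (submodP_sum hP) => k.
have [l ->|->] := unliftP j k; first exact: gk.
rewrite -[p (delta_mx 0 j)]scale1r -bu -scalerA; apply: (submodPZ hP).
have : p (i u) = 0 by exact: ses_comp0.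
rewrite linear_comb /comb (bigD1_ord j) //= => /eqP; rewrite addr_eq0 => /eqP ->.
rewrite -scaleN1r; apply: (submodPZ hP).
exact: (submodP_sum hP).
Qed.

Lemma cover_fin_gen K (c : cover K) : fin_gen (cv_ker c).
Proof. by have [inj_i _ _] := cv_ses c; exact: (fin_gen_inj noeR inj_i (fin_gen_rV _ _)). Qed.

Definition cover_next (K : {K : lmodType R | fin_gen K}) :
    {K : lmodType R | fin_gen K} :=
  let c := sval (cid (minimal_cover (svalP K))) in
  exist _ (cv_ker c) (cover_fin_gen c).

Lemma minimal_resolution A : fin_gen A -> exists (K : nat -> lmodType R)
  (n : nat -> nat) (i : forall k, {linear K k.+1 -> 'rV[R]_(n k)})
  (p : forall k, {linear 'rV[R]_(n k) -> K k}),
  [/\ K 0%N = A, forall k, ses (i k) (p k), forall k, fin_gen (K k)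
    & forall k u j, i k u 0 j \in m].
Proof.
move=> fA; pose S k := iter k cover_next (exist _ A fA).
pose c k := sval (cid (minimal_cover (svalP (S k)))).
exists (fun k => sval (S k)), (fun k => cv_rank (c k)),
  (fun k => cv_inc (c k)), (fun k => cv_proj (c k)).
split=> // [k|k|k u j]; [exact: cv_ses|exact: svalP|exact: cv_min].
Qed.

Section Splice.
Variables (K : nat -> lmodType R) (n : nat -> nat)
  (i : forall k, {linear K k.+1 -> 'rV[R]_(n k)})
  (p : forall k, {linear 'rV[R]_(n k) -> K k}).
Hypothesis ip : forall k, ses (i k) (p k).

Definition splice_d k : {linear 'rV[R]_(n k.+1) -> 'rV[R]_(n k)} := i k \o p k.+1.

Lemma splice_surj : surjective (p 0).
Proof. by have [] := ip 0. Qed.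

Lemma splice_exact0 : exact (splice_d 0) (p 0).
Proof.
have [_ ex _] := ip 0; have [_ _ ps] := ip 1 => x; rewrite (ex x).
split=> [[u <-]|[v <-]]; last by exists (p 1 v).
by have [v <-] := ps u; exists v.
Qed.

Lemma splice_exactS k : exact (splice_d k.+1) (splice_d k).
Proof.
have [inj_i _ _] := ip k; have [_ ex _] := ip k.+1; have [_ _ ps] := ip k.+2.
move=> x; have -> : splice_d k x = 0 <-> p k.+1 x = 0.
  split=> [|px]; last by rewrite /= px linear0.
  by rewrite -(linear0 (i k)) => /inj_i.
rewrite (ex x); split=> [[u <-]|[v <-]]; last by exists (p k.+2 v).
by have [v <-] := ps u; exists v.
Qed.

Definition splice : resolution (K 0) :=
  @Resolution R (K 0) (fun k => 'rV[R]_(n k)) splice_d (p 0)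
    (fun k => fin_gen_rV R (n k)) (fun k => @projective_rV R (n k))
    splice_surj splice_exact0 splice_exactS.

End Splice.

Lemma resolution_exists (A : lmodType R) : fin_gen A -> exists F : resolution A, True.
Proof.
move=> /minimal_resolution[K [n [i [p [<- ip _ _]]]]].
by exists (splice ip).
Qed.

End Cover.

(** * The residue field and linear relations between classes *)

Section Residue.
Variables (R : comNzRingType) (m : idealr R).
Implicit Types U V W N K P M : lmodType R.
Hypotheses (noeR : noetherian R) (locR : local_ring m).

Definition not_both_in (a b : R) : Prop := a \notin m \/ b \notin m.

Lemma residue_simple : simple_by m (quotmodule_pi (ideal_pred m) 1).
Proof.
have piE a : a *: quotmodule_pi (ideal_pred m) (1 : R^o)
    = quotmodule_pi (ideal_pred m) (a : R^o).
  by rewrite -linearZ /GRing.scale /= mulr1.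
have pi0 (a : R^o) : quotmodule_pi (ideal_pred m) a = 0 <-> (a : R) \in m.
  by rewrite -(linear0 (quotmodule_pi (ideal_pred m))) -quotmodule_piP subr0.
split=> [v|/pi0|a am]; last by rewrite piE; exact/pi0.
  exists (repr (v : Quotient.quot (submod_pred (ideal_pred m)))).
  by rewrite piE quotmodule_reprK.
by rewrite idealr1.
Qed.

Lemma simple_rel V (u : V) (y z : V) : simple_by m u ->
  exists a b, not_both_in a b /\ a *: y + b *: z = 0.
Proof.
move=> [uV _ mu]; have [c ->] := uV y; have [c' ->] := uV z.
have [cm|cm] := boolP (c \in m).
  exists 1, 0; split; first by left; rewrite idealr1.
  by rewrite scale1r scale0r addr0 mu.
exists (- c'), c; split; first by right.
by rewrite !scalerA -scalerDl mulNr mulrC addNr scale0r.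
Qed.

Lemma rel_ext_Ext M (F : resolution M) w i :
  isomorphic (Ext F w i) (residue_module m) -> rel_ext F not_both_in i w.
Proof.
move=> [h /bij_inj inj_h] f g fZ gZ.
have cl (t : HomR (res_mod F i) w) : rcocyc t ->
    exists u : submodule (@cocycle _ _ F w i), val u = t.
  move=> tZ; have tb : t \in @cocycle _ _ F w i by exact/asboolP.
  by exists (exist _ t tb).
have [u uf] := cl f fZ; have [v vg] := cl g gZ.
have [a [b [ab E]]] := simple_rel (h (quotmodule_pi (@coboundary _ _ F w i) u))
  (h (quotmodule_pi (@coboundary _ _ F w i) v)) residue_simple.
exists a, b; split=> //.
move: E; rewrite -!linearZ -!linearD -(linear0 h) => /inj_h.
rewrite -(linear0 (quotmodule_pi (@coboundary _ _ F w i))) => /quotmodule_piP.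
by rewrite subr0 => /asboolP; rewrite -[val _]/(a *: val u + b *: val v) uf vg.
Qed.

Section Iext.
Variables (w : lmodType R) (E : injres w).

Lemma rel_iext_retract L i V W (f : {linear V -> W}) (g : {linear W -> V}) :
  (forall v, g (f v) = v) -> rel_iext E L i W -> rel_iext E L i V.
Proof.
move=> gf relW s t sZ tZ.
have [||a [b [Lab [h hE]]]] := relW (precomp g s) (precomp g t).
- by move=> y; exact: sZ.
- by move=> y; exact: tZ.
exists a, b; split=> //; exists (h \o f) => v.
by rewrite -[v in LHS]gf [LHS]hE.
Qed.

Lemma rel_iext_simple L i V W (u : V) (y : W) :
  simple_by m u -> simple_by m y -> rel_iext E L i W -> rel_iext E L i V.
Proof.
move=> su sy; have [f fu] := simple_map noeR locR su (let: And3 _ _ k := sy in k).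
have [g gy] := simple_map noeR locR sy (let: And3 _ _ k := su in k).
apply: (rel_iext_retract (f := f) (g := g)) => v.
by have [uV _ _] := su; have [a ->] := uV v; rewrite !linearZ /= fu gy.
Qed.

Lemma ext0_rel_iext i V :
  ext0 E i V <-> rel_iext E (fun a b => a = 1 /\ b = 0) i V.
Proof.
split=> [x0 f g fZ gZ|rel f fZ].
  exists 1, 0; split=> //; rewrite scale1r scale0r addr0; exact: x0.
have [a [b [[-> ->]]]] := rel f f fZ fZ.
by rewrite scale1r scale0r addr0.
Qed.

(** Vanishing of [Ext^(i+1)(W, w)] makes restriction to [U] onto on cocycles, not merely on
    classes. *)
Lemma cocyc_extend i U V W (j : {linear U -> V}) (p : {linear V -> W})
    (f : HomR U (E i.+1)) : ses j p -> ext0 E i.+1 W -> cocyc f ->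
  exists2 g : HomR V (E i.+1), cocyc g & forall u, ev (j u) g = ev u f.
Proof.
move=> jp xW fZ; have [inj_j ex ps] := jp.
have [f' f'E] := inj_extend (f : {linear U -> E i.+1}) inj_j.
have [v /ex[u <-]|h hE] := factor_quot (f := ir_d E i.+1 \o f') ps.
  by rewrite /= f'E fZ.
have [y|k kE] := xW h.
  by have [v <-] := ps y; rewrite hE /= dd0.
exists (f' \- (k \o p)) => [v|u]; first by rewrite /= linearB /= -kE hE subrr.
by rewrite -[LHS]/(f' (j u) - k (p (j u))) f'E (ses_comp0 u jp) linear0 subr0.
Qed.

End Iext.
End Residue.

(** * Endomorphisms, faithfulness and duality for the canonical module *)

Section Canonical.
Variables (R : comNzRingType) (m : idealr R) (w : lmodType R) (E : injres w).
Variables (dim : nat) (x : seq R).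
Implicit Types U V W N K P M A : lmodType R.
Hypotheses (noeR : noetherian R) (locR : local_ring m).
Hypotheses (kd : krull_dim R dim) (xm : {subset x <= m}) (xR : wreg x R^o)
  (xd : size x = dim).
Hypothesis Efin : exists n, forall i, (n < i)%N -> forall y : E i, y = 0.
Hypotheses (cmw : CM m w) (tyw : type_one m w).
Local Notation d := (ir_d E).
Local Notation rel1 := (not_both_in m).

Lemma can_fin_gen : fin_gen w. Proof. by case: cmw. Qed.
Local Notation fw := can_fin_gen.

Lemma can_ext0_gt V : fin_gen V -> forall i, (dim < i)%N -> ext0 E i V.
Proof. exact: (ext0_gt_dim noeR locR fw kd xm xR xd Efin). Qed.

Lemma can_ext0_CM V : CM m V -> forall i, (0 < i)%N -> ext0 E i V.
Proof. by move=> cV; apply: (ext0_CM noeR locR fw kd cV); exact: can_ext0_gt. Qed.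

Lemma can_neq0 : exists v : w, v <> 0.
Proof.
have [t [[[s [_ [_ [u nu]] _]] _] _]] := tyw.
by exists u => u0; apply: nu; rewrite u0; exact: (submodP_seq_mul s w).1.
Qed.

Lemma can_not_mspan : ~ forall v : w, mspan m v.
Proof.
by move=> /(nakayama noeR locR fw) w0; have [v] := can_neq0; rewrite (w0 v).
Qed.

(** The degree [t] in [type_one] is the depth of [w], which equals [dim]. *)
Lemma can_rel_ext (F : resolution (residue_module m)) : rel_ext F rel1 dim w.
Proof.
have [t [[[s [sm [sw sne] st]] tmax] /(_ F)]] := tyw.
suff -> : t = dim by exact: rel_ext_Ext.
apply/eqP; rewrite eqn_leq -{1}st (wreg_size_le noeR locR kd sm sw sne) /=.
have [y [ym yw <-]] := CM_wreg kd cmw; apply: tmax => //; split=> //.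
apply: contrapT => h; apply: can_not_mspan => v; apply: (seq_mul_mspan ym).
by apply: contrapT => nv; apply: h; exists v.
Qed.

Lemma residue_fin_gen : fin_gen (residue_module m).
Proof.
exists 1%N, (fun=> quotmodule_pi (ideal_pred m) 1) => v.
have [uV _ _] := residue_simple m.
by have [a ->] := uV v; exists (fun=> a); rewrite big_ord1.
Qed.

Lemma can_regquot_res (F : resolution (residue_module m)) y W :
  {subset y <= m} -> regquot y w W ->
  (forall i, (i < size y)%N -> res_ext0 F i w) /\
  forall L, rel_ext F L (size y) w -> rel_ext F L 0 W.
Proof.
move=> ym yW; apply: (res_ext0_regquot F yW) => a /ym am v.
have [uV _ mu] := residue_simple m; have [b ->] := uV v.
by rewrite scalerA mulrC -scalerA mu // scaler0.
Qed.

Lemma can_ext0_simple V (u : V) i : simple_by m u -> (i < dim)%N -> ext0 E i V.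
Proof.
move=> su idim; have [F _] := resolution_exists noeR locR residue_fin_gen.
have [y [ym yw yd]] := CM_wreg kd cmw; have [W yW] := wreg_regquot yw.
have [x0 _] := can_regquot_res F ym yW.
apply/ext0_rel_iext.
apply: (rel_iext_simple noeR locR su (residue_simple m)).
have relF : rel_ext F (fun a b => a = 1 /\ b = 0) i w.
  move=> f g fZ gZ; exists 1, 0; split=> //.
  by rewrite scale1r scale0r addr0; apply: x0; rewrite ?yd.
exact: (rel_iext_res (E := E) relF).
Qed.

Lemma can_rel_simple V (u : V) : simple_by m u -> rel_iext E rel1 dim V.
Proof.
move=> su; have [F _] := resolution_exists noeR locR residue_fin_gen.
apply: (rel_iext_simple noeR locR su (residue_simple m)).
exact: (rel_iext_res (E := E) (@can_rel_ext F)).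
Qed.

(** By Rees' theorem the socle [Hom(R/m, W)] of [W = w / y w] embeds into [Ext^dim(R/m, w)], of
    dimension at most one. *)
Lemma can_socle y W (s1 s2 : W) : {subset y <= m} -> size y = dim ->
  regquot y w W -> (forall a, a \in m -> a *: s1 = 0) ->
  (forall a, a \in m -> a *: s2 = 0) ->
  exists a b, rel1 a b /\ a *: s1 + b *: s2 = 0.
Proof.
move=> ym yd yW ms1 ms2.
have [F _] := resolution_exists noeR locR residue_fin_gen.
have [_ /(_ rel1)] := can_regquot_res F ym yW; rewrite yd => /(_ (@can_rel_ext F)) rel0.
have [f1 f1E] := simple_map noeR locR (residue_simple m) ms1.
have [f2 f2E] := simple_map noeR locR (residue_simple m) ms2.
have augZ (h : {linear residue_module m -> W}) :
    rcocyc (h \o res_aug F : HomR (res_mod F 0) W).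
  move=> z; rewrite -[LHS]/(h (res_aug F (res_d F 0 z))).
  by rewrite (iffRL (@res_exact0 _ _ F _)) ?linear0 //; exists z.
have [a [b [ab E0]]] := rel0 _ _ (augZ f1) (augZ f2); exists a, b; split=> //.
have [z zE] := @res_aug_surj _ _ F (quotmodule_pi (ideal_pred m) 1).
have := congr1 (ev z) E0.
by rewrite -[LHS]/(a *: f1 (res_aug F z) + b *: f2 (res_aug F z)) zE f1E f2E.
Qed.

Definition mcocyc i V (h : HomR V (E i.+1)) : Prop :=
  exists n (c : 'rV[R]_n) (g : 'I_n -> HomR V (E i.+1)),
    [/\ forall k, c 0 k \in m, forall k, cocyc (g k) & h = comb g c].

(* [Ext^i(V, w) / m Ext^i(V, w)] has dimension at most one over [R / m]. *)
Definition rel_top i V : Prop := forall f g : HomR V (E i.+1), cocyc f -> cocyc g ->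
  exists a b h, [/\ rel1 a b, mcocyc h & cobound (a *: f + b *: g - h)].

(** The socle [S] of [W] has dimension at most one, so a relation holds on [S]. What is left comes
    from [T = W / S], which embeds into [W^n] through multiplication by [n] generators of [m]; by
    right exactness of [Ext^dim(-, w)] it extends to [W^n] and becomes a combination with
    coefficients in [m]. *)
Lemma can_rel_top y W : {subset y <= m} -> size y = dim ->
  regquot y w W -> rel_top dim W.
Proof.
move=> ym yd yW f g fZ gZ.
have fW : fin_gen W.
  by have [q [qs _]] := regquot_map yW; exact: fin_gen_surj qs fw.
have hS : submodP (fun v : W => forall a, a \in m -> a *: v = 0).
  split=> [a _|b u v mu mv a am]; first by rewrite scaler0.
  by rewrite scalerDr scalerA mulrC -scalerA mu // mv // scaler0 addr0.
have [S [j [inj_j jP]]] := submod_sub hS.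
have relS : rel_iext E rel1 dim S.
  have [S0|/existsNP[s0 s0n]] := pselect (forall s : S, s = 0).
    move=> f' g' f'Z _; exists 1, 0; split; first by left; rewrite idealr1.
    by rewrite scale1r scale0r addr0; exact: (ext0_zero S0).
  apply: (can_rel_simple (u := s0)); split=> // [s|a am].
    have [||a [b [ab E0]]] := can_socle (s1 := j s) (s2 := j s0) ym yd yW.
    - by apply/jP; exists s.
    - by apply/jP; exists s0.
    have {}E0 : a *: s + b *: s0 = 0.
      by apply: inj_j; rewrite linearD !linearZ linear0.
    have [am|am] := boolP (a \in m).
      have bm : b \notin m by case: ab => //; rewrite am.
      have as0 : a *: s = 0.
        apply: inj_j; rewrite linear0 linearZ /=.
        by have /jP : exists s', j s' = j s by [exists s]; exact.
      move: E0; rewrite as0 add0r => bs0; have [c cb] := unit_notin noeR locR bm.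
      by case: s0n; rewrite -[s0]scale1r -cb -scalerA bs0 scaler0.
    have [c ca] := unit_notin noeR locR am; exists (- (c * b)).
    rewrite -[s]scale1r -ca -scalerA; move/eqP: E0; rewrite addr_eq0 => /eqP ->.
    by rewrite scalerN scalerA scaleNr.
  apply: inj_j; rewrite linear0 linearZ /=.
  by have /jP : exists s', j s' = j s0 by [exists s0]; exact.
have [T [q jq]] := ses_quot inj_j; have [_ ex qs] := jq.
have [||a [b [ab [k kE]]]] := relS (precomp j f) (precomp j g).
- by move=> s; exact: fZ.
- by move=> s; exact: gZ.
have [k' k'E] := inj_extend k inj_j.
(* The combination of [f] and [g], corrected by a coboundary so as to vanish on [S]. *)
pose t : HomR W (E dim.+1) := a *: f + b *: g - postcomp (d dim) k'.
have [v /ex[s <-]|t' t'E] := factor_quot (f := (t : {linear _ -> _})) qs.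
  rewrite -[LHS]/(a *: ev (j s) f + b *: ev (j s) g - d dim (k' (j s))).
  rewrite k'E -kE; exact: subrr.
have tZ : cocyc t.
  apply: (submodPB (submodP_cocyc _ _ _)); first last.
    by move=> v; exact: dd0.
  apply: (submodPD (submodP_cocyc _ _ _)); exact: (submodPZ (submodP_cocyc _ _ _)).
have t'Z : cocyc (t' : HomR T (E dim.+1)).
  by move=> y'; have [v <-] := qs y'; rewrite t'E.
have [n [pm pmP]] := ideal_fg noeR (submodP_idealr m).
pose H : lmodType R := HomR 'rV[R]_n W.
(* [mu v] collects the products of [v] with the [n] generators of [m]; its kernel is the socle. *)
have [mu muE] : exists mu : {linear W -> H}, forall v u, ev u (mu v) = pm u *: v.
  have /choice[mu0 mu0E] (v : W) : exists h : H, forall u, ev u h = (pm u : R) *: v.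
    have [u|c u u' _ _ -> ->|_ ->|h hE] :=
      linear_graph (U := 'rV[R]_n) (r := fun u z => z = (pm u : R) *: v).
    - by eexists.
    - by rewrite linearP scalerDl scalerA.
    - by rewrite linear0 scale0r.
    by exists h => u; apply/hE.
  have [v|c v v' _ _ -> ->|_ ->|mu muE] := linear_graph (r := fun v h => h = mu0 v).
  - by eexists.
  - apply: HomP => u; rewrite -[RHS]/(ev u _) mu0E.
    rewrite -[LHS]/(c *: ev u (mu0 v) + ev u (mu0 v')) !mu0E.
    by rewrite scalerDr !scalerA mulrC.
  - by apply: HomP => u; rewrite -[LHS]/(ev u _) mu0E scaler0.
  by exists mu => v u; have -> := (muE v _).1 erefl; rewrite mu0E.
have muS v : mu v = 0 <-> q v = 0.
  rewrite (ex v) -jP; split=> [muv c /pmP[u <-]|mv].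
    by rewrite -muE muv.
  apply: HomP => u; rewrite -[LHS]/(ev u _) muE; apply: mv.
  by apply/pmP; exists u.
have [v /muS//|kap kapE] := factor_quot (f := mu) qs.
have inj_kap : injective kap.
  move=> y1 y2; have [v1 <-] := qs y1; have [v2 <-] := qs y2.
  rewrite !kapE => /eqP; rewrite -subr_eq0 -linearB => /eqP/muS.
  by rewrite linearB => /eqP; rewrite subr_eq0 => /eqP.
have [C [r kr]] := ses_quot inj_kap; have [_ _ rs] := kr.
have fH : fin_gen H by exact: (fin_gen_Hom noeR (fin_gen_rV _ n) fW).
have [|tau tauZ tauE] := cocyc_extend kr _ t'Z.
  by apply: can_ext0_gt => //; exact: fin_gen_surj rs fH.
exists a, b, t; split=> //.
  exists n, (\row_l pm (delta_mx 0 l)), (fun l => precomp (@coordmap R n W l) tau); split.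
  - by move=> l; rewrite mxE; apply/pmP; exists (delta_mx 0 l).
  - by move=> l v; exact: tauZ.
  apply: HomP => v; rewrite -[RHS]/(ev v _) comb_ev -[LHS]t'E.
  rewrite -[LHS]/(ev (q v) t') -tauE kapE.
  have -> : mu v = \sum_l (pm (delta_mx 0 l) : R) *: coordmap l v.
    apply: HomP => u; rewrite -[LHS]/(ev u _) -[RHS]/(ev u _) muE linear_sum.
    rewrite linear_comb scaler_suml; apply: eq_bigr => l _.
    rewrite -[RHS]/((pm (delta_mx 0 l) : R) *: ev u (coordmap l v)) coordmapE [in RHS]scalerA.
    by rewrite [in RHS]mulrC.
  rewrite [LHS](linear_sum (tau : {linear H -> E dim.+1})); apply: eq_bigr => l _.
  by rewrite linearZ mxE.
by exists k' => v; rewrite /t opprB addrC subrK.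
Qed.

(** [Ext^(i+1)(V1, w)] is [Ext^i(V, w)] modulo [a], and [a] lies in [m], so both have the same
    quotient modulo [m]. *)
Lemma rel_top_regquot i s V W : regquot s V W -> {subset s <= m} ->
  (forall k, (i < k)%N -> ext0 E k V) -> rel_top (i + size s) W -> rel_top i V.
Proof.
move=> sV; elim: sV i => {s V W} [V|a s V V1 W j p jE jp _ IH] i sm xV relW.
  by rewrite addn0 in relW.
have am : a \in m by apply: sm; rewrite inE eqxx.
have relV1 : rel_top i.+1 V1.
  apply: IH => [b bs|[//|k] ik|]; last by rewrite addSnnS.
    by apply: sm; rewrite inE bs orbT.
  by apply: (ext0_quot jp); apply: xV => //; exact: ltnW.
have [inj_j ex ps] := jp.
(* The connecting map: [t] is divided by [a] into [t'], whose differential descends to [V1]. *)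
have conn (t : HomR V (E i.+1)) : cocyc t -> exists (t' : HomR V (E i.+1))
    (u : HomR V1 (E i.+2)), [/\ t = a *: t', cocyc u
      & forall v, d i.+1 (ev v t') = ev (p v) u].
  move=> tZ; have [t' t'E] := inj_extend (t : {linear _ -> _}) inj_j.
  have [v /ex[v' <-]|u uE] := factor_quot (f := d i.+1 \o t') ps.
    by rewrite /= t'E tZ.
  exists t', u; split=> [|y|v]; last by rewrite [RHS]uE.
    by apply: HomP => v; rewrite -[LHS]t'E jE linearZ.
  by have [v <-] := ps y; rewrite uE /= dd0.
move=> f g /conn[f' [f1 [-> f1Z f'E]]] /conn[g' [g1 [-> g1Z g'E]]].
have [b [c [h [bc [n [e [h1 [em h1Z hE]]]] [l lE]]]]] := relV1 _ _ f1Z g1Z.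
have /choice[k kE] (r : 'I_n) : exists k : HomR V (E i.+1),
    forall v, ev (p v) (h1 r) = d i.+1 (ev v k).
  have [v|k kE] := xV i.+1 (ltnSn i) (precomp p (h1 r)); first exact: h1Z.
  by exists k => v; exact: kE.
(* The relation on [V1], lifted to [V] and corrected by [k] and [l], is a cocycle; multiplied by [a]
   it yields the relation between [f] and [g]. *)
pose z : HomR V (E i.+1) := b *: f' + c *: g' - comb k e - precomp p (l : HomR V1 (E i.+1)).
have zZ : cocyc z.
  move=> v; rewrite -[X in d _ X]/(b *: ev v f' + c *: ev v g' - ev v (comb k e) - l (p v)).
  rewrite 2!linearB linearD !linearZ /= f'E g'E comb_ev [X in _ - X - _]linear_sum.
  have -> : \sum_r d i.+1 (e 0 r *: ev v (k r)) = ev (p v) h.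
    rewrite hE comb_ev; apply: eq_bigr => r _.
    by rewrite linearZ /= -kE.
  by rewrite -lE; exact: subrr.
have ak r : cocyc (a *: k r).
  move=> v; rewrite -[X in d _ X]/(a *: ev v (k r)).
  have <- : ev (j v) (k r) = a *: ev v (k r).
    by rewrite jE /ev linearZ.
  rewrite -kE (ses_comp0 v jp); exact: (linear0 (h1 r : {linear V1 -> _})).
exists b, c, (comb (fun r => a *: k r) e + a *: z); split=> //.
  exists (n + 1)%N, (row_mx e (const_mx a)),
    (fun r => match split r with inl r => a *: k r | inr _ => z end); split.
  - by move=> r; rewrite -(splitK r); case: (split r) => q /=;
      rewrite ?row_mxEl ?row_mxEr ?mxE.
  - by move=> r; case: (split r).
  rewrite /comb big_split_ord big_ord1 /= row_mxEr (unsplitK (inr _)) mxE.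
  by congr (_ + _); apply: eq_bigr => r _; rewrite (unsplitK (inl _)) row_mxEl.
suff -> : b *: (a *: f') + c *: (a *: g') - (comb (fun r => a *: k r) e + a *: z) = 0.
  exact: (submodP_cobound _ _ _).1.
have -> : comb (fun r => a *: k r) e = a *: comb k e.
  rewrite /comb scaler_sumr; apply: eq_bigr => r _.
  by rewrite !scalerA mulrC.
have lp0 : a *: precomp p (l : HomR V1 (E i.+1)) = 0.
  apply: HomP => v; rewrite -[LHS]/(a *: l (p v)) -!linearZ -jE.
  by rewrite (ses_comp0 v jp) linear0.
rewrite /z !scalerBr scalerDr lp0 subr0 !scalerA ![_ * a]mulrC.
by rewrite addrCA subrr addr0 subrr.
Qed.

(** [Hom(w, w)] modulo [m] has dimension at most one, and the identity is nonzero there because [w]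
    differs from [m w]; by Nakayama's lemma the identity generates. *)
Lemma can_Hom_scalar (f : HomR w w) : exists r : R, forall v : w, ev v f = r *: v.
Proof.
have [y [ym yw yd]] := CM_wreg kd cmw; have [W yW] := wreg_regquot yw.
have top : rel_top 0 w.
  apply: (rel_top_regquot yW ym); first exact: (can_ext0_CM).
  rewrite add0n yd.
  exact: (can_rel_top ym yd yW).
have fww : fin_gen (HomR w w) by apply: (fin_gen_Hom noeR); case: cmw.
have eZ (g : HomR w w) : cocyc (postcomp (ir_e E) g).
  by move=> v; apply/(@ir_exact0 _ _ E); eexists.
have rel (g h : HomR w w) : exists a b, rel1 a b /\ mspan m (a *: g + b *: h).
  have [a [b [t [ab [n [c [k [cm kZ tE]]]] /cobound0 E0]]]] := top _ _ (eZ g) (eZ h).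
  exists a, b; split=> //.
  have /choice[k' k'E] r := ext0_Hom (kZ r).
  exists n, c, k'; split=> //; apply: HomP => v; apply: (@ir_einj _ _ E).
  move/eqP: E0; rewrite subr_eq0 tE => /eqP/(congr1 (ev v)).
  rewrite comb_ev -[LHS]/(a *: ir_e E (ev v g) + b *: ir_e E (ev v h)).
  rewrite -!linearZ -linearD => ->; rewrite -[in RHS]/(ev v _) comb_ev linear_sum.
  by apply: eq_bigr => r _; rewrite linearZ; congr (_ *: _); exact: k'E.
have [n [p ps]] := (fin_genP _).1 fww.
have hP : submodP (fun g : HomR w w => exists r : R, g = r *: (idfun : HomR w w)).
  split=> [|a _ _ [r ->] [s ->]]; first by exists 0; rewrite scale0r.
  by exists (a * r + s); rewrite scalerDl scalerA.
have [r ->] : exists r : R, f = r *: (idfun : HomR w w); last by exists r.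
move: f; apply: (nakayama_mod noeR locR (m := m) (p := p) hP) => g.
  by have [u <-] := ps g; exists u; rewrite subrr; exact: hP.1.
have [a [b [ab gm]]] := rel g (idfun : HomR w w).
have [am|am] := boolP (a \in m).
  have bm : b \notin m by case: ab => //; rewrite am.
  have [c cb] := unit_notin noeR locR bm; case: (can_not_mspan) => v.
  have : mspan m (b *: (idfun : HomR w w)).
    rewrite -[_ *: _](addKr (a *: g)) addrC.
    by apply: (submodPB (submodP_mspan _ _) gm); exact: mspanZ.
  move/(submodPZ (submodP_mspan _ _) c); rewrite scalerA cb scale1r.
  by move/(mspan_linear (ev v)).
have [c ca] := unit_notin noeR locR am.
exists (c *: (a *: g + b *: (idfun : HomR w w))).
  exact: (submodPZ (submodP_mspan _ _)).
exists (- (c * b)); rewrite scalerDr !scalerA ca scale1r opprD addrA subrr add0r.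
by rewrite scaleNr.
Qed.

Lemma ext0_regquot_low i s V W : regquot s V W -> {subset s <= m} -> fin_gen V ->
  ext0 E (i + size s) W -> ext0 E i V.
Proof.
move=> sV; elim: sV i => {s V W} [V|a s V V1 W j p jE jp _ IH] i sm fV xW.
  by rewrite addn0 in xW.
have [_ _ ps] := jp.
apply: (ext0_nakayama noeR locR fw _ jE jp fV); first by apply: sm; rewrite inE eqxx.
apply: IH; last by rewrite addSnnS.
  by move=> b bs; apply: sm; rewrite inE bs orbT.
exact: fin_gen_surj ps fV.
Qed.

(** Devissage leads to prime cyclic modules; their annihilator contains [x], hence is [m], and Ext
    of the residue field vanishes below [dim]. *)
Lemma can_ext0_lt V : fin_gen V ->
  (forall a : R^o, seq_mul x a -> forall v : V, (a : R) *: v = 0) ->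
  forall i, (i < dim)%N -> ext0 E i V.
Proof.
move=> fV; pose Phi V := (forall a : R^o, seq_mul x a -> forall v : V, (a : R) *: v = 0) ->
  forall i, (i < dim)%N -> ext0 E i V.
apply: (devissage noeR (Phi := Phi) _ _ _ fV) => {V fV}.
- by move=> V V0 _ i _; exact: ext0_zero.
- move=> U V W j p jp xU xW xV i idim; have [inj_j ex ps] := jp.
  apply: (ext0_mid jp); [apply: xU|apply: xW] => // a xa v.
    by apply: inj_j; rewrite linear0 linearZ /= xV.
  by have [u <-] := ps v; rewrite -linearZ xV // linear0.
move=> V u uV u0 pr _ xV i idim.
apply: (can_ext0_simple (u := u)) => //; split=> // a am.
have [|q qP] := prime_idealr_of (submodP_ann u) _ pr; first by rewrite scale1r.
by apply/qP; apply: (prime_over_wreg noeR locR kd xR xd) am => r xr; apply/qP/xV.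
Qed.

(** Otherwise Ext of the residue field vanishes from degree [dim] on, hence so does that of [R / x],
    and Nakayama's lemma along [x] gives [Hom(R, w) = 0]. *)
Lemma can_ext0_top V (u : V) : simple_by m u -> ~ ext0 E dim V.
Proof.
move=> su xV; have [W xW] := wreg_regquot xR.
have [p [ps pP]] := regquot_map xW.
have x0 : ext0 E 0 R^o.
  apply: (ext0_regquot_low xW xm (fin_gen_reg R)); rewrite add0n xd.
  apply: (ext0_of_simple noeR locR fw (t := dim)) => //; last first.
    exact: fin_gen_surj ps (fin_gen_reg R).
  move=> V' u' su' i; rewrite leq_eqVlt => /orP[/eqP<-|il].
    apply/ext0_rel_iext; apply: (rel_iext_simple noeR locR su' su).
    exact/ext0_rel_iext.
  apply: (can_ext0_gt) => //.
  by exists 1%N, (fun=> u') => v; have [u'V _ _] := su'; have [a ->] := u'V v;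
    exists (fun=> a); rewrite big_ord1.
have [v v0] := can_neq0; apply: v0.
have [g gE] : exists g : {linear R^o -> E 1}, forall r, g r = (r : R) *: ir_e E v.
  have [r|a r r' _ _ -> ->|_ ->|g gE] := linear_graph (U := R^o)
    (r := fun r z => z = (r : R) *: ir_e E v).
  - by eexists.
  - by rewrite scalerDl scalerA.
  - by rewrite scale0r.
  by exists g => r; apply/gE.
have /x0/cobound0 g0 : cocyc (g : HomR R^o (E 1)).
  by move=> r; rewrite gE linearZ /= (iffRL (@ir_exact0 _ _ E _)) ?scaler0 //; exists v.
apply: (@ir_einj _ _ E); rewrite linear0 -[LHS]scale1r -gE.
exact: (congr1 (ev (1 : R^o)) g0).
Qed.

(** The data [Z], [z], [cl] present [H] as [Ext^c(N, w)]. The first element [a] is injective on [H]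
    since [Ext^c(N1, w) = 0], and the connecting map identifies [H / a H] with
    [Ext^(c+1)(N1, w)]. *)
Lemma wreg_ext c s N W : regquot s N W -> {subset s <= m} -> fin_gen N ->
  (forall i, (i < c + size s)%N -> ext0 E i W) ->
  (forall i, (c < i)%N -> ext0 E i N) ->
  forall (H Z : lmodType R) (z : {linear Z -> HomR N (E c.+1)}) (cl : {linear Z -> H}),
    is_sub (@cocyc _ _ E c N) z -> surjective cl ->
    (forall u, cl u = 0 <-> cobound (z u)) -> wreg s H.
Proof.
move=> sN; elim: sN c => {s N W} [N|a s N N1 W j p jE jp sN1 IH] c sm fN xW xN //.
move=> H Z z cl [inj_z zP] cls clP.
have [inj_j ex ps] := jp.
have fN1 : fin_gen N1 by exact: fin_gen_surj ps fN.
have sm' : {subset s <= m} by move=> b bs; apply: sm; rewrite inE bs orbT.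
have xW' i : (i < c.+1 + size s)%N -> ext0 E i W by rewrite addSnnS; exact: xW.
have xN1 i : (c.+1 < i)%N -> ext0 E i N1.
  by case: i => [//|i] ci; apply: (ext0_quot jp); apply: xN => //; exact: ltnW.
have xcN1 : ext0 E c N1.
  by apply: (ext0_regquot_low sN1 sm' fN1); apply: xW'; rewrite addSn.
have [Z1 [z1 [inj_z1 z1P]]] := submod_sub (submodP_cocyc E c.+1 N1).
have hB : submodP (fun u => cobound (z1 u)).
  split=> [|b u v uB vB]; first by rewrite linear0; exact: (submodP_cobound _ _ _).1.
  by rewrite linearP; exact: (submodP_cobound _ _ _).2.
have [H1 [cl1 [cl1s cl1P]]] := submod_quot hB.
have sH1 : wreg s H1.
  by apply: (IH c.+1 sm' fN1 xW' xN1 H1 Z1 z1 cl1) => // u; exact: iff_sym.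
(* The graph of the connecting map from [Ext^c(N, w)] to [Ext^(c+1)(N1, w)]. *)
pose r h h' := exists (u : Z) (g : HomR N (E c.+1)) (u' : Z1),
  [/\ cl u = h, z u = a *: g, forall v, d c.+1 (ev v g) = ev (p v) (z1 u')
    & cl1 u' = h'].
have a0 (g : {linear N -> E c.+1}) : (forall v, a *: g v = 0) ->
    exists l : {linear N1 -> E c.+1}, forall v, l (p v) = g v.
  move=> ag; apply: factor_quot => // v /ex[v' <-].
  by rewrite jE linearZ /= ag.
have jext (i : nat) (g : {linear N -> E i}) : exists h : {linear N -> E i},
    forall v, a *: h v = g v.
  have [h hE] := inj_extend g inj_j; exists h => v.
  by rewrite -linearZ -jE hE.
have [h|b h h' k k' [u [g [u' [uh ug gu uk]]]] [v [g' [v' [vh vg gv vk]]]]|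
      h' [u [g [u' [/clP[k kE] ug gu uh]]]]|pi piP] := linear_graph (r := r).
- have [u uh] := cls h; have [g gE] := jext _ (z u : {linear _ -> _}).
  have zuZ : cocyc (z u) by apply/zP; exists u.
  have [v /ex[v' <-]|f fE] := factor_quot (f := d c.+1 \o g) ps.
    by rewrite /= jE linearZ /= gE zuZ.
  have [|u' u'E] := (z1P (f : HomR _ _)).1.
    by move=> y; have [v <-] := ps y; rewrite fE /= dd0.
  exists (cl1 u'), u, g, u'; split=> //; last by move=> v; rewrite u'E [RHS]fE.
  by apply: HomP => v; rewrite -[LHS]gE.
- exists (b *: u + v), (b *: g + g'), (b *: u' + v'); split.
  + by rewrite linearP uh vh.
  + by rewrite linearP ug vg scalerDr !scalerA mulrC.
  + move=> y; rewrite -[X in d _ X]/(b *: ev y g + ev y g') linearP gu gv.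
    by rewrite [z1 (_ + _)]linearP.
  + by rewrite linearP uk vk.
- have [k' k'E] := jext _ k.
  have [v|l lE] := a0 ((g : {linear _ -> _}) \- (d c \o k')).
    rewrite /= scalerBr.
    have -> : a *: d c (k' v) = d c (k v) by rewrite -linearZ k'E.
    by rewrite -kE ug; exact: subrr.
  rewrite -uh; apply/cl1P; exists l => y; have [v <-] := ps y.
  by rewrite lE /= linearB /= dd0 subr0; apply/esym/gu.
have pis : surjective pi.
  move=> h'; have [u' <-] := cl1s h'.
  have u'Z : cocyc (z1 u') by apply/z1P; exists u'.
  have [v|g gE] := xN c.+1 (ltnSn c) (precomp p (z1 u')); first exact: u'Z.
  have [|u uE] := (zP (a *: (g : HomR _ _))).1.
    move=> v; rewrite -[X in d _ X]/(a *: g v) -linearZ -jE -gE.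
    rewrite /= (ses_comp0 v jp); exact: (linear0 (z1 u' : {linear _ -> _})).
  exists (cl u); apply/piP; exists u, g, u'; split=> // v.
  exact/esym/gE.
apply/(wreg_cons s pis (a := a)); last split=> //.
  move=> h; rewrite -(piP h 0); split=> [[u [g [u' [<- ug gu /cl1P[l lE]]]]]|[h0 <-]].
    have [|u0 u0E] := (zP (g - precomp p (l : HomR _ _))).1.
      move=> v; rewrite -[X in d _ X]/(ev v g - l (p v)) linearB gu -lE.
      exact: subrr.
    exists (cl u0); rewrite -linearZ; congr (cl _); apply: inj_z.
    rewrite linearZ /= u0E ug scalerBr; apply/eqP; rewrite subr_eq addrC -subr_eq subrr eq_sym.
    apply/eqP/HomP => v; rewrite -[LHS]/(a *: l (p v)) -!linearZ -jE.
    by rewrite (ses_comp0 v jp) linear0.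
  have [u0 <-] := cls h0; exists (a *: u0), (z u0), 0; split=> //.
  - by rewrite linearZ.
  - by rewrite linearZ.
  - have zu0 : cocyc (z u0) by apply/zP; exists u0.
    by move=> v; rewrite [LHS]zu0 linear0.
  - exact: linear0.
move=> h ah; have [u uh] := cls h; rewrite -uh in ah *.
move: ah; rewrite -linearZ => /clP[g gE]; apply/clP.
have [g' g'E] := jext _ g.
have [v|l lE] := a0 ((z u : {linear _ -> _}) \- (d c \o g')).
  rewrite /= scalerBr.
  have -> : a *: d c (g' v) = d c (g v) by rewrite -linearZ g'E.
  by rewrite -gE linearZ; exact: subrr.
have [y|k kE] := xcN1 l.
  have zuZ : cocyc (z u) by apply/zP; exists u.
  by have [v <-] := ps y; rewrite lE /= linearB /= dd0 subr0 zuZ.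
exists (g' \+ (k \o p)) => v.
by rewrite /= linearD /= -kE lE /= addrC subrK.
Qed.

(** The case [N = R], [c = 0] of [wreg_ext], where [Ext^0(R, w) = w]; Ext of [R / x] vanishes below
    [dim] because [x] kills this module. *)
Lemma can_wreg : wreg x w.
Proof.
have [W xW] := wreg_regquot xR; have [p [ps pP]] := regquot_map xW.
have fW : fin_gen W by exact: fin_gen_surj ps (fin_gen_reg R).
have /choice[z0 z0E] (v : w) : exists h : HomR R^o (E 1),
    forall r : R^o, ev r h = (r : R) *: ir_e E v.
  have [r|a r r' _ _ -> ->|_ ->|g gE] := linear_graph (U := R^o)
    (r := fun r z => z = (r : R) *: ir_e E v).
  - by eexists.
  - by rewrite scalerDl scalerA.
  - by rewrite scale0r.
  by exists g => r; apply/gE.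
have [z zE] : exists z : {linear w -> HomR R^o (E 1)},
    forall v (r : R^o), ev r (z v) = (r : R) *: ir_e E v.
  have [v|c v v' _ _ -> ->|_ ->|z zE] := linear_graph (r := fun v h => h = z0 v).
  - by eexists.
  - apply: HomP => r; rewrite -[RHS]/(ev r _) z0E.
    rewrite -[LHS]/(c *: ev r (z0 v) + ev r (z0 v')) !z0E.
    by rewrite linearP scalerDr !scalerA mulrC.
  - by apply: HomP => r; rewrite -[LHS]/(ev r _) z0E linear0 scaler0.
  by exists z => v r; have -> := (zE v _).1 erefl; rewrite z0E.
have zI : injective z.
  move=> u v /(congr1 (ev (1 : R^o))); rewrite !zE !scale1r; exact: (@ir_einj _ _ E).
apply: (wreg_ext (c := 0) xW xm (fin_gen_reg R) _ _ (z := z) (cl := idfun)).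
- move=> i; rewrite xd; apply: can_ext0_lt _ fW _ i => a xa v.
  have [r <-] := ps v; rewrite -linearZ; apply/pP.
  by rewrite /GRing.scale /= mulrC; apply: (submodPZ (submodP_seq_mul x R^o)).
- by move=> [//|i] _; apply: ext0_projective; exact: projective_reg.
- split=> // f; split=> [fZ|[v <-] r].
    have [v vE] := (@ir_exact0 _ _ E _).1 (fZ 1); exists v; apply: HomP => r.
    rewrite -[LHS]/(ev r _) zE vE -linearZ /GRing.scale /= mulr1 //.
  rewrite -[X in ir_d _ _ X]/(ev r (z v)) zE linearZ /=.
  by rewrite (iffRL (@ir_exact0 _ _ E _)) ?scaler0 //; exists v.
- by move=> v; exists v.
move=> v; rewrite cobound0 /=; split=> [->|]; first exact: linear0.
by rewrite -(linear0 z) => /zI.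
Qed.

(** Each quotient step makes [Ext^(c+1)(N1, w)] a quotient of [Ext^c(N, w)]. *)
Lemma ext_kill c s N W b : regquot s N W -> (forall i, (c < i)%N -> ext0 E i N) ->
  (forall f : HomR N (E c.+1), cocyc f -> cobound (b *: f)) ->
  forall f : HomR W (E (c + size s).+1), cocyc f -> cobound (b *: f).
Proof.
move=> sN; elim: sN c => {s N W} [N|a s N N1 W j p jE jp _ IH] c xN kill.
  by rewrite addn0.
rewrite addnS -addSn; apply: IH => [[//|i] ci|f fZ].
  by apply: (ext0_quot jp); apply: xN => //; exact: ltnW.
have [inj_j ex ps] := jp.
have [v|g gE] := xN c.+1 (ltnSn c) (precomp p f); first exact: fZ.
have [|h hE] := kill (a *: (g : HomR _ _)).
  move=> v; rewrite -[X in d _ X]/(a *: g v) -linearZ -jE -gE.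
  rewrite /= (ses_comp0 v jp); exact: (linear0 (f : {linear _ -> _})).
have [h' h'E] := inj_extend h inj_j.
have [v /ex[v' <-]|k kE] := factor_quot (f := (b \*: g) \- (d c \o h')) ps.
  rewrite /= h'E -hE jE linearZ /=.
  by rewrite -[X in _ - X]/(b *: (a *: g v')) !scalerA mulrC subrr.
exists k => y; have [v <-] := ps y; rewrite kE /= linearB /= dd0 subr0 linearZ /=.
by rewrite -gE.
Qed.

(** If [b] is outside [(x)], a multiple [b'] of it generates a copy [U] of the residue field in
    [W = R / x]. As [b'] kills [Hom(R, w)], it kills [Ext^dim(W, w)]. But multiplication by [b'] on
    [W] is a surjection onto [U] followed by the inclusion; on [Ext^dim] the inclusion induces an
    onto map and the surjection an injective one, so [Ext^dim(U, w)] would vanish. *)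
Lemma can_ann_sub (b : R) : (forall v : w, b *: v = 0) -> seq_mul x (b : R^o).
Proof.
move=> bw; apply: contrapT => nb.
have [W xW] := wreg_regquot xR; have [p [ps pP]] := regquot_map xW.
have fW : fin_gen W by exact: fin_gen_surj ps (fin_gen_reg R).
have Wx (a : R^o) (n : W) : seq_mul x a -> (a : R) *: n = 0.
  move=> xa; have [r <-] := ps n; rewrite -linearZ; apply/pP.
  by rewrite /GRing.scale /= mulrC; apply: (submodPZ (submodP_seq_mul x R^o)).
have pE (r : R) : p (r : R^o) = r *: p 1.
  by rewrite -linearZ /GRing.scale /= mulr1.
have [||c [cb mc]] := simple_multiple noeR (m := m) (v := p (b : R^o)) _ _.
- exact: (regquot_prime noeR locR kd xR xd xW).
- by move/pP.
pose b' := c * b.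
have b'w (v : w) : b' *: v = 0 by rewrite -scalerA bw scaler0.
have nb'0 : b' *: p 1 <> 0 by rewrite -scalerA -pE.
have mb' a : a \in m -> a *: (b' *: p 1) = 0.
  by move=> am; rewrite -[b' *: _]scalerA -pE mc.
have [U [C [j [q [u0 [jq ju0 u0U]]]]]] := ses_line (b' *: p 1).
have [inj_j ex qs] := jq.
have su0 : simple_by m u0.
  split=> // [u00|a am]; first by apply: nb'0; rewrite -ju0 u00 linear0.
  by apply: inj_j; rewrite linear0 linearZ /= ju0 mb'.
apply: (can_ext0_top su0) => f0 f0Z.
have [|f fZ fE] := cocyc_extend jq _ f0Z.
  apply: (can_ext0_gt) => //.
  exact: fin_gen_surj qs fW.
have kill : cobound (b' *: f).
  have xdE : (dim = 0 + size x)%N by rewrite add0n xd.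
  move: (f) (fZ); rewrite xdE; apply: (ext_kill (c := 0) xW) => [[//|i] _|h hZ].
    by apply: ext0_projective; exact: projective_reg.
  apply/cobound0; apply: HomP => r; rewrite -[LHS]/(b' *: h r).
  have [v vE] := (@ir_exact0 _ _ E _).1 (hZ r).
  by rewrite -vE -linearZ b'w linear0.
case: kill => g gE.
have [b0 b0E] := mulmap W b'.
(* [be] is multiplication by [b'] on [W], with values in [U]. *)
have [n|be beE] := factor_sub (f := b0) inj_j.
  have [r <-] := ps n; exists (r *: u0).
  by rewrite linearZ /= ju0 b0E [p r]pE !scalerA mulrC.
have bes : surjective be.
  move=> u; have [r ->] := u0U u; exists (p (r : R^o)); apply: inj_j.
  by rewrite beE b0E linearZ /= ju0 [p r]pE !scalerA mulrC.
have [K [ka kabe]] := ses_sub bes; have [inj_ka exk _] := kabe.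
have fK : fin_gen K by exact: (fin_gen_inj noeR inj_ka fW).
(* The kernel [K] of [be] is killed by [x], so [Ext^(dim-1)(K, w) = 0] and a coboundary corrects [g]
   so as to vanish on [K]; for [dim = 0] the target [E 0] is zero. *)
have [g' [g'K g'E]] : exists g' : {linear W -> E dim},
    (forall n, be n = 0 -> g' n = 0) /\ forall n, d dim (g' n) = d dim (g n).
  have xK : forall i, (i < dim)%N -> ext0 E i K.
    apply: (can_ext0_lt fK) => a xa v.
    by apply: inj_ka; rewrite linear0 linearZ /= Wx.
  have gK n : be n = 0 -> d dim (g n) = 0.
    move=> ben; rewrite -gE -[LHS]/(b' *: (f : {linear _ -> _}) n) -linearZ -b0E -beE ben.
    by rewrite !linear0.
  clear - xK gK g kabe; case: (dim) g xK gK => [|k] g xK gK.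
    by exists g; split=> // n _; exact: ir_zero.
  have [inj_ka exk _] := kabe.
  have [v|h hE] := xK k (ltnSn k) (precomp ka (g : HomR _ _)).
    by apply: gK; exact: (ses_comp0 v kabe).
  have [h' h'E] := inj_extend h inj_ka.
  exists (g \- (d k \o h')); split=> [n /exk[v <-]|n].
    by rewrite /= h'E -hE; exact: subrr.
  by rewrite /= linearB /= dd0 subr0.
have [g'' g''E] := factor_quot bes g'K.
exists g'' => u; have [n <-] := bes u; rewrite g''E g'E -gE.
rewrite -[LHS]/(ev (be n) f0) -fE beE b0E.
by rewrite /ev linearZ.
Qed.

(** The working form of [CM]: it passes to syzygies at once, whereas its equivalence with [CM] rests
    on biduality. *)
Definition ext_acyclic A : Prop := fin_gen A /\ forall i, (0 < i)%N -> ext0 E i A.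

Lemma acyclic_syz K A n (i : {linear K -> 'rV[R]_n}) (p : {linear 'rV[R]_n -> A}) :
  ses i p -> ext_acyclic A -> ext_acyclic K.
Proof.
move=> ip [fA xA]; have [inj_i _ _] := ip; split.
  exact: (fin_gen_inj noeR inj_i (fin_gen_rV _ n)).
move=> [//|k] _; apply: (ext0_sub ip); last exact: xA.
exact: ext0_projective (projective_rV (n := n)).
Qed.

Lemma acyclic_ses_Hom K V A (i : {linear K -> V}) (p : {linear V -> A}) :
  ses i p -> ext_acyclic A -> ses (precomp (W := w) p) (precomp (W := w) i).
Proof.
move=> ip [_ xA]; have [inj_i ex ps] := ip; split.
- move=> f g fg; apply: HomP => y; have [v <-] := ps y.
  exact: (congr1 (ev v) fg).
- move=> f; split=> [fi|[g <-]].
    have [v /ex[u <-]|g gE] := factor_quot (f := (f : {linear _ -> _})) ps.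
      exact: (congr1 (ev u) fi).
    by exists g; apply: HomP => v; rewrite /= gE.
  by apply: HomP => u; rewrite /= (ses_comp0 u ip) linear0.
- move=> f; have [g gE] := Hom_extend (f : {linear _ -> _}) ip (xA 1%N isT).
  by exists g; apply: HomP => u; rewrite /= gE.
Qed.

(** Dualizing [0 -> K -> R^n -> A -> 0] makes [Hom(A, w)] the kernel of a surjection
    [w^n -> Hom(K, w)], so the depth lemma lengthens the prefix by one. As [K] is again acyclic, the
    induction runs over all [A]. *)
Lemma wreg_Hom k A : ext_acyclic A -> (k <= size x)%N -> wreg (take k x) (HomR A w).
Proof.
suff H l : (l <= k)%N -> forall A, ext_acyclic A -> (k <= size x)%N ->
    wreg (take l x) (HomR A w) by exact: H.
elim: l {-2}l (leqnn l) => [|n IHn] l ln lk {}A xA kx.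
  by move: ln; rewrite leqn0 => /eqP ->; rewrite take0.
have [fA _] := xA; have [N [p ps]] := (fin_genP _).1 fA.
have [K [i ip]] := ses_sub ps; have xK := acyclic_syz ip xA.
apply: (wreg_syz (acyclic_ses_Hom ip xA)).
  apply: wreg_take; apply: (wreg_coord (W := w) (c := fun l => ev (delta_mx 0 l))
    (e := fun l => @coordmap R N w l)); last exact: can_wreg.
  exact: coordmap_sum.
rewrite size_takel ?(leq_trans lk) // => j jl.
rewrite take_takel ?(ltnW jl) //; apply: IHn => //; last by rewrite (leq_trans (ltnW jl)).
by rewrite -ltnS (leq_trans jl).
Qed.

Lemma acyclic_Hom A : ext_acyclic A -> ext_acyclic (HomR A w).
Proof.
move=> xA.
have fD : fin_gen (HomR A w) by case: xA => fA _; exact: (fin_gen_Hom noeR fA fw).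
split=> //; apply: (can_ext0_CM).
apply: (wreg_CM noeR locR kd xm xd fD).
by rewrite -[x]take_size; apply: wreg_Hom.
Qed.

(** The annihilator [I] of [w] is the kernel of the surjection [R -> Hom(w, w)]. As [x] is regular
    on [Hom(w, w)], purity turns the inclusion of [I] in [(x)] into [I = x I], and Nakayama's lemma
    applies. *)
Lemma can_faithful (b : R) : (forall v : w, b *: v = 0) -> b = 0.
Proof.
have hI : submodP (fun b : R^o => forall v : w, (b : R) *: v = 0).
  split=> [v|a r s rw sw v]; first by rewrite scale0r.
  by rewrite scalerDl -scalerA rw sw scaler0 addr0.
have [I [i [inj_i iP]]] := submod_sub hI.
have aw : ext_acyclic w.
  split; first by case: cmw.
  exact: (can_ext0_CM).
have [q qE] : exists q : {linear R^o -> HomR w w},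
    forall (r : R^o) v, ev v (q r) = (r : R) *: v.
  have [r|a r r' _ _ -> ->|_ ->|q qE] := linear_graph (U := R^o)
      (r := fun r (h : HomR w w) => h = (r : R) *: (idfun : HomR w w)).
  - by eexists.
  - by rewrite scalerDl scalerA.
  - by rewrite scale0r.
  by exists q => r v; have -> := (qE r _).1 erefl.
have iq : ses i q.
  split=> // [r|f].
    rewrite -iP; split=> [q0 v|rw]; first by rewrite -qE q0.
    by apply: HomP => v; rewrite -[LHS]/(ev v _) qE rw.
  have [r rE] := can_Hom_scalar f.
  by exists r; apply: HomP => v; rewrite -[LHS]/(ev v _) qE -rE.
have fI : fin_gen I by exact: (fin_gen_inj noeR inj_i (fin_gen_reg R)).
have I0 : forall y : I, y = 0.
  apply: (nakayama noeR locR fI) => y; apply: (seq_mul_mspan xm).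
  apply: (seq_mul_pure iq).
    by rewrite -[x]take_size; apply: wreg_Hom.
  by apply: can_ann_sub => v; have /iP : exists u, i u = i y by [exists y]; exact.
move=> /iP[u <-]; rewrite (I0 u); exact: linear0.
Qed.

(** [Hom(A, w)] sits in [w^n] with quotient [Hom(K, w)], so [psi] extends to [w^n], where each
    coordinate is an endomorphism of [w], that is, a scalar. *)
Lemma bidual_surj A (psi : {linear HomR A w -> w}) : ext_acyclic A ->
  exists a, forall f, psi f = ev a f.
Proof.
move=> xA; have [fA _] := xA; have [n [p ps]] := (fin_genP _).1 fA.
have [K [i ip]] := ses_sub ps; have xK := acyclic_syz ip xA.
have [_ xDK] := acyclic_Hom xK.
have [Psi PsiE] := Hom_extend psi (acyclic_ses_Hom ip xA) (xDK 1%N isT).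
have /choice[r rE] (l : 'I_n) : exists r : R, forall v : w, Psi (coordmap l v) = r *: v.
  have [r rE] := can_Hom_scalar
    (Psi \o (@coordmap R n w l)).
  by exists r => v; rewrite -rE.
exists (p (\row_l r l)) => f; rewrite -PsiE [X in Psi X]coordmap_sum linear_sum.
rewrite -[RHS]/(ev (\row_l r l) (precomp p f)) [X in _ = ev _ X]coordmap_sum linear_sum.
by apply: eq_bigr => l _; rewrite rE; apply: etrans (esym (coordmapE _ _ _)); rewrite mxE.
Qed.

(** Evaluation at a lift [u] of [a] vanishes on [Hom(A, w)], so it induces a functional on
    [Hom(K, w)], which is evaluation at some [k]. Every map [R^n -> w] then kills [u - i k], whose
    coordinates vanish by faithfulness. *)
Lemma bidual_inj A (a : A) : ext_acyclic A -> (forall f : HomR A w, ev a f = 0) -> a = 0.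
Proof.
move=> xA a0; have [fA _] := xA; have [n [p ps]] := (fin_genP _).1 fA.
have [K [i ip]] := ses_sub ps; have xK := acyclic_syz ip xA.
have Dip := acyclic_ses_Hom ip xA; have [_ Dex Dps] := Dip.
have [u ua] := ps a.
have [h /Dex[f <-]|psi psiE] := factor_quot (f := @ev R 'rV[R]_n w u) Dps.
  by rewrite -[LHS]/(ev (p u) f) ua.
have [k kE] := bidual_surj psi xK.
suff uk : u = i k by rewrite -ua uk (ses_comp0 k ip).
apply/eqP; rewrite -subr_eq0; apply/eqP/rowP => l; rewrite [RHS]mxE; apply: can_faithful => v.
have := psiE (coordmap l v); rewrite kE -[LHS]/(ev (i k) (coordmap l v)) !coordmapE.
rewrite !mxE scalerBl => ->; apply/eqP; rewrite subr_eq0.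
exact/eqP/esym/coordmapE.
Qed.

Lemma bidual_iso A : ext_acyclic A ->
  exists (be : {linear A -> HomR (HomR A w) w}) (e : {linear HomR (HomR A w) w -> A}),
    [/\ forall a f, ev f (be a) = ev a f, cancel be e & cancel e be].
Proof.
move=> xA.
have [be beE] : exists be : {linear A -> HomR (HomR A w) w},
    forall a f, ev f (be a) = ev a f.
  have [a|c a a' _ _ -> ->|_ ->|be beE] := linear_graph (U := A)
      (r := fun a (h : HomR (HomR A w) w) => h = @ev R A w a).
  - by eexists.
  - apply: HomP => f; rewrite -[LHS]/(c *: ev a f + ev a' f).
    by rewrite -[RHS]/(ev (c *: a + a') f) /ev linearP.
  - by apply: HomP => f; rewrite -[LHS]/(ev 0 f) /ev linear0.
  by exists be => a f; have -> := (beE a _).1 erefl.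
have inj_be : injective be.
  move=> a b ab; apply/eqP; rewrite -subr_eq0; apply/eqP/(bidual_inj xA) => f.
  by rewrite -beE linearB /= ab subrr.
have [psi|e eE] := factor_sub (f := idfun : {linear HomR (HomR A w) w -> _}) inj_be.
  have [a aE] := bidual_surj psi xA; exists a; apply: HomP => f.
  by rewrite -[LHS]/(ev f _) beE -aE.
by exists be, e; split=> // a; apply: inj_be; rewrite eE.
Qed.

(** An acyclic [A] is isomorphic to its bidual, on which [x] is weakly regular. *)
Lemma acyclic_CM A : ext_acyclic A <-> CM m A.
Proof.
split=> [xA|cA]; last first.
  split; first by case: cA.
  exact: (can_ext0_CM).
have [fA _] := xA; apply: (wreg_CM noeR locR kd xm xd fA).
have sDD : wreg x (HomR (HomR A w) w).
  by rewrite -[x]take_size; apply: wreg_Hom => //; exact: acyclic_Hom.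
have [be [e [_ beK _]]] := bidual_iso xA.
apply: (wreg_coord (n := 1) (c := fun=> be) (e := fun=> e)) sDD => a.
by rewrite big_ord1 beK.
Qed.

End Canonical.

(** * Annihilators of Ext and of stable endomorphisms *)

Section StableAnnihilator.
Variable R : comNzRingType.
Implicit Types U V W N K P M A Q G : lmodType R.

Lemma ann_Ext M (F : resolution M) N i r : ann (Ext F N i) r <->
  forall f : HomR (res_mod F i) N, rcocyc f -> is_coboundary (r *: f).
Proof.
have pi0 (u : submodule (@cocycle _ _ F N i)) :
    r *: quotmodule_pi (@coboundary _ _ F N i) u = 0 <-> is_coboundary (r *: val u).
  rewrite -linearZ -(linear0 (quotmodule_pi (@coboundary _ _ F N i))).
  rewrite -quotmodule_piP subr0 -[is_coboundary _]/(is_coboundary (val (r *: u))).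
  by split=> [/asboolP|] //; move=> h; exact/asboolP.
split=> [annr f fZ|h v].
  have fb : f \in @cocycle _ _ F N i by exact/asboolP.
  exact/(pi0 (exist _ f fb))/annr.
rewrite -(quotmodule_reprK v); apply/pi0/h.
by have /asboolP := valP (repr (v : Quotient.quot (submod_pred (@coboundary _ _ F N i)))).
Qed.

Lemma ann_stable_End M r :
  ann (stable_End M) r <-> factors_proj (r *: (idfun : HomR M M)).
Proof.
have pi0 (f : HomR M M) :
    r *: quotmodule_pi (@proj_endo _ M) f = 0 <-> factors_proj (r *: f).
  rewrite -linearZ -(linear0 (quotmodule_pi (@proj_endo _ M))).
  by rewrite -quotmodule_piP subr0; split=> [/asboolP|] //; move=> h; exact/asboolP.
split=> [annr|[P [a [b [fP pP rE]]]] v]; first exact/pi0/annr.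
rewrite -(quotmodule_reprK v); apply/pi0.
set f := repr _; exists P, (a \o (f : HomR M M)), b; split=> // y.
by rewrite /= -[RHS]/(b (a (ev y f))) -rE.
Qed.

(** The map [r - i g] vanishes on [K], hence descends to a map [A -> P] whose composite with [p] is
    [r]. *)
Lemma factors_proj_extend K P A (i : {linear K -> P}) (p : {linear P -> A})
    (g : {linear P -> K}) r :
  ses i p -> fin_gen P -> projective P -> (forall y, g (i y) = r *: y) ->
  factors_proj (r *: (idfun : HomR A A)).
Proof.
move=> ip fP pP gi; have [inj_i ex ps] := ip.
have [j jE] := mulmap P r.
have [v /ex[y <-]|s sE] := factor_quot (f := j \- (i \o g)) ps.
  by rewrite /= gi jE linearZ subrr.
exists P, s, p; split=> // a; have [v <-] := ps a.
by rewrite sE linearB /= (ses_comp0 _ ip) subr0 jE linearZ.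
Qed.

End StableAnnihilator.

(** * The two inclusions between the annihilators *)

Section CohomologyAnnihilator.
Variables (R : comNzRingType) (m : idealr R).
Implicit Types U V W N K P M A Q G : lmodType R.
Variables (dim : nat) (x : seq R).
Hypotheses (noeR : noetherian R) (locR : local_ring m).
Hypotheses (kd : krull_dim R dim) (xm : {subset x <= m}) (xR : wreg x R^o)
  (xd : size x = dim).

(** Each step of the resolution lengthens the regular prefix by one, by the depth lemma. *)
Lemma coker_wreg M (F : resolution M) j Q (q : {linear res_mod F j -> Q}) :
  surjective q -> exact (res_d F j) q -> wreg (take j x) Q.
Proof.
elim: j Q q => [|j IHj] Q q qs ex; first by rewrite take0.
have [Q0 [q0 [q0s q0P]]] := submod_quot (submodP_im (res_d F j)).
have [v /ex[u <-]|i iE] := factor_quot (f := res_d F j) qs; first exact: res_dd.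
have iq : ses i q0.
  split=> // [y y'|y].
    have [v <-] := qs y; have [v' <-] := qs y'; rewrite !iE => dvv'.
    apply/eqP; rewrite -subr_eq0 -linearB; apply/eqP/ex/res_exactS.
    by rewrite linearB /= dvv' subrr.
  rewrite -q0P; split=> [[u <-]|[u <-]]; first by exists (q u); rewrite iE.
  by have [v <-] := qs u; exists v; rewrite iE.
have ex0 : exact (res_d F j) q0 by move=> y; rewrite -q0P.
apply: (wreg_syz iq).
  by apply/wreg_take/wreg_projective; [|exact: res_fin_gen|exact: res_projective].
move=> l; rewrite size_take_min ltn_min ltnS => /andP[lj _].
rewrite take_takel ?leqW // -(take_takel _ lj).
by apply: wreg_take; exact: IHj ex0.
Qed.

Lemma stable_ann_sub_ca r : stable_ann (CM m) r -> ca R r.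
Proof.
(* The cokernel [Q] of [res_d F k] is maximal Cohen-Macaulay for [k] at least [dim], and Ext of [M]
   in degree [k + 1] is [Ext^1(Q, N)]; hence the bound [dim.+1]. *)
move=> hr; exists dim.+1 => // -[//|k] dk M N fM fN F.
apply/ann_Ext => f fZ.
have [Q [q [qs qP]]] := submod_quot (submodP_im (res_d F k)).
have exq : exact (res_d F k) q by move=> y; rewrite -qP.
have cQ : CM m Q.
  apply: (wreg_CM noeR locR kd xm xd); first exact: fin_gen_surj qs (res_fin_gen F k).
  by rewrite -[x](@take_oversize _ k) ?xd //; exact: coker_wreg exq.
have /ann_stable_End[P [a [b [fP pP rE]]]] := hr Q cQ.
have [b' b'E] := pP _ _ q b qs.
have [I [j [inj_j jP]]] := submod_sub (submodP_im (res_d F k)).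
have [z|d' d'E] := factor_sub (f := res_d F k) inj_j; first by apply/jP; exists z.
have d's : surjective d'.
  move=> y; have /jP[z zE] : exists u, j u = j y by exists y.
  by exists z; apply: inj_j; rewrite d'E.
have [z d'z|f' f'E] := factor_quot (f := (f : {linear _ -> _})) d's.
  have /res_exactS[z' <-] : res_d F k z = 0 by rewrite -d'E d'z linear0.
  exact: fZ.
have [mu muE] := mulmap (res_mod F k) r.
(* [r] minus its factorization through [P] maps into the image of [res_d F k], on which [f] induces
   [f']. *)
have [v|rho rhoE] := factor_sub (f := mu \- (b' \o a \o q)) inj_j.
  apply/jP/exq; rewrite linearB /= b'E -rE muE linearZ; exact: subrr.
exists (f' \o rho) => z /=.
have -> : rho (res_d F k z) = r *: d' z.
  apply: inj_j; rewrite rhoE /= muE (iffRL (exq _)); last by exists z.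
  by rewrite !linear0 addr0 linearZ /= d'E.
by rewrite linearZ /= f'E.
Qed.

Variables (w : lmodType R) (E : injres w).
Hypothesis Efin : exists n, forall i, (n < i)%N -> forall y : E i, y = 0.
Hypotheses (cmw : CM m w) (tyw : type_one m w).
Hypothesis hD : forall M, OmegaCMx m M -> OmegaCMx m (HomR M w).

Let acyclicP A : ext_acyclic E A <-> CM m A :=
  acyclic_CM noeR locR kd xm xR xd Efin cmw tyw A.

(** If [K] had a free summand, a coordinate of it times [v] would be a map [K -> w] attaining [v].
    Extended to [R^n], it is evaluated at a vector with entries in [m], so [w = m w]. *)
Lemma minimal_syz_OmegaCMx K A n (i : {linear K -> 'rV[R]_n})
    (p : {linear 'rV[R]_n -> A}) :
  ses i p -> (forall u j, i u 0 j \in m) -> CM m A -> OmegaCMx m K.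
Proof.
move=> ip im cA; have [inj_i ex ps] := ip; split.
  exists A; split=> //; exists 'rV[R]_n, i, p; split=> //.
  by split; [exact: fin_gen_rV|exact: projective_rV].
move=> [//|k] N [f [f' fK f'K]]; exfalso.
apply: (can_not_mspan noeR locR cmw tyw) => v.
have [g gE] : exists g : {linear K -> w}, forall b, g b = (f b).1 0 0 *: v.
  have [b|c b b' _ _ -> ->|_ ->|g gE] := linear_graph (U := K)
      (r := fun b z => z = (f b).1 0 0 *: v).
  - by eexists.
  - by rewrite linearP !mxE scalerDl scalerA.
  - by rewrite linear0 mxE scale0r.
  by exists g => b; apply/gE.
have [_ /(_ 1%N isT) xA] := (acyclicP A).2 cA.
have [h hE] := Hom_extend g ip xA.
have <- : g (f' (delta_mx 0 0, 0)) = v by rewrite gE f'K /= mxE !eqxx scale1r.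
rewrite -hE linear_comb.
exists n, (i (f' (delta_mx 0 0, 0))), (fun j => h (delta_mx 0 j)); split=> //.
Qed.

(** [Hom(G, w)] is a summand of [w^c], so the extension is found coordinate by coordinate. *)
Lemma Hom_valued_extend K V A G (i : {linear K -> V}) (p : {linear V -> A})
    (f : {linear K -> HomR G w}) :
  ses i p -> ext0 E 1 A -> fin_gen G -> projective G ->
  exists g : {linear V -> HomR G w}, forall y, g (i y) = f y.
Proof.
move=> ip xA /fin_genP[c [pi pis]] prG.
have [sg sgE] := prG _ _ pi idfun pis.
have /choice[e eE] (l : 'I_c) : exists e : {linear V -> w},
    forall y, e (i y) = ev (pi (delta_mx 0 l)) (f y).
  by have [e eE] := Hom_extend (ev (pi (delta_mx 0 l)) \o f) ip xA; exists e.
pose F v : HomR G w := precomp sg (\sum_l coordmap l (e l v)).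
have [v|a v v' _ _ -> ->|_ ->|g gE] := linear_graph (U := V) (r := fun v z => z = F v).
- by eexists.
- rewrite /F -linearP; congr (precomp _ _); rewrite scaler_sumr -big_split /=.
  by apply: eq_bigr => l _; rewrite !linearP.
- by rewrite /F big1 ?linear0 // => l _; rewrite !linear0.
exists g => y; have -> := (gE (i y) _).1 erefl.
have -> : F (i y) = precomp sg (precomp pi (f y)).
  rewrite [precomp pi (f y)]coordmap_sum; congr (precomp _ _).
  by apply: eq_bigr => l _; rewrite eE.
by apply: HomP => z; rewrite /= sgE.
Qed.

Lemma ca_sub_stable_ann r : ca R r -> stable_ann (CM m) r.
Proof.
move=> [[//|k] _ rk] A0 cA0; have [fA0 _] := cA0.
have [K [n [i [p [K0 ip fK im]]]]] := minimal_resolution noeR locR fA0.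
case: _ / K0 in cA0 fA0 *.
have xK j : ext_acyclic E (K j).
  elim: j => [|j IHj]; first exact/acyclicP.
  exact: acyclic_syz (ip j) IHj.
have stab0 : factors_proj (r *: (idfun : HomR (K k) (K k))).
  (* The cocycle [p k.+1] represents the class of [0 -> K k.+1 -> R^(n k) -> K k -> 0]. *)
  have /ann_Ext/(_ (p k.+1)) := rk k.+1 (leqnn _) _ _ (fK 0%N) (fK k.+1) (splice ip).
  case=> [z|g gE].
    by rewrite /ev /= (ses_comp0 _ (ip k.+1)).
  apply: (factors_proj_extend (g := g) (ip k) (fin_gen_rV _ _)) => [|y].
    exact: projective_rV.
  have [_ _ ps] := ip k.+1; have [z <-] := ps y; exact/esym/gE.
apply/ann_stable_End.
elim: k stab0 {rk} => [//|j IHj] [Q [be [al [fQ pQ rE]]]]; apply: IHj.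
have [omB _] := hD (minimal_syz_OmegaCMx (ip j) (im j) ((acyclicP _).1 (xK j))).
have [Y [cY [G [i' [p' [[fG pG] inj_i' ex' ps']]]]]] := omB.
have [_ /(_ 1%N isT) xY] := (acyclicP Y).2 cY.
have [bi [e [biE biK eK]]] := bidual_iso noeR locR kd xm xR xd Efin cmw tyw (xK j.+1).
have ip' : ses i' p' by split.
(* Projectivity of [Q] lifts [al] to [Hom(G, w)] once [K j.+1] is read as its bidual. *)
have [q|al' al'E] := projective_lift (p := precomp (W := w) i') (g := bi \o al) pQ.
  have [h hE] := Hom_extend (bi (al q) : {linear _ -> _}) ip' xY.
  by exists h; apply: HomP => f; rewrite /= hE.
have [_ /(_ 1%N isT) xKj] := xK j.
have [phi phiE] := Hom_valued_extend (al' \o be) (ip j) xKj fG pG.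
apply: (factors_proj_extend (g := e \o precomp i' \o phi) (ip j) (fin_gen_rV _ _)) => [|y].
  exact: projective_rV.
by rewrite /= phiE /= al'E /= biK -rE.
Qed.

End CohomologyAnnihilator.

Theorem theorem1 (R : comNzRingType) (m : idealr R) (w : lmodType R)
    (hR : CM_local_ring m) (hw : canonical_module m w)
    (hD : forall M : lmodType R, OmegaCMx m M -> OmegaCMx m (HomR M w)) :
  ca R = stable_ann (CM m).
Proof.
have [noeR locR cmR] := hR; have [cmw /finite_injdim_injres[E Efin] tyw] := hw.
have [dim kd] : exists dim, krull_dim R dim.
  (* The Krull dimension is supplied by [CM] of the nonzero module [R]. *)
  have [_ [R0|[n [kn _]]]] := cmR; last by exists n.
  by have /eqP := R0 1; rewrite oner_eq0.
have [x [xm xR xd]] := CM_wreg kd cmR.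
apply/predeqP => r; split.
  exact: (ca_sub_stable_ann noeR locR kd xm xR xd Efin cmw tyw hD).
exact: (stable_ann_sub_ca noeR locR kd xm xR xd).
Qed.
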